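(* Let $d\ge 3$, let $$\gamma_d=\sum_{n=0}^\infty\ \sum_{n_1+\cdots+n_d=n}\binom{n}{n_1,\ldots,n_d}^2 d^{-2n}\in[1,\infty],$$ and let $a>0$ and $b\in\mathbb{C}$ be given. Then there exists a stable degree one symmetric polynomial $p(z_1,\ldots,z_d)$ such that $$\widehat{\frac{1}{|p|^2}}(0,0,\ldots,0)=a,\qquad \widehat{\frac{1}{|p|^2}}(1,0,\ldots,0)=b$$ if and only if $|b|<\left(1-\frac{1}{\gamma_d}\right)a$. In that case, the polynomial $p(z)$ may be found by finding $c\ge0$ such that $$\frac{a(a+(d-1)c)}{a^2+(d-1)ac-d|b|^2}=\frac{1}{(2\pi)^{d-2}}\int_{[0,2\pi]^{d-2}}\frac{1}{\sqrt{g(t_3,\ldots,t_d)}}\,dt_3\cdots dt_d,$$ where $$g(t_3,\ldots,t_d)=\left(1-\frac{2|b|}{a+(d-1)c}\sum_{3\le j\le d}\cos t_j+\frac{|b|^2}{(a+(d-1)c)^2}\sum_{3\le j,k\le d}\cos(t_j-t_k)\right)\times$$ $$\left(1-\frac{2|b|}{a+(d-1)c}\sum_{3\le j\le d}\cos t_j+\frac{|b|^2}{(a+(d-1)c)^2}\Big(-4+\sum_{3\le j,k\le d}\cos(t_j-t_k)\Big)\right),$$ and such that the $(d+1)\times(d+1)$ matrix $$A=\begin{bmatrix} a&\bar b&\bar b&\cdots&\bar b\\ b&a&c&\cdots&c\\ b&c&a&\cdots&c\\ \vdots&\vdots&&\ddots&\vdots\\ b&c&c&\cdots&a\end{bmatrix}$$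 is positive definite (such a $c$ exists). Subsequently, $p(z)=p_0+p_1(z_1+\cdots+z_d)$ is found via the equation $$A\begin{bmatrix}|p_0|^2\\ p_1\overline{p_0}\\ \vdots\\ p_1\overline{p_0}\end{bmatrix}=\begin{bmatrix}1\\0\\ \vdots\\0\end{bmatrix}.$$
   Context: A degree one symmetric polynomial in $d$ variables is a polynomial of the form $p(z_1,\ldots,z_d)=p_0+p_1(z_1+\cdots+z_d)$ with $p_0,p_1\in\mathbb{C}$ (the case $p_1=0$ is allowed). It is called stable if it has no roots in the closed polydisk $\{(z_1,\ldots,z_d)\in\mathbb{C}^d: |z_j|\le 1 \text{ for all } j\}$. For a function $f$ on the torus $\mathbb{T}^d=\{z\in\mathbb{C}^d:|z_j|=1\text{ for all }j\}$, $\widehat f(k)$ denotes its $k$th Fourier coefficient, $k\in\mathbb{Z}^d$, i.e. the coefficient of $z^k=z_1^{k_1}\cdots z_d^{k_d}$ in the Fourier series $f(z)=\sum_{k}\widehat f(k)z^k$. In the definition of $\gamma_d$ the inner sum is over all nonnegative integers $n_1,\ldots,n_d$ with sum $n$, the symbol $\binom{n}{n_1,\ldots,n_d}$ is the multinomial coefficient, and $\frac{1}{\infty}=0$. The matrix $A$ has all diagonal entries $a$, the remaining entries of its first row $\bar b$, the remaining entries of its first column $b$, and all other entries $c$. The integral equation for $c$ is understood to include the requirement that its right-hand side makes sense with real square roots (i.e. $g\ge 0$ and the integral is defined). *)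

(* Defs.v *)
From HB Require Import structures.
From mathcomp Require Import all_boot all_order all_algebra.
From mathcomp Require Import complex.
From mathcomp Require Import all_classical all_reals all_analysis.

Set Implicit Arguments.
Unset Strict Implicit.
Unset Printing Implicit Defensive.

Import Order.TTheory GRing.Theory Num.Theory numFieldNormedType.Exports.

Local Open Scope classical_set_scope.
Local Open Scope ring_scope.
Local Open Scope complex_scope.

(* The modulus as an element of R; `|z| itself has type R[i]. *)
Notation modulus := ComplexField.Normc.normc.

Section cons_measure.
Context {d : measure_display} {T : measurableType d} {R : realType} {n : nat}.
Variable nu : {sigma_finite_measure set T -> \bar R}.
Variable mu : {sigma_finite_measure set (n.-tuple T) -> \bar R}.

Definition tuple_cons (x : T * n.-tuple T) : n.+1.-tuple T :=
  [tuple of x.1 :: x.2].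

Lemma measurable_tuple_cons : measurable_fun [set: T * n.-tuple T] tuple_cons.
Proof. exact: (measurable_cons measurable_fst measurable_snd). Qed.

HB.instance Definition _ :=
  isMeasurableFun.Build _ _ _ _ tuple_cons measurable_tuple_cons.

(* The product measure nu \x mu, transported to n.+1.-tuple T. *)
Definition cons_measure : set (n.+1.-tuple T) -> \bar R :=
  pushforward (nu \x mu)%E tuple_cons.

Let cons_measure0 : cons_measure set0 = 0%E.
Proof. exact: measure0. Qed.

Let cons_measure_ge0 A : (0 <= cons_measure A)%E.
Proof. exact: measure_ge0. Qed.

Let cons_measure_sigma_additive : semi_sigma_additive cons_measure.
Proof. exact: measure_semi_sigma_additive. Qed.

HB.instance Definition _ := isMeasure.Build _ _ _ cons_measure
  cons_measure0 cons_measure_ge0 cons_measure_sigma_additive.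

Lemma cons_measure_sigma_finite : sigma_finite setT cons_measure.
Proof.
have /sigma_finiteP[F [FT ndF Foo]] := sigma_finiteT nu.
have /sigma_finiteP[G [GT ndG Goo]] := sigma_finiteT mu.
pose u (t : n.+1.-tuple T) : T * n.-tuple T := (thead t, [tuple of behead t]).
have mu_ : measurable_fun setT u.
  apply/measurable_fun_pairP; split; first exact: measurable_tnth.
  exact: measurable_behead.
have uK : u \o tuple_cons = id.
  by apply/funext => -[x t]; congr pair => /=; exact: val_inj.
exists (fun k => u @^-1` (F k `*` G k)).
  apply/esym; rewrite -subTset => t _.
  have [i _ Fi] : (\bigcup_i F i) (thead t) by rewrite -FT.
  have [j _ Gj] : (\bigcup_i G i) [tuple of behead t] by rewrite -GT.
  exists (maxn i j) => //; split.
    by move: Fi; exact/subsetPset/ndF/leq_maxl.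
  by move: Gj; exact/subsetPset/ndG/leq_maxr.
move=> k; have [mFk Fkoo] := Foo k; have [mGk Gkoo] := Goo k; split.
  by rewrite -[_ @^-1` _]setTI; apply: mu_ => //; exact: measurableX.
rewrite /cons_measure /pushforward -comp_preimage uK.
by rewrite product_measure1E// lte_mul_pinfty// ge0_fin_numE.
Qed.

HB.instance Definition _ :=
  Measure_isSigmaFinite.Build _ _ _ cons_measure cons_measure_sigma_finite.

End cons_measure.

(* Lebesgue measure on R^n. *)
Fixpoint lebesgue_tuple (R : realType) (n : nat) :
    {sigma_finite_measure set (n.-tuple (measurableTypeR R)) -> \bar R} :=
  match n with
  | 0 => \d_[tuple]
  | m.+1 => cons_measure lebesgue_measure (lebesgue_tuple R m)
  end.

Section torus.
Variable R : realType.
Local Notation C := R[i].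

(* [0, 2 pi]^n *)
Definition cube (n : nat) : set (n.-tuple (measurableTypeR R)) :=
  [set t | forall j, tnth t j \in `[0, 2 * pi]].
Arguments cube n : clear implicits.

Definition expi (x : R) : C := cos x +i* sin x.

(* k-th Fourier coefficient of a function on the torus T^d:
   (2 pi)^(-d) times the integral over [0, 2 pi]^d of
   f(e^(i t_1), ..., e^(i t_d)) e^(-i (k_1 t_1 + ... + k_d t_d)). *)
Definition fourier_coef (d : nat) (f : ('I_d -> C) -> C) (k : 'I_d -> int) : C :=
  let h (t : d.-tuple (measurableTypeR R)) : C :=
    f (fun j => expi (tnth t j)) * expi (- \sum_(j < d) (k j)%:~R * tnth t j) in
  ((2 * pi) ^- d)%:C *
    ((\int[lebesgue_tuple R d]_(t in cube d) complex.Re (h t))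
     +i* (\int[lebesgue_tuple R d]_(t in cube d) complex.Im (h t))).

(* The degree one symmetric polynomial with coefficients p0 and p1. *)
Definition deg1_sympoly (d : nat) (p0 p1 : C) (z : 'I_d -> C) : C :=
  p0 + p1 * \sum_(j < d) z j.

Definition stable (d : nat) (p : ('I_d -> C) -> C) : Prop :=
  forall z : 'I_d -> C, (forall j, `|z j| <= 1) -> p z != 0.

Definition inv_sqr_modulus (d : nat) (p : ('I_d -> C) -> C) (z : 'I_d -> C) : C :=
  (`|p z| ^+ 2)^-1.

(* The multi-index (1, 0, ..., 0). *)
Definition first_index (d : nat) (j : 'I_d) : int := (j == 0 :> nat)%:Z.

Definition solves_moments (d : nat) (a : R) (b : C) (p : ('I_d -> C) -> C) : Prop :=
  [/\ stable p,
      fourier_coef (inv_sqr_modulus p) (fun=> 0) = a%:C &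
      fourier_coef (inv_sqr_modulus p) (@first_index d) = b].

(* The division is exact. *)
Definition multinomial (d : nat) (k : 'I_d -> nat) : nat :=
  (\sum_(j < d) k j)`! %/ \prod_(j < d) (k j)`!.

Definition gamma (d : nat) : \bar R :=
  (\sum_(0 <= n <oo)
    (\sum_(k : {ffun 'I_d -> 'I_n.+1} | (\sum_(j < d) k j == n)%N)
      (multinomial (fun j => k j))%:R ^+ 2 * d%:R ^- (2 * n))%:E)%E.

(* The index j < d - 2 stands for the variable t_(j + 3). *)
Definition gfun (d : nat) (a : R) (b : C) (c : R)
    (t : (d - 2).-tuple (measurableTypeR R)) : R :=
  let s := a + (d - 1)%:R * c in
  let S1 : R := \sum_(j < d - 2) cos (tnth t j) in
  let S2 : R := \sum_(j < d - 2) \sum_(k < d - 2) cos (tnth t j - tnth t k) in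
  (1 - 2 * modulus b / s * S1 + modulus b ^+ 2 / s ^+ 2 * S2) *
  (1 - 2 * modulus b / s * S1 + modulus b ^+ 2 / s ^+ 2 * (- 4 + S2)).

(* The inverse is taken in the extended reals, where 0^-1 = +oo. *)
Definition inv_sqrt_gfun (d : nat) (a : R) (b : C) (c : R)
    (t : (d - 2).-tuple (measurableTypeR R)) : \bar R :=
  ((Num.sqrt (gfun a b c t))%:E^-1)%E.

Definition integral_equation (d : nat) (a : R) (b : C) (c : R) : Prop :=
  [/\ forall t, cube (d - 2) t -> 0 <= gfun a b c t,
      (lebesgue_tuple R (d - 2)).-integrable (cube (d - 2))
        (@inv_sqrt_gfun d a b c) &
      ((a * (a + (d - 1)%:R * c) /
          (a ^+ 2 + (d - 1)%:R * a * c - d%:R * modulus b ^+ 2))%:E =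
       ((2 * pi) ^- (d - 2))%:E *
         \int[lebesgue_tuple R (d - 2)]_(t in cube (d - 2))
           inv_sqrt_gfun a b c t)%E].

Definition moment_matrix (d : nat) (a : R) (b : C) (c : R) : 'M[C]_(1 + d) :=
  block_mx a%:C%:M (const_mx (b^*)%R)
           (const_mx b) (\matrix_(i, j) (if i == j then a else c)%:C).

Definition posdefmx (n : nat) (A : 'M[C]_n) : Prop :=
  A \is hermsymmx /\
  forall x : 'cV[C]_n, x != 0 -> 0 < (map_mx Num.conj x^T *m A *m x) 0 0.

Definition admissible (d : nat) (a : R) (b : C) (c : R) : Prop :=
  [/\ 0 <= c, integral_equation d a b c & posdefmx (moment_matrix d a b c)].

Definition coef_equation (d : nat) (a : R) (b : C) (c : R) (p0 p1 : C) : Prop :=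
  moment_matrix d a b c *m
    col_mx (`|p0| ^+ 2)%:M (const_mx (p1 * (p0^*)%R)) =
  col_mx 1%:M (0 : 'cV[C]_d).

End torus.

(* Main.v *)
Require Import Defs.
From HB Require Import structures.
From mathcomp Require Import all_boot all_order all_algebra.
From mathcomp Require Import complex.
From mathcomp Require Import all_classical all_reals all_analysis.
From mathcomp Require Import measurable_realfun.
From mathcomp Require Import ring lra.

Set Implicit Arguments.
Unset Strict Implicit.
Unset Printing Implicit Defensive.

Import Order.TTheory GRing.Theory Num.Theory numFieldNormedType.Exports.
Local Open Scope classical_set_scope.
Local Open Scope ring_scope.

(** Write S = z_1 + ... + z_d, p = p_0 (1 - q S) with q = - p_1 / p_0, and
    r = |q|. The polynomial p is stable if and only if d r < 1. Let M_n be the mean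
    of |S|^(2n) over the torus and F(x) = M_0 + M_1 x + M_2 x^2 + ...

    The powers of S are orthogonal on the torus, so expanding 1 / (1 - q S) shows
    that |1 - q S|^(-2) has mean F(r^2), and that 1 / (1 - q S) has mean 1
    ([cmean_inv_sqr_affine], [cmean_inv_affine]). Since M_n is the sum of the
    squared multinomial coefficients ([sum_sqr_multinomial]), gamma_d is the value
    of F, possibly infinite, at 1/d^2. Let A and B be the Fourier coefficients of
    1/|p|^2 at 0 and at (1, 0, ..., 0). Then A = F(r^2) / |p_0|^2, and
    multiplying 1/|p|^2 by p gives, by symmetry between the coordinates,
    d conj(q) B = A - 1/|p_0|^2 ([fourier_coef_relation]). Therefore
    |B| / A = (1 - 1/F(r^2)) / (d r).

    The quotient (1 - 1/F(x)) / x increases with x, being the mean of |S|^2 under the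
    weight 1/(1 - x |S|^2) ([genfun_ratio_le]); hence |B| / A < 1 - 1/gamma_d for
    every stable p ([ratio_lt_gamma]). Conversely, the intermediate value theorem
    gives, for every smaller value of |b| / a, some r < 1/d that produces it
    ([exists_ratio]).

    On the side of the matrix, put s = a + (d - 1) c and rho = |b| / s. For
    d rho < 1, integrating two variables out of |1 - rho S|^(-2) with the Poisson
    kernel turns its mean into the mean of 1 / sqrt g ([mean_inv_sqrt_gpoly]), so
    the integral equation reads a s / (a s - d |b|^2) = F(rho^2), and the linear system
    forces |p_1 / p_0| = rho and |p_0|^2 = s / (a s - d |b|^2). Larger values of
    rho cannot occur: for d rho > 1 the function g takes negative values
    ([gpoly_ge0_radius]), and for d rho = 1 the right-hand side would be at least
    gamma_d, against the hypothesis on b ([admissible_radius]). Choosing c from the r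
    above gives existence; the bounds
    1/(1 - d x) <= F(x) < 1/(1 - d^2 x) for x > 0 give c >= 0 and c < a, which with
    a s > d |b|^2 makes the matrix positive definite ([posdef_moment_matrix]). *)

(** * Bounded measurable functions *)

Section bounded_measurable.
Variable R : realType.

(** Bounded measurable functions: on a set of finite measure they are integrable
    and Fubini's theorem applies to them without further conditions. *)
Definition bmf d (X : measurableType d) (f : X -> R) : Prop :=
  measurable_fun setT f /\ exists M, forall x, `|f x| <= M.

Lemma bmf_cst d (X : measurableType d) (k : R) : bmf (fun _ : X => k).
Proof. by split; [exact: measurable_cst|exists `|k|]. Qed.

Lemma bmfD d (X : measurableType d) (f g : X -> R) :
  bmf f -> bmf g -> bmf (fun x => f x + g x).
Proof.
move=> [mf [A fA]] [mg [B gB]]; split; first exact: measurable_funD.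
by exists (A + B) => x; rewrite (le_trans (ler_normD _ _))// lerD.
Qed.

Lemma bmfM d (X : measurableType d) (f g : X -> R) :
  bmf f -> bmf g -> bmf (fun x => f x * g x).
Proof.
move=> [mf [A fA]] [mg [B gB]]; split; first exact: measurable_funM.
by exists (A * B) => x; rewrite normrM ler_pM.
Qed.

Lemma bmfN d (X : measurableType d) (f : X -> R) :
  bmf f -> bmf (fun x => - f x).
Proof.
move=> [mf [A fA]]; split; first exact: measurableT_comp.
by exists A => x; rewrite normrN.
Qed.

Lemma bmfB d (X : measurableType d) (f g : X -> R) :
  bmf f -> bmf g -> bmf (fun x => f x - g x).
Proof. by move=> mf mg; apply: bmfD => //; exact: bmfN. Qed.

Lemma bmf_sum d (X : measurableType d) I (r : seq I) (P : pred I)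
    (f : I -> X -> R) :
  (forall i, bmf (f i)) -> bmf (fun x => \sum_(i <- r | P i) f i x).
Proof.
move=> mf; elim: r => [|i r IH].
  by under eq_fun do rewrite big_nil; exact: bmf_cst.
under eq_fun do rewrite big_cons.
by case: (P i) => //; exact: bmfD.
Qed.

Lemma bmfX d (X : measurableType d) (f : X -> R) n :
  bmf f -> bmf (fun x => f x ^+ n).
Proof.
move=> mf; elim: n => [|n IH].
  by under eq_fun do rewrite expr0; exact: bmf_cst.
by under eq_fun do rewrite exprS; exact: bmfM.
Qed.

Lemma bmf_comp d d' (X : measurableType d) (Y : measurableType d')
    (h : X -> Y) (f : Y -> R) :
  measurable_fun setT h -> bmf f -> bmf (f \o h).
Proof.
move=> mh [mf [A fA]]; split; first exact: measurableT_comp.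
by exists A => x; exact: fA.
Qed.

Lemma bmf_cos d (X : measurableType d) (h : X -> R) :
  measurable_fun setT h -> bmf (fun x => cos (h x)).
Proof.
move=> mh; split; last by exists 1 => x; exact: cos_max.
apply: measurableT_comp => //.
by apply: continuous_measurable_fun; exact: continuous_cos.
Qed.

Lemma bmf_sin d (X : measurableType d) (h : X -> R) :
  measurable_fun setT h -> bmf (fun x => sin (h x)).
Proof.
move=> mh; split; last by exists 1 => x; exact: sin_max.
apply: measurableT_comp => //.
by apply: continuous_measurable_fun; exact: continuous_sin.
Qed.

Lemma bmf_inv d (X : measurableType d) (f : X -> R) (m : R) :
  0 < m -> (forall x, m <= f x) -> bmf f -> bmf (fun x => (f x)^-1).
Proof.
move=> m0 fm [mf _]; have f0 x : 0 < f x by exact: lt_le_trans (fm x).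
split; last first.
  exists m^-1 => x; rewrite normfV (gtr0_norm (f0 x)).
  by rewrite lef_pV2// posrE.
rewrite (_ : (fun _ => _) = (fun y => y `^ (-1)) \o f); last first.
  by apply/funext => x /=; rewrite powR_inv1// ltW.
exact: measurableT_comp.
Qed.

Lemma bmf_sqrt d (X : measurableType d) (f : X -> R) :
  bmf f -> bmf (fun x => Num.sqrt (f x)).
Proof.
move=> [mf [A fA]]; split; last first.
  exists (Num.sqrt A) => x; rewrite ger0_norm ?sqrtr_ge0//.
  by rewrite ler_wsqrtr// (le_trans (ler_norm _)).
rewrite (_ : (fun _ => _) = (fun y => Num.sqrt y) \o f)//.
apply: measurableT_comp => //.
by apply: continuous_measurable_fun; exact: sqrt_continuous.
Qed.

End bounded_measurable.

(** * Fubini's theorem for bounded functions on sets of finite measure *)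

Section fubini_bounded.
Variable R : realType.
Context d1 d2 (X : measurableType d1) (Y : measurableType d2).
Variables (m1 : {sigma_finite_measure set X -> \bar R})
          (m2 : {sigma_finite_measure set Y -> \bar R}).

Lemma bmf_integrable d (Z : measurableType d) (m : {measure set Z -> \bar R})
    (D : set Z) (f : Z -> R) :
  measurable D -> (m D < +oo)%E -> bmf f -> m.-integrable D (EFin \o f).
Proof.
move=> mD Dfin [mf [M fM]]; apply: measurable_bounded_integrable => //.
  exact: measurable_funTS.
exists M; split; first exact: num_real.
by move=> y My z _ /=; rewrite (le_trans (fM z))// ltW.
Qed.

Variables (D1 : set X) (D2 : set Y).
Hypotheses (mD1 : measurable D1) (mD2 : measurable D2).
Hypotheses (fin1 : (m1 D1 < +oo)%E) (fin2 : (m2 D2 < +oo)%E).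
Variable f : X * Y -> R.
Hypothesis bf : bmf f.

Let g := (EFin \o f) \_ (D1 `*` D2).

Let mD : measurable (D1 `*` D2).
Proof. exact: measurableX. Qed.

Let finD : ((m1 \x m2) (D1 `*` D2) < +oo)%E.
Proof.
rewrite product_measure1E// lte_mul_pinfty//.
by rewrite ge0_fin_numE.
Qed.

Let ig : (m1 \x m2)%E.-integrable setT g.
Proof.
apply/(integrable_mkcond _ mD).
exact: bmf_integrable.
Qed.

Lemma bmf_slice1 x : bmf (fun y => f (x, y)).
Proof.
by apply: (bmf_comp (h := fun y => (x, y))) => //; exact: measurable_fun_pair.
Qed.

Lemma bmf_slice2 y : bmf (fun x => f (x, y)).
Proof.
by apply: (bmf_comp (h := fun x => (x, y))) => //; exact: measurable_fun_pair.
Qed.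

(** The inner integrals are finite, so the real-valued and the extended-real
    integrals agree. *)
Lemma slice1_fineK x :
  (\int[m2]_(y in D2) f (x, y))%:E = (\int[m2]_(y in D2) (f (x, y))%:E)%E.
Proof.
rewrite /Rintegral fineK//; apply: integrable_fin_num => //.
exact: (bmf_integrable mD2 fin2 (bmf_slice1 x)).
Qed.

Lemma slice2_fineK y :
  (\int[m1]_(x in D1) f (x, y))%:E = (\int[m1]_(x in D1) (f (x, y))%:E)%E.
Proof.
rewrite /Rintegral fineK//; apply: integrable_fin_num => //.
exact: (bmf_integrable mD1 fin1 (bmf_slice2 y)).
Qed.

Lemma Rintegral_iterated12 :
  \int[m1]_(x in D1) \int[m2]_(y in D2) f (x, y) =
  \int[(m1 \x m2)%E]_(z in D1 `*` D2) f z.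
Proof.
rewrite {1 3}/Rintegral; congr fine.
rewrite [RHS]integral_mkcond -integral12_prod_meas1// [LHS]integral_mkcond.
apply: eq_integral => x _; rewrite patchE /fubini_F.
case: ifPn => xD; last first.
  rewrite integral0_eq// => y _.
  by rewrite /g patchE in_setX (negbTE xD).
rewrite slice1_fineK [LHS]integral_mkcond.
by apply: eq_integral => y _; rewrite /g !patchE in_setX xD.
Qed.

Lemma Rintegral_iterated21 :
  \int[m2]_(y in D2) \int[m1]_(x in D1) f (x, y) =
  \int[(m1 \x m2)%E]_(z in D1 `*` D2) f z.
Proof.
rewrite {1 3}/Rintegral; congr fine.
rewrite [RHS]integral_mkcond -integral21_prod_meas1// [LHS]integral_mkcond.
apply: eq_integral => y _; rewrite patchE /fubini_G.
case: ifPn => yD; last first.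
  rewrite integral0_eq// => x _.
  by rewrite /g patchE in_setX (negbTE yD) andbF.
rewrite slice2_fineK [LHS]integral_mkcond.
by apply: eq_integral => x _; rewrite /g !patchE in_setX yD andbT.
Qed.

Lemma Rintegral_swap :
  \int[m1]_(x in D1) \int[m2]_(y in D2) f (x, y) =
  \int[m2]_(y in D2) \int[m1]_(x in D1) f (x, y).
Proof. by rewrite Rintegral_iterated12 Rintegral_iterated21. Qed.

End fubini_bounded.

Lemma bmf_Rintegral (R : realType) d1 d2 (X : measurableType d1)
    (Y : measurableType d2) (m2 : {sigma_finite_measure set Y -> \bar R})
    (D2 : set Y) (f : X * Y -> R) :
  measurable D2 -> (m2 D2 < +oo)%E -> bmf f ->
  bmf (fun x => \int[m2]_(y in D2) f (x, y)).
Proof.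
move=> mD2 fin2 bf; split.
- apply/measurable_EFinP => /=.
  rewrite (_ : _ \o _ = fubini_F m2 ((EFin \o f) \_ (setT `*` D2))).
    (* an arbitrary finite measure on X, for which the product is finite *)
    pose m0 : {sigma_finite_measure set X -> \bar R} := \d_(point : X).
    have mD : measurable ([set: X] `*` D2) by exact: measurableX.
    have Dfin : ((m0 \x m2) (setT `*` D2) < +oo)%E.
      rewrite product_measure1E// lte_mul_pinfty// ?ge0_fin_numE//= diracT//.
    apply: (measurable_fubini_F (m1 := m0)).
    by apply/(integrable_mkcond _ mD); exact: bmf_integrable.
  apply/funext => x /=.
  rewrite slice1_fineK// integral_mkcond.
  by apply: eq_integral => y _; rewrite /= !patchE in_setX in_setT.
- have [mf [M fM]] := bf.
  exists (M * fine (m2 D2)) => x.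
  have ix := bmf_integrable mD2 fin2 (bmf_slice1 bf x).
  apply: (le_trans (le_normr_Rintegral mD2 ix)).
  rewrite -(Rintegral_cst m2 mD2 M).
  apply: le_Rintegral => //.
  + exact: integrable_norm.
  + by apply: bmf_integrable => //; exact: bmf_cst.
Qed.

(** * Averages *)

Section average.
Variable R : realType.
Context d (X : measurableType d).
Variables (m : {sigma_finite_measure set X -> \bar R}) (D : set X).

(** The average of [f] over [D], meaningful when the measure of [D] is positive
    and finite. *)
Definition avg (f : X -> R) : R := (fine (m D))^-1 * \int[m]_(x in D) f x.

Lemma eq_avg f g : f =1 g -> avg f = avg g.
Proof. by move=> fg; congr (_ * _); apply: eq_Rintegral => x _; exact: fg. Qed.

Hypotheses (mD : measurable D) (D0 : (0 < m D)%E) (Dfin : (m D < +oo)%E).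

Let finD0 : 0 < fine (m D).
Proof. by rewrite fine_gt0// D0. Qed.

Lemma avg_cst k : avg (fun=> k) = k.
Proof. by rewrite /avg Rintegral_cst// mulrCA mulVf ?mulr1// gt_eqF. Qed.

Lemma avgD f g : bmf f -> bmf g -> avg (fun x => f x + g x) = avg f + avg g.
Proof.
by move=> bf bg; rewrite /avg RintegralD// ?mulrDr//; exact: bmf_integrable.
Qed.

Lemma avgB f g : bmf f -> bmf g -> avg (fun x => f x - g x) = avg f - avg g.
Proof.
by move=> bf bg; rewrite /avg RintegralB// ?mulrBr//; exact: bmf_integrable.
Qed.

Lemma avgZ k f : bmf f -> avg (fun x => k * f x) = k * avg f.
Proof.
move=> bf; rewrite /avg RintegralZl//; first by rewrite mulrCA.
exact: bmf_integrable.
Qed.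

Lemma avg_le f g : bmf f -> bmf g -> (forall x, f x <= g x) -> avg f <= avg g.
Proof.
move=> bf bg fg; rewrite /avg ler_wpM2l ?invr_ge0 ?(ltW finD0)//.
by apply: le_Rintegral => //; exact: bmf_integrable.
Qed.

Lemma avg_norm_le f M : bmf f -> (forall x, `|f x| <= M) -> `|avg f| <= M.
Proof.
move=> bf fM; rewrite ler_norml -{1}(avg_cst (- M)) -{2}(avg_cst M).
by apply/andP; split; apply: avg_le => //; try exact: bmf_cst;
  move=> x; have := fM x; rewrite ler_norml => /andP[].
Qed.

Lemma bmf_avg d' (Y : measurableType d') (f : Y * X -> R) :
  bmf f -> bmf (fun y => avg (fun x => f (y, x))).
Proof.
by move=> bf; apply: bmfM; [exact: bmf_cst|exact: bmf_Rintegral].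
Qed.

End average.

Lemma avg_swap (R : realType) d1 d2 (X : measurableType d1)
    (Y : measurableType d2) (m1 : {sigma_finite_measure set X -> \bar R})
    (m2 : {sigma_finite_measure set Y -> \bar R}) (D1 : set X) (D2 : set Y)
    (f : X * Y -> R) :
  measurable D1 -> measurable D2 -> (m1 D1 < +oo)%E -> (m2 D2 < +oo)%E ->
  bmf f ->
  avg m1 D1 (fun x => avg m2 D2 (fun y => f (x, y))) =
  avg m2 D2 (fun y => avg m1 D1 (fun x => f (x, y))).
Proof.
move=> mD1 mD2 fin1 fin2 bf; rewrite /avg.
rewrite RintegralZl//; last first.
  by apply: bmf_integrable => //; exact: bmf_Rintegral.
rewrite [in RHS]RintegralZl//; last first.
  apply: bmf_integrable => //.
  apply: (bmf_Rintegral (f := fun z => f (z.2, z.1))) => //.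
  by apply: (bmf_comp (h := fun z => (z.2, z.1))) => //;
    exact: measurable_fun_pair.
by rewrite mulrCA (Rintegral_swap mD1 mD2).
Qed.

(** * The torus *)

Section torus_mean.
Variable R : realType.
Local Notation T := (measurableTypeR R).
Local Notation period := (`[0, 2 * pi]%classic : set T).

Lemma measurable_period : measurable period.
Proof. exact: measurable_itv. Qed.

Lemma lebesgue_period : lebesgue_measure period = (2 * pi : R)%:E.
Proof.
by rewrite lebesgue_measure_itv/= lte_fin mulr_gt0 ?pi_gt0// oppr0 adde0.
Qed.

Lemma twopi_gt0 : 0 < 2 * pi :> R.
Proof. by rewrite mulr_gt0 ?pi_gt0. Qed.

Lemma tuple_cons_cube n :
  (@tuple_cons _ T n) @^-1` @cube R (n.+1) = period `*` @cube R n.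
Proof.
apply/seteqP; split=> [[x t] /= h|[x t] [/= hx ht] j].
  split; first by have := h ord0; rewrite (tnth_nth 0).
  move=> j; have := h (lift ord0 j).
  by rewrite !(tnth_nth 0)/= /bump.
have [i ->|->] := unliftP ord0 j; last by rewrite (tnth_nth 0).
by have := ht i; rewrite !(tnth_nth 0)/= /bump.
Qed.

Lemma measurable_cube n : measurable (@cube R n).
Proof.
rewrite (_ : @cube R n =
  \bigcap_(j in [set: 'I_n]) ((@tnth _ T ^~ j) @^-1` period)).
  apply: fin_bigcap_measurable => // j _.
  rewrite -[_ @^-1` _]setTI.
  by apply: measurable_tnth => //; exact: measurable_period.
by apply/seteqP; split=> t h j; [move=> _|]; exact: h.
Qed.

Lemma lebesgue_cube n : lebesgue_tuple R n (@cube R n) = ((2 * pi) ^+ n)%:E.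
Proof.
elim: n => [|n IH].
  by rewrite /= diracE (_ : _ \in _)//; apply/mem_set => -[].
have -> : lebesgue_tuple R n.+1 (@cube R n.+1) =
    (lebesgue_measure \x lebesgue_tuple R n)%E (period `*` @cube R n).
  by rewrite -tuple_cons_cube.
rewrite (product_measure1E _ _ measurable_period (@measurable_cube n)).
rewrite IH exprS EFinM; congr (_ * _)%E; exact: lebesgue_period.
Qed.

(** The mean over [0, 2 pi]^n, and over one period. *)
Definition mean n (f : n.-tuple T -> R) :=
  avg (lebesgue_tuple R n) (@cube R n) f.
Definition mean1 (f : T -> R) := avg lebesgue_measure period f.

Lemma mean0 f : bmf f -> mean (n := 0) f = f [tuple].
Proof.
move=> [mf _]; rewrite /mean /avg lebesgue_cube expr0 invr1 mul1r /Rintegral.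
rewrite /= integral_dirac//.
- by rewrite diracE (_ : _ \in _) ?mul1e//; apply/mem_set => -[].
- exact: measurable_cube.
- exact/measurable_EFinP/measurable_funTS.
Qed.

Lemma lebesgue_cube_fin n : (lebesgue_tuple R n (@cube R n) < +oo)%E.
Proof. by rewrite lebesgue_cube ltry. Qed.

Lemma lebesgue_cube_gt0 n : (0 < lebesgue_tuple R n (@cube R n))%E.
Proof. by rewrite lebesgue_cube lte_fin exprn_gt0// twopi_gt0. Qed.

Lemma lebesgue_period_fin : (lebesgue_measure period < +oo)%E.
Proof. by rewrite lebesgue_period ltry. Qed.

Lemma lebesgue_period_gt0 : (0 < lebesgue_measure period)%E.
Proof. by rewrite lebesgue_period lte_fin twopi_gt0. Qed.

Lemma Rintegral_cubeS n f : bmf f ->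
  \int[lebesgue_tuple R n.+1]_(t in @cube R n.+1) f t =
  \int[(lebesgue_measure \x lebesgue_tuple R n)%E]_(z in period `*` @cube R n)
    f (tuple_cons z).
Proof.
move=> bf; rewrite /Rintegral; congr fine.
rewrite -tuple_cons_cube.
apply: (@integral_pushforward _ _ _ _ R (@tuple_cons _ T n) _
  (lebesgue_measure \x lebesgue_tuple R n)%E (@cube R n.+1) (EFin \o f)).
- exact: measurable_tuple_cons.
- by apply/measurable_EFinP; case: bf.
- rewrite tuple_cons_cube.
  apply: (bmf_integrable (f := f \o @tuple_cons _ T n)).
  + apply: measurableX; [exact: measurable_period|exact: measurable_cube].
  + suff: ((lebesgue_measure \x lebesgue_tuple R n)
        (period `*` @cube R n) = (2 * pi)%:E * ((2 * pi) ^+ n)%:E)%E.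
      by move=> /= ->; rewrite -EFinM ltry.
    rewrite (product_measure1E _ _ measurable_period (@measurable_cube n)).
    by rewrite lebesgue_cube; congr (_ * _)%E; exact: lebesgue_period.
  + by apply: bmf_comp => //; exact: measurable_tuple_cons.
- exact: measurable_cube.
Qed.

(** The mean over n + 1 variables as an iterated mean, the first variable being
    the outer one. *)
Lemma meanS n f : bmf f ->
  mean (n := n.+1) f = mean1 (fun x => mean (fun t => f (tuple_cons (x, t)))).
Proof.
move=> bf.
have bg : bmf (f \o @tuple_cons _ T n).
  by apply: bmf_comp => //; exact: measurable_tuple_cons.
rewrite /mean1 /mean /avg Rintegral_cubeS// lebesgue_cube.
rewrite -(Rintegral_iterated12 (m1 := lebesgue_measure)
  (m2 := lebesgue_tuple R n) measurable_period (@measurable_cube n)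
  lebesgue_period_fin (lebesgue_cube_fin n) bg).
rewrite RintegralZl ?lebesgue_cube ?lebesgue_period; last 2 first.
- exact: measurable_period.
- apply: (bmf_integrable measurable_period lebesgue_period_fin).
  exact: (bmf_Rintegral (@measurable_cube n) (lebesgue_cube_fin n) bg).
rewrite (_ : fine (lebesgue_measure period) = 2 * pi).
  by rewrite /= mulrA exprS invfM.
by rewrite (congr1 fine lebesgue_period).
Qed.

End torus_mean.

Local Open Scope complex_scope.
(** * Complex-valued averages *)

Section complex_average.
Variable R : realType.
Local Notation C := R[i].
Local Notation Re := complex.Re.
Local Notation Im := complex.Im.

Lemma modulusE (z : C) : `|z| = (modulus z)%:C.
Proof. by []. Qed.

Lemma modulus_ge0 (z : C) : 0 <= modulus z.
Proof. by case: z => a b; exact: sqrtr_ge0. Qed.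

Lemma sqr_modulus (z : C) : modulus z ^+ 2 = Re z ^+ 2 + Im z ^+ 2.
Proof. by case: z => a b /=; rewrite sqr_sqrtr// addr_ge0 ?sqr_ge0. Qed.

Lemma modulus_le_ReIm (z : C) : modulus z <= `|Re z| + `|Im z|.
Proof.
rewrite -(@ler_pXn2r _ 2)// ?nnegrE ?modulus_ge0 ?addr_ge0//.
rewrite sqr_modulus sqrrD !real_normK ?num_real//.
by rewrite addrAC lerDl mulrn_wge0// mulr_ge0.
Qed.

Lemma normr_Re_le (z : C) : `|Re z| <= modulus z.
Proof.
rewrite -(@ler_pXn2r _ 2)// ?nnegrE ?modulus_ge0//.
by rewrite sqr_modulus real_normK ?num_real// lerDl sqr_ge0.
Qed.

Lemma normr_Im_le (z : C) : `|Im z| <= modulus z.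
Proof.
rewrite -(@ler_pXn2r _ 2)// ?nnegrE ?modulus_ge0//.
by rewrite sqr_modulus real_normK ?num_real// lerDr sqr_ge0.
Qed.

Lemma ReM (x y : C) : Re (x * y) = Re x * Re y - Im x * Im y.
Proof. by case: x y => [a b] [c e]. Qed.
Lemma ImM (x y : C) : Im (x * y) = Re x * Im y + Im x * Re y.
Proof. by case: x y => [a b] [c e]. Qed.
Lemma ReD (x y : C) : Re (x + y) = Re x + Re y.
Proof. by case: x y => [a b] [c e]. Qed.
Lemma ImD (x y : C) : Im (x + y) = Im x + Im y.
Proof. by case: x y => [a b] [c e]. Qed.
Lemma ReN (x : C) : Re (- x) = - Re x.
Proof. by case: x. Qed.
Lemma ImN (x : C) : Im (- x) = - Im x.
Proof. by case: x. Qed.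
Lemma ReV (x : C) : Re x^-1 = Re x * (modulus x ^+ 2)^-1.
Proof. by rewrite sqr_modulus; case: x. Qed.
Lemma ImV (x : C) : Im x^-1 = - (Im x * (modulus x ^+ 2)^-1).
Proof. by rewrite sqr_modulus; case: x. Qed.

Section cbmf.
Context d (X : measurableType d).
Implicit Types f g : X -> C.

(** Complex functions with bounded measurable real and imaginary parts. *)
Definition cbmf f : Prop :=
  bmf (fun x => Re (f x)) /\ bmf (fun x => Im (f x)).

Lemma cbmf_cst k : cbmf (fun=> k).
Proof. by split; exact: bmf_cst. Qed.

Lemma cbmfD f g : cbmf f -> cbmf g -> cbmf (fun x => f x + g x).
Proof.
move=> [f1 f2] [g1 g2]; split.
- by under eq_fun do rewrite ReD; exact: bmfD.
- by under eq_fun do rewrite ImD; exact: bmfD.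
Qed.

Lemma cbmfN f : cbmf f -> cbmf (fun x => - f x).
Proof.
move=> [f1 f2]; split.
- by under eq_fun do rewrite ReN; exact: bmfN.
- by under eq_fun do rewrite ImN; exact: bmfN.
Qed.

Lemma cbmfB f g : cbmf f -> cbmf g -> cbmf (fun x => f x - g x).
Proof. by move=> bf bg; apply: cbmfD => //; exact: cbmfN. Qed.

Lemma cbmfM f g : cbmf f -> cbmf g -> cbmf (fun x => f x * g x).
Proof.
move=> [f1 f2] [g1 g2]; split.
- by under eq_fun do rewrite ReM; apply: bmfB; exact: bmfM.
- by under eq_fun do rewrite ImM; apply: bmfD; exact: bmfM.
Qed.

Lemma cbmf_conj f : cbmf f -> cbmf (fun x => (f x)^*%C).
Proof.
move=> [f1 f2]; split.
- by rewrite (_ : (fun _ => _) = (fun x => Re (f x)))//; apply/funext => x;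
  case: (f x).
- rewrite (_ : (fun _ => _) = (fun x => - Im (f x))); first exact: bmfN.
  by apply/funext => x; case: (f x).
Qed.

Lemma cbmfX f n : cbmf f -> cbmf (fun x => f x ^+ n).
Proof.
move=> bf; elim: n => [|n IH].
  by under eq_fun do rewrite expr0; exact: cbmf_cst.
by under eq_fun do rewrite exprS; exact: cbmfM.
Qed.

Lemma cbmf_sum I (r : seq I) (P : pred I) (f : I -> X -> C) :
  (forall i, cbmf (f i)) -> cbmf (fun x => \sum_(i <- r | P i) f i x).
Proof.
move=> bf; elim: r => [|i r IH].
  by under eq_fun do rewrite big_nil; exact: cbmf_cst.
under eq_fun do rewrite big_cons.
by case: (P i) => //; exact: cbmfD.
Qed.

Lemma bmf_sqr_modulus f : cbmf f -> bmf (fun x => modulus (f x) ^+ 2).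
Proof.
move=> [f1 f2]; under eq_fun do rewrite sqr_modulus.
by apply: bmfD; exact: bmfX.
Qed.

Lemma cbmf_inv f m : 0 < m -> (forall x, m <= modulus (f x)) -> cbmf f ->
  cbmf (fun x => (f x)^-1).
Proof.
move=> m0 fm bf.
have bv : bmf (fun x => (modulus (f x) ^+ 2)^-1).
  apply: (bmf_inv (m := m ^+ 2)); [exact: exprn_gt0| |exact: bmf_sqr_modulus].
  by move=> x; rewrite ler_pXn2r// ?nnegrE ?modulus_ge0// ltW.
case: bf => f1 f2; split.
- by under eq_fun do rewrite ReV; exact: bmfM.
- by under eq_fun do rewrite ImV; apply/bmfN/bmfM.
Qed.

End cbmf.

Lemma cbmf_comp d d' (X : measurableType d) (Y : measurableType d')
    (h : X -> Y) (f : Y -> C) :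
  measurable_fun setT h -> cbmf f -> cbmf (f \o h).
Proof. by move=> mh [f1 f2]; split;
  [have := bmf_comp mh f1|have := bmf_comp mh f2]. Qed.

Section cavg.
Context d (X : measurableType d).
Variables (m : {sigma_finite_measure set X -> \bar R}) (D : set X).
Implicit Types f g : X -> C.

(** The average of a complex function, taken on its real and imaginary parts. *)
Definition cavg f : C :=
  avg m D (fun x => Re (f x)) +i* avg m D (fun x => Im (f x)).

Lemma eq_cavg f g : f =1 g -> cavg f = cavg g.
Proof. by move=> /funext ->. Qed.

Hypotheses (mD : measurable D) (D0 : (0 < m D)%E) (Dfin : (m D < +oo)%E).

Lemma cavg_cst k : cavg (fun=> k) = k.
Proof. by rewrite /cavg !avg_cst//; case: k. Qed.

Lemma cavg_real (f : X -> R) : cavg (fun x => (f x)%:C) = (avg m D f)%:C.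
Proof. by rewrite /cavg /= avg_cst. Qed.

Lemma cavgD f g : cbmf f -> cbmf g ->
  cavg (fun x => f x + g x) = cavg f + cavg g.
Proof.
move=> [f1 f2] [g1 g2]; rewrite /cavg.
under [X in X +i* _]eq_avg do rewrite ReD.
under [X in _ +i* X]eq_avg do rewrite ImD.
by rewrite !avgD.
Qed.

Lemma cavgZ k f : cbmf f -> cavg (fun x => k * f x) = k * cavg f.
Proof.
move=> [f1 f2]; rewrite /cavg.
under [X in X +i* _]eq_avg do rewrite ReM.
under [X in _ +i* X]eq_avg do rewrite ImM.
have bZ c h : bmf h -> bmf (fun x : X => c * h x).
  by move=> bh; apply: bmfM => //; exact: bmf_cst.
rewrite avgB//; try exact: bZ.
rewrite avgD//; try exact: bZ.
rewrite !avgZ//.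
by case: k.
Qed.

Lemma cavgB f g : cbmf f -> cbmf g ->
  cavg (fun x => f x - g x) = cavg f - cavg g.
Proof.
move=> bf bg; rewrite cavgD//; last exact: cbmfN.
congr (_ + _); rewrite -mulN1r -cavgZ//.
by apply: eq_cavg => x; rewrite mulN1r.
Qed.

Lemma cavg_sum I (r : seq I) (P : pred I) (f : I -> X -> C) :
  (forall i, cbmf (f i)) ->
  cavg (fun x => \sum_(i <- r | P i) f i x) = \sum_(i <- r | P i) cavg (f i).
Proof.
move=> bf; elim: r => [|i r IH].
  by under eq_cavg do rewrite big_nil; rewrite big_nil cavg_cst.
under eq_cavg do rewrite big_cons.
rewrite big_cons; case: (P i) => //.
by rewrite cavgD// ?IH//; exact: cbmf_sum.
Qed.

(** The constant 2, which comes from bounding the two parts separately, is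
    harmless: the lemma only serves to show that errors tend to 0. *)
Lemma cavg_norm_le f B : cbmf f -> (forall x, modulus (f x) <= B) ->
  modulus (cavg f) <= 2 * B.
Proof.
move=> [f1 f2] fB; rewrite (le_trans (modulus_le_ReIm _))//= mulr2n
  mulrDl mul1r.
apply: lerD; apply: avg_norm_le => // x.
- exact: le_trans (normr_Re_le _) (fB x).
- exact: le_trans (normr_Im_le _) (fB x).
Qed.

Lemma cavg_conj f : cbmf f -> cavg (fun x => (f x)^*%C) = (cavg f)^*%C.
Proof.
move=> [f1 f2]; rewrite /cavg /=; congr (_ +i* _).
  by apply: eq_avg => x; case: (f x).
rewrite -mulN1r -avgZ//.
by apply: eq_avg => x; case: (f x) => a b /=; rewrite mulN1r.
Qed.

Lemma cbmf_cavg d' (Y : measurableType d') (f : Y * X -> C) :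
  cbmf f -> cbmf (fun y => cavg (fun x => f (y, x))).
Proof.
move=> [f1 f2]; split => /=.
- exact: (bmf_avg mD Dfin f1).
- exact: (bmf_avg mD Dfin f2).
Qed.

End cavg.

Lemma cavg_swap d1 d2 (X : measurableType d1)
    (Y : measurableType d2) (m1 : {sigma_finite_measure set X -> \bar R})
    (m2 : {sigma_finite_measure set Y -> \bar R}) (D1 : set X) (D2 : set Y)
    (f : X * Y -> C) :
  measurable D1 -> measurable D2 -> (m1 D1 < +oo)%E -> (m2 D2 < +oo)%E ->
  cbmf f ->
  cavg m1 D1 (fun x => cavg m2 D2 (fun y => f (x, y))) =
  cavg m2 D2 (fun y => cavg m1 D1 (fun x => f (x, y))).
Proof.
move=> mD1 mD2 fin1 fin2 [f1 f2]; rewrite /cavg /=; congr (_ +i* _).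
- exact: (avg_swap mD1 mD2 fin1 fin2 f1).
- exact: (avg_swap mD1 mD2 fin1 fin2 f2).
Qed.

End complex_average.

(** * Exponentials and means over the torus *)

Section exponentials.
Variable R : realType.
Local Notation C := R[i].
Local Notation T := (measurableTypeR R).
Local Notation period := (`[0, 2 * pi]%classic : set T).

Lemma expi0 : expi 0 = 1 :> C.
Proof. by rewrite /expi cos0 sin0. Qed.

Lemma expiD (x y : R) : expi (x + y) = expi x * expi y.
Proof.
by rewrite /expi cosD sinD; apply/eqP; rewrite eq_complex/= eqxx/= addrC eqxx.
Qed.

Lemma conj_expi (x : R) : (expi x)^*%C = expi (- x).
Proof. by rewrite /expi cosN sinN. Qed.

Lemma expiX (x : R) n : expi x ^+ n = expi (n%:R * x).
Proof.
elim: n => [|n IH]; first by rewrite expr0 mul0r expi0.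
by rewrite exprS IH -expiD -natr1 mulrDl mul1r addrC.
Qed.

Lemma modulus_expi (x : R) : modulus (expi x) = 1.
Proof. by rewrite /= cos2Dsin2 sqrtr1. Qed.

Lemma mulr_expi_conj (x : R) : expi x * (expi x)^*%C = 1.
Proof. by rewrite conj_expi -expiD subrr expi0. Qed.

Lemma cbmf_expi d (X : measurableType d) (h : X -> R) :
  measurable_fun setT h -> cbmf (fun x => expi (h x)).
Proof. by move=> mh; split => /=; [exact: bmf_cos|exact: bmf_sin]. Qed.

Lemma cos_natpi n : cos (n%:R * (2 * pi)) = 1 :> R.
Proof.
have -> : n%:R * (2 * pi) = pi *+ 2 *+ n :> R.
  by rewrite (mulr_natl pi 2) mulr_natl.
by rewrite -[X in cos X]add0r (periodicn (@cosD2pi R)) cos0.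
Qed.

Lemma sin_natpi n : sin (n%:R * (2 * pi)) = 0 :> R.
Proof.
have -> : n%:R * (2 * pi) = pi *+ 2 *+ n :> R.
  by rewrite (mulr_natl pi 2) mulr_natl.
by rewrite -[X in sin X]add0r (periodicn (@sinD2pi R)) sin0.
Qed.

(** The fundamental theorem of calculus for an everywhere differentiable
    primitive. *)
Lemma Rintegral_derive (f F : R -> R) (a b : R) : a < b ->
  continuous f -> (forall x : R, is_derive x 1 F (f x)) ->
  \int[lebesgue_measure]_(x in `[a, b]) f x = F b - F a.
Proof.
move=> ab cf dF; rewrite /Rintegral.
have cF : continuous F.
  by move=> x; apply/differentiable_continuous/derivable1_diffP.
rewrite (continuous_FTC2 (F := F) ab) //.
- exact: continuous_subspaceT.
- split.
  + by move=> x _.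
  + exact/cvg_at_right_filter/cF.
  + exact/cvg_at_left_filter/cF.
- by move=> x _; rewrite derive1E; exact: derive_val.
Qed.

Lemma continuous_cosZ (k : R) : continuous (fun x => cos (k * x)).
Proof.
move=> x; apply: continuous_comp; last exact: continuous_cos.
exact: mulrl_continuous.
Qed.

Lemma continuous_sinZ (k : R) : continuous (fun x => sin (k * x)).
Proof.
move=> x; apply: continuous_comp; last exact: continuous_sin.
exact: mulrl_continuous.
Qed.

(** The complex mean over [0, 2 pi]^n, and over one period. *)
Definition cmean n (f : n.-tuple T -> C) : C :=
  cavg (lebesgue_tuple R n) (@cube R n) f.
Definition cmean1 (f : T -> C) : C := cavg lebesgue_measure period f.

Lemma cmean0 (f : 0.-tuple T -> C) : cbmf f -> cmean f = f [tuple].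
Proof.
move=> [f1 f2]; rewrite /cmean /cavg -!/(mean _) !mean0//.
by case: (f _).
Qed.

Lemma cmeanS n (f : n.+1.-tuple T -> C) : cbmf f ->
  cmean f = cmean1 (fun x => cmean (fun t => f (tuple_cons (x, t)))).
Proof.
by move=> [f1 f2]; rewrite /cmean /cavg -!/(mean _) !meanS.
Qed.

Lemma cmean1_cst k : cmean1 (fun=> k) = k.
Proof.
move=> *; apply: cavg_cst => //;
  by [exact: measurable_period|exact: lebesgue_period_gt0|exact:
  lebesgue_period_fin].
Qed.

Lemma cmean1Z k (f : T -> C) : cbmf f ->
  cmean1 (fun x => k * f x) = k * cmean1 f.
Proof.
move=> *; apply: cavgZ => //;
  by [exact: measurable_period|exact: lebesgue_period_fin].
Qed.

Lemma cmean1_sum I (r : seq I) (P : pred I) (f : I -> T -> C) :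
  (forall i, cbmf (f i)) ->
  cmean1 (fun x => \sum_(i <- r | P i) f i x) =
    \sum_(i <- r | P i) cmean1 (f i).
Proof.
move=> *; apply: cavg_sum => //;
  by [exact: measurable_period|exact: lebesgue_period_gt0|exact:
  lebesgue_period_fin].
Qed.

Lemma cmean1_conj (f : T -> C) : cbmf f ->
  cmean1 (fun x => (f x)^*%C) = (cmean1 f)^*%C.
Proof.
move=> *; apply: cavg_conj => //;
  by [exact: measurable_period|exact: lebesgue_period_fin].
Qed.

Lemma cbmf_cmean1 d (Y : measurableType d) (f : Y * (T) -> C) :
  cbmf f -> cbmf (fun y => cmean1 (fun x => f (y, x))).
Proof.
move=> *; apply: cbmf_cavg => //;
  by [exact: measurable_period|exact: lebesgue_period_fin].
Qed.

Lemma cmean_cst n k : cmean (n := n) (fun=> k) = k.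
Proof.
move=> *; apply: cavg_cst => //;
  by [exact: measurable_cube|exact: lebesgue_cube_gt0|exact: lebesgue_cube_fin].
Qed.

Lemma cmean_real n (f : n.-tuple T -> R) :
  cmean (fun x => (f x)%:C) = (mean f)%:C.
Proof.
move=> *; apply: cavg_real => //;
  by [exact: measurable_cube|exact: lebesgue_cube_gt0|exact: lebesgue_cube_fin].
Qed.

Lemma cmeanB n (f g : n.-tuple T -> C) : cbmf f -> cbmf g ->
  cmean (fun x => f x - g x) = cmean f - cmean g.
Proof.
move=> *; apply: cavgB => //;
  by [exact: measurable_cube|exact: lebesgue_cube_fin].
Qed.

Lemma cmeanZ n k (f : n.-tuple T -> C) : cbmf f ->
  cmean (fun x => k * f x) = k * cmean f.
Proof.
move=> *; apply: cavgZ => //;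
  by [exact: measurable_cube|exact: lebesgue_cube_fin].
Qed.

Lemma cmean_sum n I (r : seq I) (P : pred I) (f : I -> n.-tuple T -> C) :
  (forall i, cbmf (f i)) ->
  cmean (fun x => \sum_(i <- r | P i) f i x) = \sum_(i <- r | P i) cmean (f i).
Proof.
move=> *; apply: cavg_sum => //;
  by [exact: measurable_cube|exact: lebesgue_cube_gt0|exact: lebesgue_cube_fin].
Qed.

Lemma cmean_norm_le n (f : n.-tuple T -> C) B : cbmf f ->
  (forall x, modulus (f x) <= B) -> modulus (cmean f) <= 2 * B.
Proof.
move=> *; apply: cavg_norm_le => //;
  by [exact: measurable_cube|exact: lebesgue_cube_gt0|exact: lebesgue_cube_fin].
Qed.

Lemma cmean_conj n (f : n.-tuple T -> C) : cbmf f ->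
  cmean (fun x => (f x)^*%C) = (cmean f)^*%C.
Proof.
move=> *; apply: cavg_conj => //;
  by [exact: measurable_cube|exact: lebesgue_cube_fin].
Qed.

Lemma cbmf_cmean n d (Y : measurableType d) (f : Y * (n.-tuple T) -> C) :
  cbmf f -> cbmf (fun y => cmean (fun x => f (y, x))).
Proof.
move=> *; apply: cbmf_cavg => //;
  by [exact: measurable_cube|exact: lebesgue_cube_fin].
Qed.

Lemma cmean_swap n (f : T * n.-tuple T -> C) : cbmf f ->
  cmean1 (fun x => cmean (fun t => f (x, t))) =
  cmean (fun t => cmean1 (fun x => f (x, t))).
Proof.
move=> bf; apply: (@cavg_swap _ _ _ T _ lebesgue_measure) => //;
  by [exact: measurable_period|exact: measurable_cube|
   exact: lebesgue_period_fin|exact: lebesgue_cube_fin].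
Qed.

Lemma cmean1_swap (f : T * T -> C) : cbmf f ->
  cmean1 (fun x => cmean1 (fun y => f (x, y))) =
  cmean1 (fun y => cmean1 (fun x => f (x, y))).
Proof.
move=> bf; apply: (@cavg_swap _ _ _ T T lebesgue_measure
  lebesgue_measure) => //;
  by [exact: measurable_period|exact: lebesgue_period_fin].
Qed.

Lemma cmean1_expiX k : cmean1 (fun x => expi x ^+ k) = (k == 0%N)%:R.
Proof.
have [->|k0] := eqVneq k 0%N.
  by rewrite (_ : (fun x : T => _) = fun=> 1) ?cmean1_cst.
have kR : k%:R != 0 :> R by rewrite pnatr_eq0.
rewrite /cmean1 /cavg /avg.
under eq_Rintegral do rewrite expiX /=.
under [X in _ +i* (_ * X)]eq_Rintegral do rewrite expiX /=.
have dS (x : R) :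
    is_derive x 1 (fun x => k%:R^-1 * sin (k%:R * x)) (cos (k%:R * x)).
  apply: is_derive_eq; rewrite /GRing.scale/= mulr1 mulrCA mulVf ?mulr1//.
have dC (x : R) :
    is_derive x 1 (fun x => - (k%:R^-1 * cos (k%:R * x))) (sin (k%:R * x)).
  apply: is_derive_eq; rewrite /GRing.scale/= mulr1 mulNr mulrN opprK.
  by rewrite mulrCA mulVf ?mulr1.
rewrite (Rintegral_derive (twopi_gt0 R) (@continuous_cosZ _) dS).
rewrite (Rintegral_derive (twopi_gt0 R) (@continuous_sinZ _) dC).
rewrite sin_natpi cos_natpi !mulr0 sin0 cos0 !mulr0 subrr mulr0 opprK
  mulr1 addNr.
by rewrite mulr0.
Qed.

(** Orthogonality of the characters of the circle. *)
Lemma cmean1_expi_orth k l :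
  cmean1 (fun x => expi x ^+ k * (expi x)^*%C ^+ l) = (k == l)%:R.
Proof.
have E (m n : nat) (x : R) :
  expi x ^+ (m + n) * (expi x)^*%C ^+ n = expi x ^+ m.
  by rewrite exprD -mulrA -exprMn mulr_expi_conj expr1n mulr1.
have [lk|kl] := leqP l k.
  have -> : (fun x : T => expi x ^+ k * (expi x)^*%C ^+ l) =
      (fun x => expi x ^+ (k - l)).
    by apply/funext => x; rewrite -(E (k - l)%N l) subnK.
  by rewrite cmean1_expiX subn_eq0 eqn_leq lk andbT.
have -> : (fun x : T => expi x ^+ k * (expi x)^*%C ^+ l) =
    (fun x => (expi x ^+ (l - k))^*%C).
  apply/funext => x; rewrite -(E (l - k)%N k) subnK ?(ltnW kl)//.
  rewrite rmorphM !rmorphXn [RHS]mulrC; congr (_ ^+ _ * _).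
  exact/esym/conjcK.
rewrite cmean1_conj; last first.
  by apply: cbmfX; exact: cbmf_expi.
by rewrite cmean1_expiX subn_eq0 leqNgt kl conjc0 ltn_eqF.
Qed.

End exponentials.

(** * The modulus, and moments of the sum of the coordinates *)

Section moments.
Variable R : realType.
Local Notation C := R[i].
Local Notation T := (measurableTypeR R).

Lemma modulusM (x y : C) : modulus (x * y) = modulus x * modulus y.
Proof. exact: ComplexField.Normc.normcM. Qed.

Lemma modulusV (x : C) : modulus x^-1 = (modulus x)^-1.
Proof. exact: ComplexField.Normc.normcV. Qed.

Lemma modulusN (x : C) : modulus (- x) = modulus x.
Proof. exact: normcN. Qed.

Lemma modulusD_le (x y : C) : modulus (x + y) <= modulus x + modulus y.
Proof. exact: le_normcD. Qed.

Lemma modulus1 : modulus (1 : C) = 1.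
Proof. exact: ComplexField.Normc.normc1. Qed.

Lemma modulus0 : modulus (0 : C) = 0.
Proof. exact: ComplexField.Normc.normc0. Qed.

Lemma modulus0_eq0 (x : C) : modulus x = 0 -> x = 0.
Proof. exact: ComplexField.Normc.eq0_normc. Qed.

Lemma modulusX (x : C) n : modulus (x ^+ n) = modulus x ^+ n.
Proof.
elim: n => [|n IH]; first by rewrite !expr0 modulus1.
by rewrite !exprS modulusM IH.
Qed.

Lemma modulus_conj (x : C) : modulus x^*%C = modulus x.
Proof. by case: x => a b /=; rewrite sqrrN. Qed.

Lemma modulus_real (x : R) : modulus x%:C = `|x|.
Proof. by rewrite /= expr0n/= addr0 sqrtr_sqr. Qed.

Lemma mulr_conj (x : C) : x * x^*%C = (modulus x ^+ 2)%:C.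
Proof.
rewrite sqr_modulus; case: x => a b; apply/eqP.
by rewrite eq_complex/=; apply/andP; split; apply/eqP; ring.
Qed.

Lemma modulusB_ge (x y : C) : modulus x - modulus y <= modulus (x - y).
Proof.
by rewrite lerBlDr -{1}(subrK y x) modulusD_le.
Qed.

Lemma modulus_sum_le I (r : seq I) (P : pred I) (f : I -> C) :
  modulus (\sum_(i <- r | P i) f i) <= \sum_(i <- r | P i) modulus (f i).
Proof.
elim/big_ind2 : _ => //; first by rewrite modulus0.
move=> a b c e ab ce; rewrite (le_trans (modulusD_le _ _))// lerD//.
Qed.

Lemma le_geometric_eq0 (z K r : R) : 0 <= r < 1 ->
  (forall N, `|z| <= K * r ^+ N) -> z = 0.
Proof.
move=> /andP[r0 r1] h.
have rN : `|r| < 1 by rewrite ger0_norm.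
have cv : (fun N => K * r ^+ N) @ \oo --> K * 0.
  by apply: cvgMr; exact: cvg_expr.
rewrite mulr0 in cv.
have := ler_lim (is_cvg_cst _ : cvg ((fun _ : nat => `|z|) @ \oo)) (cvgP _ cv).
rewrite lim_cst// (cvg_lim _ cv)// => H.
apply/eqP; rewrite -normr_le0; apply: H.
by near=> N; exact: h.
Unshelve. all: by end_near. Qed.

(** [expi_sum t] is the sum z_1 + ... + z_n of the coordinates of the point of
    the torus with arguments [t]. *)
Definition expi_sum n (t : n.-tuple T) : C := \sum_(j < n) expi (tnth t j).

Lemma expi_sum0 (t : 0.-tuple T) : expi_sum t = 0.
Proof. exact: big_ord0. Qed.

Lemma expi_sum_cons n x (t : n.-tuple T) :
  expi_sum (tuple_cons (x, t)) = expi x + expi_sum t.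
Proof.
rewrite /expi_sum big_ord_recl; congr (_ + _).
by apply: eq_bigr => j _; rewrite !(tnth_nth 0).
Qed.

Lemma cbmf_expi_sum n : cbmf (@expi_sum n).
Proof. by apply: cbmf_sum => j; apply: cbmf_expi; exact: measurable_tnth. Qed.

Lemma modulus_expi_sum n (t : n.-tuple T) : modulus (expi_sum t) <= n%:R.
Proof.
rewrite (le_trans (modulus_sum_le _ _ _))//.
under eq_bigr do rewrite modulus_expi.
by rewrite sumr_const card_ord.
Qed.

Lemma cbmf_tuple_cons n (f : n.+1.-tuple T -> C) : cbmf f ->
  cbmf (fun z : T * n.-tuple T => f (tuple_cons z)).
Proof. by move=> bf; apply: (cbmf_comp _ bf); exact: measurable_tuple_cons. Qed.

Lemma cbmf_slice d1 d2 (X : measurableType d1) (Y : measurableType d2)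
  (f : X * Y -> C) x : cbmf f -> cbmf (fun y => f (x, y)).
Proof. by move=> [f1 f2]; split;
  [exact: (bmf_slice1 f1)|exact: (bmf_slice1 f2)]. Qed.

(** The constant coefficient of |z_1 + ... + z_d|^(2n), by recursion on the number
    of variables; it is the sum of the squares of the multinomial coefficients
    ([sum_sqr_multinomial]). *)
Fixpoint mom d n : nat :=
  if d is d'.+1 then \sum_(k < n.+1) 'C(n, k) ^ 2 * mom d' (n - k)
  else (n == 0)%N.

(** The powers of z_1 + ... + z_d are orthogonal. Expanding both powers of
    z_1 + (z_2 + ... + z_d) with the binomial formula, only the terms with the
    same power of z_1 survive the integration over z_1. *)
Lemma cmean_expi_sum_moments d m n :
  cmean (fun t : d.-tuple T => expi_sum t ^+ m * (expi_sum t)^*%C ^+ n) =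
  ((m == n) * mom d n)%N%:R.
Proof.
elim: d m n => [|d IH] m n.
  rewrite cmean0; last first.
    by apply: cbmfM; apply: cbmfX; [|apply: cbmf_conj]; exact: cbmf_expi_sum.
  rewrite expi_sum0 conjc0 !expr0n /=.
  by case: m n => [|m] [|n]; rewrite ?mulr1 ?mul0r ?muln1 ?muln0 ?mulr0.
rewrite cmeanS; last first.
  by apply: cbmfM; apply: cbmfX; [|apply: cbmf_conj]; exact: cbmf_expi_sum.
pose c i j : C := ('C(m, i) * 'C(n, j))%N%:R.
pose s (t : d.-tuple T) := expi_sum t.
have bS i j : cbmf (fun t : d.-tuple T => s t ^+ i * (s t)^*%C ^+ j).
  by apply: cbmfM; apply: cbmfX; [|apply: cbmf_conj]; exact: cbmf_expi_sum.
have bE i j : cbmf (fun x : T => expi x ^+ i * (expi x)^*%C ^+ j).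
  by apply: cbmfM; apply: cbmfX; [|apply: cbmf_conj]; exact: cbmf_expi.
transitivity (cmean1 (fun x : T => \sum_(i < m.+1) \sum_(j < n.+1)
   (c i j * ((m - i == n - j) * mom d (n - j))%N%:R) *
     (expi x ^+ i * (expi x)^*%C ^+ j))).
  apply: eq_cavg => x.
  transitivity (cmean (fun t : d.-tuple T => \sum_(i < m.+1) \sum_(j < n.+1)
     (c i j * (expi x ^+ i * (expi x)^*%C ^+ j)) *
     (s t ^+ (m - i) * (s t)^*%C ^+ (n - j)))).
    apply: eq_cavg => t.
    rewrite expi_sum_cons -/(s t) addrC rmorphD/= !exprDn big_distrl/=.
    apply: eq_bigr => i _; rewrite big_distrr/=; apply: eq_bigr => j _.
    rewrite /c natrM -[X in X * _ = _]mulr_natr -[X in _ * X = _]mulr_natr.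
    by ring.
  rewrite cmean_sum; last first.
    move=> i; apply: cbmf_sum => j; apply: cbmfM => //; exact: cbmf_cst.
  apply: eq_bigr => i _; rewrite cmean_sum; last first.
    move=> j; apply: cbmfM => //; exact: cbmf_cst.
  apply: eq_bigr => j _; rewrite cmeanZ// IH.
  by rewrite mulrAC.
rewrite cmean1_sum; last first.
  move=> i; apply: cbmf_sum => j; apply: cbmfM => //; exact: cbmf_cst.
under eq_bigr => i _.
  rewrite cmean1_sum; last first.
    move=> j; apply: cbmfM => //; exact: cbmf_cst.
  under eq_bigr => j _ do rewrite cmean1Z// cmean1_expi_orth.
  over.
rewrite /c /=.
have [->|mn] := eqVneq m n.
  rewrite mul1n natr_sum; apply: eq_bigr => i _.
  rewrite (bigD1 i)//= !eqxx mulr1 mul1n -natrM big1 ?addr0//.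
  move=> j ji; rewrite (_ : (i == j :> nat) = false) ?mulr0//.
  by apply/negbTE; rewrite eq_sym.
rewrite mul0n big1// => i _; rewrite big1// => j _.
have [ij|_] := eqVneq (i : nat) j; last by rewrite mulr0.
rewrite (_ : (m - i == n - j)%N = false) ?mul0n ?mulr0 ?mul0r//.
apply/negbTE; apply: contra mn => /eqP h.
have im : (i <= m)%N by rewrite -ltnS.
have jn : (j <= n)%N by rewrite -ltnS.
by rewrite -(subnK im) -(subnK jn) h ij.
Qed.

End moments.

(** * The generating function of the moments *)

Section real_means.
Variable R : realType.
Local Notation T := (measurableTypeR R).
Variable n : nat.
Implicit Types f g : n.-tuple T -> R.

Lemma mean_cst k : mean (fun _ : n.-tuple T => k) = k.
Proof.
apply: (avg_cst (m := lebesgue_tuple R n));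
  by [exact: measurable_cube|exact: lebesgue_cube_gt0|exact: lebesgue_cube_fin].
Qed.

Lemma meanD f g : bmf f -> bmf g -> mean (fun t => f t + g t) = mean f + mean g.
Proof. by move=> *; apply: avgD => //;
  [exact: measurable_cube|exact: lebesgue_cube_fin]. Qed.

Lemma meanB f g : bmf f -> bmf g -> mean (fun t => f t - g t) = mean f - mean g.
Proof. by move=> *; apply: avgB => //;
  [exact: measurable_cube|exact: lebesgue_cube_fin]. Qed.

Lemma meanZ k f : bmf f -> mean (fun t => k * f t) = k * mean f.
Proof. by move=> *; apply: avgZ => //;
  [exact: measurable_cube|exact: lebesgue_cube_fin]. Qed.

Lemma mean_le f g : bmf f -> bmf g -> (forall t, f t <= g t) ->
  mean f <= mean g.
Proof.
by move=> *; apply: avg_le => //; [exact: measurable_cube|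
  exact: lebesgue_cube_gt0|exact: lebesgue_cube_fin].
Qed.

Lemma mean_norm_le f M : bmf f -> (forall t, `|f t| <= M) -> `|mean f| <= M.
Proof.
by move=> *; apply: avg_norm_le => //; [exact: measurable_cube|
  exact: lebesgue_cube_gt0|exact: lebesgue_cube_fin].
Qed.

Lemma mean_sum I (r : seq I) (P : pred I) (f : I -> n.-tuple T -> R) :
  (forall i, bmf (f i)) ->
  mean (fun t => \sum_(i <- r | P i) f i t) = \sum_(i <- r | P i) mean (f i).
Proof.
move=> bf; elim: r => [|i r IH].
  by rewrite big_nil -[RHS]mean_cst; apply: eq_avg => t; rewrite big_nil.
rewrite big_cons; case: ifPn => Pi.
  rewrite -IH -meanD//; last exact: bmf_sum.
  by apply: eq_avg => t; rewrite big_cons Pi.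
by rewrite -IH; apply: eq_avg => t; rewrite big_cons (negbTE Pi).
Qed.

End real_means.

Section generating_function.
Variable R : realType.
Local Notation C := R[i].
Local Notation T := (measurableTypeR R).

Lemma geometric_truncation (K : fieldType) (u : K) N : u != 1 ->
  (1 - u)^-1 = \sum_(n < N) u ^+ n + u ^+ N / (1 - u).
Proof.
move=> u1; have h : 1 - u != 0 by rewrite subr_eq0 eq_sym.
apply: (mulfI h); rewrite mulfV// mulrDr mulrCA mulfV// mulr1.
by rewrite -[1 - u]opprB mulNr -subrX1 opprB subrK.
Qed.

Variable d : nat.

(** The squared modulus of z_1 + ... + z_d. *)
Definition sqr_sum (t : d.-tuple T) : R := modulus (expi_sum t) ^+ 2.

Lemma sqr_sum_ge0 t : 0 <= sqr_sum t.
Proof. exact: sqr_ge0. Qed.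

Lemma sqr_sum_le t : sqr_sum t <= d%:R ^+ 2.
Proof.
by rewrite ler_pXn2r ?nnegrE ?modulus_ge0// modulus_expi_sum.
Qed.

Lemma bmf_sqr_sum : bmf sqr_sum.
Proof. by apply: bmf_sqr_modulus; exact: cbmf_expi_sum. Qed.

Lemma mean_sqr_sumX n : mean (fun t => sqr_sum t ^+ n) = (mom d n)%:R.
Proof.
apply: (@complexI R).
rewrite -cmean_real rmorph_nat -[in RHS](mul1n (mom d n))
  -[1%N]/(nat_of_bool true).
rewrite -(eqxx n) -cmean_expi_sum_moments.
by apply: eq_cavg => t; rewrite /sqr_sum -exprMn mulr_conj rmorphXn.
Qed.

(** The generating function sum_n M_n x^n of the moments M_n of |S|^2, in closed
    form; it is used for 0 <= x < 1/d^2. *)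
Definition genfun (x : R) : R := mean (fun t => (1 - x * sqr_sum t)^-1).

(** The partial sums of the series that [genfun] sums. *)
Definition gensum N (x : R) : R := \sum_(n < N) (mom d n)%:R * x ^+ n.

Lemma gensumE N x :
  gensum N x = mean (fun t => \sum_(n < N) (x * sqr_sum t) ^+ n).
Proof.
have bZ : bmf (fun t => x * sqr_sum t).
  by apply: bmfM; [exact: bmf_cst|exact: bmf_sqr_sum].
rewrite mean_sum; last by move=> i; exact: bmfX.
apply: eq_bigr => n _; rewrite -mean_sqr_sumX mulrC -meanZ; last first.
  by apply: bmfX; exact: bmf_sqr_sum.
by apply: eq_avg => t; rewrite [RHS]exprMn.
Qed.

Section inside_disc.
Variable x : R.
Hypotheses (x0 : 0 <= x) (x1 : d%:R ^+ 2 * x < 1).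

Lemma xsqr_sum_le t : 0 <= x * sqr_sum t <= d%:R ^+ 2 * x.
Proof.
by rewrite mulr_ge0 ?sqr_sum_ge0//= mulrC ler_wpM2r ?sqr_sum_le.
Qed.

Lemma genfun_den_ge t : 1 - d%:R ^+ 2 * x <= 1 - x * sqr_sum t.
Proof. by rewrite lerB//; case/andP: (xsqr_sum_le t). Qed.

Lemma genfun_den_gt0 t : 0 < 1 - x * sqr_sum t.
Proof. by rewrite (lt_le_trans _ (genfun_den_ge t))// subr_gt0. Qed.

Lemma bmf_genfun_den : bmf (fun t => (1 - x * sqr_sum t)^-1).
Proof.
apply: (bmf_inv (m := 1 - d%:R ^+ 2 * x)); first by rewrite subr_gt0.
  exact: genfun_den_ge.
apply: bmfB; first exact: bmf_cst.
by apply: bmfM; [exact: bmf_cst|exact: bmf_sqr_sum].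
Qed.

Lemma genfun_truncation N :
  `|genfun x - gensum N x| <= (1 - d%:R ^+ 2 * x)^-1 * (d%:R ^+ 2 * x) ^+ N.
Proof.
have bZ : bmf (fun t => x * sqr_sum t).
  by apply: bmfM; [exact: bmf_cst|exact: bmf_sqr_sum].
rewrite gensumE -meanB; last 2 first.
- exact: bmf_genfun_den.
- by apply: bmf_sum => i; exact: bmfX.
apply: mean_norm_le => [|t].
  apply: bmfB; first exact: bmf_genfun_den.
  by apply: bmf_sum => i; exact: bmfX.
have h := genfun_den_gt0 t; have /andP[z0 z1] := xsqr_sum_le t.
rewrite (geometric_truncation N); last first.
  by rewrite -subr_eq0 -oppr_eq0 opprB gt_eqF.
rewrite addrAC subrr add0r ger0_norm; last first.
  by rewrite divr_ge0 ?exprn_ge0// ltW.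
rewrite mulrC ler_pM ?invr_ge0 ?exprn_ge0//; first exact: ltW.
  by rewrite lef_pV2 ?posrE// ?subr_gt0//; exact: genfun_den_ge.
by rewrite lerXn2r ?nnegrE// (le_trans z0).
Qed.

End inside_disc.

Section affine_form.
Variable q : C.
Hypothesis hq : d%:R * modulus q < 1.

Local Notation u t := (q * expi_sum t).

Let r := d%:R * modulus q.
Let r0 : 0 <= r. Proof. by rewrite mulr_ge0 ?modulus_ge0. Qed.
Let r1 : 0 <= r < 1. Proof. by rewrite r0. Qed.

Lemma modulus_affine_le (t : d.-tuple T) : modulus (u t) <= r.
Proof. by rewrite modulusM mulrC ler_wpM2r ?modulus_ge0 ?modulus_expi_sum. Qed.

Lemma modulus_affine_ge (t : d.-tuple T) : 1 - r <= modulus (1 - u t).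
Proof.
rewrite (le_trans _ (modulusB_ge _ _))// modulus1 lerB//.
exact: modulus_affine_le.
Qed.

Let r1' : 0 < 1 - r. Proof. by rewrite subr_gt0. Qed.

Lemma affine_neq0 (t : d.-tuple T) : 1 - u t != 0.
Proof.
apply/eqP => h; have := modulus_affine_ge t.
by rewrite h modulus0 leNgt r1'.
Qed.

Let bu : cbmf (fun t : d.-tuple T => u t).
Proof. by apply: cbmfM; [exact: cbmf_cst|exact: cbmf_expi_sum]. Qed.

Lemma cbmf_affine : cbmf (fun t : d.-tuple T => 1 - u t).
Proof. by apply: cbmfB => //; exact: cbmf_cst. Qed.

Lemma cbmf_inv_affine : cbmf (fun t : d.-tuple T => (1 - u t)^-1).
Proof. exact: (cbmf_inv r1' modulus_affine_ge cbmf_affine). Qed.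

(** 1 / (1 - q S) is the sum of the powers of q S, all of mean 0 except the first. *)
Lemma cmean_inv_affine : cmean (fun t : d.-tuple T => (1 - u t)^-1) = 1.
Proof.
apply/eqP; rewrite -subr_eq0; apply/eqP/modulus0_eq0.
apply: (@le_geometric_eq0 _ _ (2 * (1 - r)^-1 * r) r) => // N.
rewrite ger0_norm ?modulus_ge0// -[X in _ <= X]mulrA -[r * r ^+ N]exprS.
have E : cmean (fun t : d.-tuple T => \sum_(n < N.+1) u t ^+ n) = 1.
  rewrite cmean_sum; last by move=> i; exact: cbmfX.
  rewrite big_ord_recl/= big1 ?addr0.
    by rewrite (_ : (fun _ => _) = fun=> 1) ?cmean_cst.
  move=> i _; have -> : (fun t : d.-tuple T => u t ^+ bump 0 i) =
     (fun t => q ^+ i.+1 * (expi_sum t ^+ i.+1 * (expi_sum t)^*%C ^+ 0)).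
    by apply/funext => t; rewrite expr0 mulr1 exprMn.
  rewrite cmeanZ; last first.
    by apply: cbmfM; apply: cbmfX; [|apply: cbmf_conj]; exact: cbmf_expi_sum.
  by rewrite cmean_expi_sum_moments mul0n mulr0.
rewrite -[X in modulus (_ - X)]E -cmeanB; last 2 first.
- exact: cbmf_inv_affine.
- by apply: cbmf_sum => i; exact: cbmfX.
rewrite -mulrA; apply: cmean_norm_le => [|t].
  by apply: cbmfB; [exact: cbmf_inv_affine|apply: cbmf_sum => i; exact: cbmfX].
rewrite (geometric_truncation N.+1); last first.
  by rewrite -subr_eq0 -oppr_eq0 opprB affine_neq0.
rewrite addrAC subrr add0r mulrC modulusM modulusV modulusX.
apply: ler_pM; rewrite ?invr_ge0 ?exprn_ge0 ?modulus_ge0//.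
  by rewrite lef_pV2 ?posrE ?(lt_le_trans r1') ?modulus_affine_ge.
by rewrite lerXn2r ?nnegrE ?modulus_ge0 ?modulus_affine_le.
Qed.

Lemma cmean_sqr_geometric_sum N :
  cmean (fun t : d.-tuple T =>
    (\sum_(n < N) u t ^+ n) * (\sum_(n < N) u t ^+ n)^*%C) =
  (gensum N (modulus q ^+ 2))%:C.
Proof.
pose S (t : d.-tuple T) := expi_sum t.
have bS i j : cbmf (fun t : d.-tuple T => S t ^+ i * (S t)^*%C ^+ j).
  by apply: cbmfM; apply: cbmfX; [|apply: cbmf_conj]; exact: cbmf_expi_sum.
transitivity (cmean (fun t : d.-tuple T => \sum_(i < N) \sum_(j < N)
    (q ^+ i * q^*%C ^+ j) * (S t ^+ i * (S t)^*%C ^+ j))).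
  apply: eq_cavg => t; rewrite rmorph_sum big_distrl/=; apply: eq_bigr => i _.
  rewrite big_distrr/=; apply: eq_bigr => j _.
  by rewrite rmorphXn rmorphM/= !exprMn -/(S t); ring.
rewrite cmean_sum; last first.
  by move=> i; apply: cbmf_sum => j; apply: cbmfM => //; exact: cbmf_cst.
rewrite /gensum rmorph_sum; apply: eq_bigr => i _.
rewrite cmean_sum; last by move=> j; apply: cbmfM => //; exact: cbmf_cst.
rewrite (bigD1 i)//= big1 ?addr0 => [|j ji].
  rewrite cmeanZ// cmean_expi_sum_moments eqxx mul1n -exprMn mulr_conj.
  by rewrite -rmorphXn [RHS]rmorphM [RHS]mulrC; congr (_ * _);
    rewrite rmorph_nat.
rewrite cmeanZ// cmean_expi_sum_moments (_ : (i == j :> nat) = false).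
  by rewrite mul0n mulr0.
by apply/negbTE; rewrite eq_sym.
Qed.

(** By orthogonality of the powers of S, the squared modulus of a partial sum of
    1 / (1 - q S) has mean [gensum]; both sides are limits of these at a
    geometric rate. *)
Lemma cmean_inv_sqr_affine :
  cmean (fun t : d.-tuple T => ((modulus (1 - u t) ^+ 2)^-1)%:C) =
  (genfun (modulus q ^+ 2))%:C.
Proof.
pose g (t : d.-tuple T) := (1 - u t)^-1.
pose s N (t : d.-tuple T) := \sum_(n < N) u t ^+ n.
have bg : cbmf g by exact: cbmf_inv_affine.
have bs N : cbmf (s N) by apply: cbmf_sum => i; exact: cbmfX.
have gE t : ((modulus (1 - u t) ^+ 2)^-1)%:C = g t * (g t)^*%C.
  by rewrite mulr_conj modulusV exprVn.
rewrite (_ : (fun _ => _) = (fun t => g t * (g t)^*%C)); last first.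
  by apply/funext => t; rewrite gE.
have x0 : 0 <= modulus q ^+ 2 by exact: sqr_ge0.
have x1 : d%:R ^+ 2 * modulus q ^+ 2 < 1.
  by rewrite -exprMn expr_lt1.
apply/eqP; rewrite -subr_eq0; apply/eqP/modulus0_eq0.
pose K := (1 - r)^-1 ^+ 2.
apply: (@le_geometric_eq0 _ _ (2 * (3 * K) + (1 - r ^+ 2)^-1) r) => // N.
rewrite ger0_norm ?modulus_ge0//.
rewrite -(subrK (gensum N (modulus q ^+ 2))%:C (cmean _)) -addrA.
rewrite (le_trans (modulusD_le _ _))// mulrDl lerD//; last first.
  rewrite (_ : _ - _ =
    (gensum N (modulus q ^+ 2) - genfun (modulus q ^+ 2))%:C);
    last by rewrite rmorphB.
  rewrite modulus_real distrC.
  rewrite (le_trans (genfun_truncation x0 x1 N))// -exprMn -/r.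
  rewrite ler_wpM2l ?invr_ge0 ?subr_ge0 ?expr_le1// ?(ltW hq)//.
  by rewrite -exprM ler_wiXn2l ?leq_pmull// ltW.
rewrite -cmean_sqr_geometric_sum -cmeanB; last 2 first.
- by apply: cbmfM => //; exact: cbmf_conj.
- by apply: cbmfM; [exact: (bs N)|apply: cbmf_conj; exact: (bs N)].
rewrite -mulrA; apply: cmean_norm_le => [|t].
  apply: cbmfB.
    by apply: cbmfM => //; exact: cbmf_conj.
  by apply: cbmfM; [exact: (bs N)|apply: cbmf_conj; exact: (bs N)].
rewrite -/(s N t).
have gs : s N t = g t * (1 - u t ^+ N).
  rewrite /g (_ : 1 - u t ^+ N = (1 - u t) * s N t) ?mulKf ?affine_neq0//.
  by rewrite -opprB subrX1 -mulNr opprB.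
rewrite gs rmorphM mulrACA -[X in X - _]mulr1 -mulrBr modulusM mulrC.
rewrite mulrAC; apply: ler_pM; rewrite ?modulus_ge0//.
  rewrite rmorphB rmorph1/=.
  set v := u t ^+ N; have vN : modulus v <= r ^+ N.
    by rewrite modulusX lerXn2r ?nnegrE ?modulus_ge0 ?modulus_affine_le.
  rewrite (_ : 1 - _ = v + v^*%C - v * v^*%C); last by ring.
  rewrite (le_trans (modulusD_le _ _))// modulusN modulusM.
  have : modulus (v + v^*%C) <= r ^+ N + r ^+ N.
    by rewrite (le_trans (modulusD_le _ _))// lerD// modulus_conj.
  have : modulus v * modulus v^*%C <= r ^+ N.
    rewrite modulus_conj -[leRHS]mulr1 ler_pM ?modulus_ge0//.
    by rewrite (le_trans vN)// exprn_ile1// ltW.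
  lra.
rewrite modulusM modulus_conj -expr2 /K lerXn2r ?nnegrE ?modulus_ge0 ?invr_ge0
  ?(ltW r1')//.
by rewrite /g modulusV lef_pV2 ?posrE ?(lt_le_trans r1') ?modulus_affine_ge.
Qed.

End affine_form.
End generating_function.

(** * Fourier coefficients of the inverse squared modulus *)

Section coordinate_symmetry.
Variable R : realType.
Local Notation C := R[i].
Local Notation T := (measurableTypeR R).

(** [stable_cbmf H M]: composing [H] with bounded measurable functions, the
    second one of modulus at most [M], gives a bounded measurable function. *)
Definition stable_cbmf (H : C -> C -> C) (M : R) : Prop :=
  forall d (X : measurableType d) (f g : X -> C), cbmf f -> cbmf g ->
    (forall x, modulus (g x) <= M) -> cbmf (fun x => H (f x) (g x)).

Lemma cbmf_tnth n (j : 'I_n) : cbmf (fun t : n.-tuple T => expi (tnth t j)).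
Proof. by apply: cbmf_expi; exact: measurable_tnth. Qed.

Lemma stable_cbmf_shift H M (z : C) : modulus z = 1 -> stable_cbmf H (1 + M) ->
  stable_cbmf (fun w s => H w (z + s)) M.
Proof.
move=> z1 hH d X f g bf bg gM; apply: hH => //.
  by apply: cbmfD => //; exact: cbmf_cst.
by move=> x; rewrite (le_trans (modulusD_le _ _))// z1 lerD2l.
Qed.

(** The mean of H (z_j, z_1 + ... + z_n) does not depend on j: two variables can be
    exchanged by Fubini's theorem, and the other cases follow by induction. *)
Lemma cmean_coordinate n H (M : R) (j : 'I_n.+1) : n.+1%:R <= M ->
  stable_cbmf H M ->
  cmean (fun t : n.+1.-tuple T => H (expi (tnth t j)) (expi_sum t)) =
  cmean (fun t : n.+1.-tuple T => H (expi (tnth t ord0)) (expi_sum t)).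
Proof.
elim: n H M j => [|n IH] H M j nM hH; first by rewrite ord1.
have bH i : cbmf (fun t : n.+2.-tuple T => H (expi (tnth t i)) (expi_sum t)).
  apply: hH; [exact: cbmf_tnth|exact: cbmf_expi_sum|].
  by move=> t; rewrite (le_trans (modulus_expi_sum _)).
have [i ->|->//] := unliftP ord0 j.
have tnthS (x : T) (t : n.+1.-tuple T) k :
  tnth (tuple_cons (x, t)) (lift ord0 k) = tnth t k.
  by rewrite !(tnth_nth 0).
have tnth0 m (x : T) (t : m.-tuple T) : tnth (tuple_cons (x, t)) ord0 = x.
  by rewrite (tnth_nth 0).
pose f (z : T * T) (t : n.-tuple T) :=
  H (expi z.2) (expi z.1 + (expi z.2 + expi_sum t)).
have bz1 : cbmf (fun z : (T * T) * n.-tuple T => expi z.1.1).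
  by apply: cbmf_expi; exact: measurableT_comp.
have bz2 : cbmf (fun z : (T * T) * n.-tuple T => expi z.1.2).
  by apply: cbmf_expi; exact: measurableT_comp.
have bz3 : cbmf (fun z : (T * T) * n.-tuple T => expi_sum z.2).
  exact: (cbmf_comp measurable_snd (@cbmf_expi_sum _ _)).
have bf : cbmf (fun z => f z.1 z.2).
  apply: hH => //.
    by apply: cbmfD => //; exact: cbmfD.
  move=> [[x y] t] /=; rewrite (le_trans (modulusD_le _ _))// modulus_expi.
  rewrite (le_trans _ nM)// -[n.+2]add1n natrD lerD2l.
  rewrite (le_trans (modulusD_le _ _))// modulus_expi.
  by rewrite -[n.+1]add1n natrD lerD2l modulus_expi_sum.
transitivity (cmean1 (fun x => cmean1 (fun y => cmean (f (x, y))))).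
  rewrite cmeanS//; apply: eq_cavg => x.
  transitivity (cmean (fun t : n.+1.-tuple T =>
      H (expi (tnth t i)) (expi x + expi_sum t))).
    by apply: eq_cavg => t; rewrite tnthS expi_sum_cons.
  have hx : stable_cbmf (fun w s => H w (expi x + s)) (M - 1).
    apply: stable_cbmf_shift; first exact: modulus_expi.
    by rewrite addrC subrK.
  have nM1 : n.+1%:R <= M - 1 by rewrite lerBrDr natr1.
  rewrite (IH (fun w s => H w (expi x + s)) (M - 1) i nM1 hx).
  rewrite cmeanS; last first.
    apply: hx; [exact: cbmf_tnth|exact: cbmf_expi_sum|].
    by move=> t; rewrite (le_trans (modulus_expi_sum _)).
  apply: eq_cavg => y; apply: eq_cavg => t.
  by rewrite tnth0 expi_sum_cons.
have bg : cbmf (fun z : T * T => cmean (f z)) by exact: (cbmf_cmean bf).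
rewrite (cmean1_swap bg).
rewrite cmeanS//; apply: eq_cavg => x; rewrite cmeanS; last first.
  have := cbmf_slice x (cbmf_tuple_cons (bH ord0)); exact.
apply: eq_cavg => y; apply: eq_cavg => t.
by rewrite tnth0 !expi_sum_cons /f/= addrCA.
Qed.

End coordinate_symmetry.

Section fourier.
Variable R : realType.
Local Notation C := R[i].
Local Notation T := (measurableTypeR R).

(** Fourier coefficients are means over the torus. *)
Lemma fourier_coef_cmean d (f : ('I_d -> C) -> C) (k : 'I_d -> int) :
  fourier_coef f k = cmean (fun t : d.-tuple T =>
    f (fun j => expi (tnth t j)) * expi (- \sum_(j < d) (k j)%:~R * tnth t j)).
Proof.
rewrite /fourier_coef /cmean /cavg /avg lebesgue_cube /=.
by apply/eqP; rewrite eq_complex /= !mul0r subr0 addr0 !eqxx.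
Qed.

Variable d : nat.
Variable q : C.
Hypothesis hq : d%:R * modulus q < 1.
Let w (s : C) : C := ((modulus (1 - q * s) ^+ 2)^-1)%:C.

Let wE s : w s = (1 - q * s)^-1 * ((1 - q * s)^-1)^*%C.
Proof. by rewrite mulr_conj modulusV exprVn. Qed.

Lemma stable_cbmf_w : stable_cbmf (fun z s => w s * z^*%C) d%:R.
Proof.
move=> d' X f g bf bg gd; apply: cbmfM; last exact: cbmf_conj.
under eq_fun do rewrite wE.
suff h : cbmf (fun x => (1 - q * g x)^-1) by apply: cbmfM => //;
  exact: cbmf_conj.
apply: (cbmf_inv (m := 1 - d%:R * modulus q)); first by rewrite subr_gt0.
- move=> x; rewrite (le_trans _ (modulusB_ge _ _))// modulus1 lerB// modulusM.
  by rewrite mulrC ler_wpM2r ?modulus_ge0.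
- apply: cbmfB; first exact: cbmf_cst.
  by apply: cbmfM => //; exact: cbmf_cst.
Qed.

(** The Fourier coefficient of |1 - q S|^(-2) at the j-th unit vector. *)
Definition first_coef (j : 'I_d) : C :=
  cmean (fun t : d.-tuple T => w (expi_sum t) * (expi (tnth t j))^*%C).

Lemma first_coef_eq (i j : 'I_d) : first_coef i = first_coef j.
Proof.
rewrite /first_coef; have := stable_cbmf_w.
case: d i j => [[]//|n] i j hw.
have h k := cmean_coordinate k (lexx _) hw.
by rewrite !h.
Qed.

Let bw (j : 'I_d) : cbmf (fun t : d.-tuple T =>
  w (expi_sum t) * (expi (tnth t j))^*%C).
Proof.
apply: stable_cbmf_w; [exact: cbmf_tnth|exact: cbmf_expi_sum|].
exact: modulus_expi_sum.
Qed.

Let bws : cbmf (fun t : d.-tuple T => w (expi_sum t)).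
Proof.
have := cbmf_inv_affine hq => b.
by under eq_fun do rewrite wE; apply: cbmfM => //; exact: cbmf_conj.
Qed.

Lemma sum_first_coef (j : 'I_d) : d%:R * first_coef j =
  cmean (fun t : d.-tuple T => w (expi_sum t) * (expi_sum t)^*%C).
Proof.
transitivity (\sum_(i < d) first_coef i).
  under eq_bigr do rewrite (first_coef_eq _ j).
  by rewrite sumr_const card_ord mulr_natl.
rewrite /first_coef -cmean_sum//.
by apply: eq_cavg => t; rewrite -big_distrr; congr (_ * _);
  rewrite [RHS]rmorph_sum.
Qed.

(** The mean of (1 - q S)^-1 is 1; multiplying and dividing by the conjugate
    of 1 - q S relates the zeroth and the first Fourier coefficients. *)
Lemma first_coef_genfun (j : 'I_d) :
  d%:R * q^*%C * first_coef j = (genfun d (modulus q ^+ 2))%:C - 1.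
Proof.
have bS : cbmf (fun t : d.-tuple T => w (expi_sum t) * (expi_sum t)^*%C).
  by apply: cbmfM => //; apply: cbmf_conj; exact: cbmf_expi_sum.
rewrite mulrAC sum_first_coef mulrC -cmeanZ//.
rewrite -(cmean_inv_sqr_affine hq) -[X in _ - X](cmean_inv_affine hq).
rewrite -cmeanB//; last exact: cbmf_inv_affine.
apply: eq_cavg => t; rewrite -/(w _) wE.
have n0 := affine_neq0 hq t.
set v := 1 - q * expi_sum t in n0 *.
have -> : q^*%C * ((v^-1 * (v^-1)^*%C) * (expi_sum t)^*%C) =
    (v^-1 * (v^-1)^*%C) * (1 - v^*%C).
  have -> : v^*%C = 1 - q^*%C * (expi_sum t)^*%C by rewrite /v rmorphB
    rmorph1 rmorphM.
  by ring.
rewrite mulrBr mulr1 -mulrA -rmorphM mulVf// rmorph1 mulr1//.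
Qed.

Lemma first_coef_0 (j : 'I_d) : q = 0 -> first_coef j = 0.
Proof.
move=> q0; have d0 : d%:R != 0 :> C.
  by rewrite pnatr_eq0 -lt0n (leq_ltn_trans _ (ltn_ord j)).
apply: (mulfI d0); rewrite sum_first_coef mulr0.
have bS : cbmf (fun t : d.-tuple T => expi_sum t ^+ 1 * (expi_sum t)^*%C ^+ 0).
  by apply: cbmfM; apply: cbmfX; [|apply: cbmf_conj]; exact: cbmf_expi_sum.
have := cmean_expi_sum_moments R d 1 0; rewrite mul0n mulr0n => h.
rewrite -[RHS]conjc0 -h -cmean_conj//.
apply: eq_cavg => t; rewrite /w q0 mul0r subr0 modulus1 expr1n invr1 mul1r.
by rewrite expr1 expr0 mulr1.
Qed.

End fourier.

Section real_complex_morphism.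
Variable R : realType.
Implicit Types x y : R.

Lemma real_complexM x y : (x * y)%:C = x%:C * y%:C.
Proof. exact: (rmorphM (real_complex R)). Qed.
Lemma real_complexD x y : (x + y)%:C = x%:C + y%:C.
Proof. exact: (rmorphD (real_complex R)). Qed.
Lemma real_complexB x y : (x - y)%:C = x%:C - y%:C.
Proof. exact: (rmorphB (real_complex R)). Qed.
Lemma real_complexN x : (- x)%:C = - x%:C.
Proof. exact: (rmorphN (real_complex R)). Qed.
Lemma real_complexX x n : (x ^+ n)%:C = x%:C ^+ n.
Proof. exact: (rmorphXn (real_complex R)). Qed.
Lemma real_complexV x : (x^-1)%:C = x%:C^-1.
Proof. exact: (fmorphV (real_complex R)). Qed.
Lemma real_complex_nat n : (n%:R : R)%:C = n%:R.
Proof. exact: (rmorph_nat (real_complex R)). Qed.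

End real_complex_morphism.

Section degree_one.
Variable R : realType.
Local Notation C := R[i].
Local Notation T := (measurableTypeR R).
Variable d : nat.
Hypothesis d0 : (0 < d)%N.

(** If |p_0| <= d |p_1| then the polynomial vanishes at a point with equal
    coordinates. *)
Lemma stable_deg1 (p0 p1 : C) :
  stable (@deg1_sympoly R d p0 p1) <-> d%:R * modulus p1 < modulus p0.
Proof.
split=> [st|lt z z1]; last first.
  apply/eqP => h; move: lt; rewrite ltNge => /negP; apply.
  have -> : p0 = - (p1 * \sum_(j < d) z j).
    by apply/eqP; rewrite -subr_eq0 opprK -/(deg1_sympoly p0 p1 z) h.
  rewrite modulusN modulusM mulrC ler_wpM2r ?modulus_ge0//.
  rewrite (le_trans (modulus_sum_le _ _ _))//.
  rewrite (le_trans (ler_sum _ (G := fun=> 1) _))//.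
    by move=> j _; have := z1 j; rewrite modulusE lecR.
  by rewrite sumr_const card_ord.
rewrite ltNge; apply/negP => le.
have p0n : p0 != 0.
  apply/eqP => p00; have := st (fun=> 0);
    rewrite /deg1_sympoly p00 big1// mulr0 addr0 eqxx.
  by move=> h; suff : false by []; apply: h => j; rewrite normr0.
have p1n : p1 != 0.
  apply: contraNneq p0n => p10; move: le; rewrite p10 modulus0 mulr0 => le.
  by apply/eqP/modulus0_eq0/eqP; rewrite eq_le le modulus_ge0.
have dn : d%:R != 0 :> C by rewrite pnatr_eq0 -lt0n.
have dR : 0 < d%:R :> R by rewrite ltr0n.
have p1R : 0 < modulus p1.
  rewrite lt_def modulus_ge0 andbT; apply: contraNneq p1n => /modulus0_eq0 ->.
  by [].
have := st (fun=> - (p0 / (d%:R * p1))); rewrite /deg1_sympoly.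
rewrite sumr_const card_ord -[X in p1 * X]mulr_natl mulrN mulrN.
rewrite (_ : p1 * _ = p0) ?subrr ?eqxx; last by field; rewrite dn p1n.
move=> h; suff : false by []; apply: h => j.
rewrite modulusE modulusN modulusM modulusV modulusM lecR.
rewrite ler_pdivrMr ?mul1r; last first.
  by rewrite mulr_gt0// -[d%:R]/(d%:R) -(rmorph_nat (real_complex R))
    modulus_real ger0_norm.
by rewrite -(rmorph_nat (real_complex R)) modulus_real ger0_norm.
Qed.

Variables (p0 p1 : C).
Hypothesis lt : d%:R * modulus p1 < modulus p0.
Let q := - (p1 / p0).

Lemma p0_gt0 : 0 < modulus p0.
Proof. by rewrite (le_lt_trans _ lt)// mulr_ge0 ?modulus_ge0. Qed.

Lemma p0_neq0 : p0 != 0.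
Proof.
by apply/eqP => h; have := p0_gt0; rewrite h modulus0 ltxx.
Qed.

Lemma ratio_lt : d%:R * modulus q < 1.
Proof.
rewrite /q modulusN modulusM modulusV mulrA ltr_pdivrMr ?p0_gt0//.
by rewrite mul1r.
Qed.

Lemma inv_sqr_modulus_deg1 (t : d.-tuple T) :
  inv_sqr_modulus (deg1_sympoly p0 p1) (fun j => expi (tnth t j)) =
  ((modulus p0 ^+ 2)^-1)%:C * ((modulus (1 - q * expi_sum t) ^+ 2)^-1)%:C.
Proof.
rewrite /inv_sqr_modulus (_ : deg1_sympoly _ _ _ = p0 * (1 - q * expi_sum t)).
  rewrite modulusE modulusM -rmorphXn -rmorphM -invfM -exprMn.
  by rewrite -(fmorphV (real_complex R)).
rewrite /deg1_sympoly -/(expi_sum t) /q mulrBr mulr1 mulNr mulrN opprK mulrA.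
by rewrite mulrCA mulfV ?mulr1// p0_neq0.
Qed.

Lemma cbmf_inv_sqr_modulus :
  cbmf (fun t : d.-tuple T => ((modulus (1 - q * expi_sum t) ^+ 2)^-1)%:C).
Proof.
have b := cbmf_inv_affine ratio_lt.
have -> : (fun t : d.-tuple T => ((modulus (1 - q * expi_sum t) ^+ 2)^-1)%:C) =
    (fun t => (1 - q * expi_sum t)^-1 * ((1 - q * expi_sum t)^-1)^*%C).
  by apply/funext => t; rewrite mulr_conj modulusV exprVn.
by apply: cbmfM => //; exact: cbmf_conj.
Qed.

Lemma fourier_coef0 :
  fourier_coef (inv_sqr_modulus (@deg1_sympoly R d p0 p1)) (fun=> 0) =
  ((modulus p0 ^+ 2)^-1 * genfun d (modulus q ^+ 2))%:C.
Proof.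
rewrite fourier_coef_cmean real_complexM -(cmean_inv_sqr_affine ratio_lt).
rewrite -cmeanZ; last exact: cbmf_inv_sqr_modulus.
apply: eq_cavg => t; rewrite inv_sqr_modulus_deg1.
by rewrite big1 ?oppr0 ?expi0 ?mulr1// => j _; rewrite mul0r.
Qed.

Lemma fourier_coef1 (j : 'I_d) : j = 0%N :> nat ->
  fourier_coef (inv_sqr_modulus (@deg1_sympoly R d p0 p1)) (@first_index d) =
  ((modulus p0 ^+ 2)^-1)%:C * first_coef q j.
Proof.
move=> j0; rewrite fourier_coef_cmean /first_coef -cmeanZ; last first.
  apply: cbmfM; first exact: cbmf_inv_sqr_modulus.
  by apply: cbmf_conj; exact: cbmf_tnth.
apply: eq_cavg => t; rewrite inv_sqr_modulus_deg1 -mulrA; congr (_ * (_ * _)).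
rewrite conj_expi (bigD1 j)//= big1 ?addr0.
  by rewrite /first_index j0 eqxx mul1r.
move=> i ij; rewrite /first_index (_ : (i == 0 :> nat) = false) ?mul0r//.
by apply/negbTE; apply: contra ij => /eqP i0; apply/eqP/val_inj;
  rewrite /= i0 j0.
Qed.

(** The relation between the two Fourier coefficients and the coefficients of
    the polynomial: the first row of the linear system for p_0 and p_1. *)
Lemma fourier_coef_relation a b :
  fourier_coef (inv_sqr_modulus (@deg1_sympoly R d p0 p1)) (fun=> 0) = a%:C ->
  fourier_coef (inv_sqr_modulus (@deg1_sympoly R d p0 p1))
    (@first_index d) = b ->
  a = (modulus p0 ^+ 2)^-1 * genfun d (modulus q ^+ 2) /\
  d%:R * q^*%C * b = (a - (modulus p0 ^+ 2)^-1)%:C.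
Proof.
pose j : 'I_d := Ordinal d0.
rewrite fourier_coef0 (fourier_coef1 (j := j))// =>
  /(@complexI R) <- <-; split=> //.
rewrite mulrCA first_coef_genfun ?ratio_lt//.
by rewrite mulrBr mulr1 [RHS]real_complexB [X in _ = X - _]real_complexM.
Qed.

End degree_one.

(** * Inequalities for the generating function *)

Section generating_function_analysis.
Variable R : realType.
Local Notation T := (measurableTypeR R).
Variable d : nat.
Implicit Types (x y : R) (t : d.-tuple T).
Local Notation F := (@genfun R d).
Local Notation Z := (@sqr_sum R d).
Local Notation u x t := ((1 - x * Z t)^-1).

Lemma mom_0 k : mom k 0 = 1%N.
Proof.
elim: k => [//|k IH] /=.
by rewrite big_ord_recl big_ord0 /= bin0 IH.
Qed.

Lemma mom_1 k : mom k 1 = k.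
Proof.
elim: k => [//|k IH] /=.
by rewrite !big_ord_recl big_ord0 /= bin0 subn0 IH /bump/= binn subnn mom_0
  !mul1n addn1.
Qed.

Lemma mean_sqr_sum : mean Z = d%:R.
Proof.
rewrite -[RHS](congr1 (fun n => n%:R) (mom_1 d)) -(mean_sqr_sumX R).
by apply: eq_avg => t; rewrite expr1.
Qed.

Lemma bmf_weighted x : 0 <= x -> d%:R ^+ 2 * x < 1 -> bmf (fun t =>
  Z t * u x t).
Proof. by move=> x0 x1; apply: bmfM;
  [exact: bmf_sqr_sum|exact: bmf_genfun_den]. Qed.

Lemma genfunE x : 0 <= x -> d%:R ^+ 2 * x < 1 ->
  F x = 1 + x * mean (fun t => Z t * u x t).
Proof.
move=> x0 x1; have bw := bmf_weighted x0 x1.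
rewrite -meanZ// -[X in X + _](mean_cst d) -meanD//; last 2 first.
- exact: bmf_cst.
- by apply: bmfM => //; exact: bmf_cst.
apply: eq_avg => t; have := genfun_den_gt0 x0 x1 t => h.
by field; rewrite gt_eqF.
Qed.

Lemma weighted_ge0 x : 0 <= x -> d%:R ^+ 2 * x < 1 -> 0 <= mean (fun t =>
  Z t * u x t).
Proof.
move=> x0 x1; rewrite -(mean_cst d 0); apply: mean_le.
- exact: bmf_cst.
- exact: bmf_weighted.
- move=> t; rewrite mulr_ge0 ?sqr_sum_ge0// invr_ge0 ltW//.
  exact: genfun_den_gt0.
Qed.

Lemma genfun_ge1 x : 0 <= x -> d%:R ^+ 2 * x < 1 -> 1 <= F x.
Proof. by move=> x0 x1; rewrite genfunE// lerDl mulr_ge0// weighted_ge0. Qed.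

(** The bound |S| <= d is only used in the denominator, |S|^2 having mean d. *)
Lemma genfun_upper x : 0 <= x -> d%:R ^+ 2 * x < 1 ->
  F x <= 1 + x * (d%:R / (1 - d%:R ^+ 2 * x)).
Proof.
move=> x0 x1; rewrite genfunE// lerD2l ler_wpM2l//.
rewrite mulrC -[X in _ <= _ * X]mean_sqr_sum -meanZ; last exact: bmf_sqr_sum.
apply: mean_le; first exact: bmf_weighted.
  by apply: bmfM; [exact: bmf_cst|exact: bmf_sqr_sum].
move=> t; rewrite mulrC ler_wpM2r ?sqr_sum_ge0//.
rewrite lef_pV2 ?posrE ?subr_gt0//; first exact: genfun_den_ge.
by rewrite -subr_gt0 genfun_den_gt0.
Qed.

(** Jensen's inequality, through the tangent at the mean value of |S|^2. *)
Lemma genfun_lower x : 0 <= x -> d%:R ^+ 2 * x < 1 -> d%:R * x < 1 ->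
  (1 - d%:R * x)^-1 <= F x.
Proof.
move=> x0 x1 x1'; set c := 1 - d%:R * x.
have c0 : 0 < c by rewrite subr_gt0.
have bZ := @bmf_sqr_sum R d.
(* the tangent to z |-> 1 / (1 - x z) at z = d *)
pose g t := 2 / c - c ^- 2 + (c ^- 2 * x) * Z t.
have -> : c^-1 = mean g.
  rewrite /g meanD//; last 2 first.
  - exact: bmf_cst.
  - by apply: bmfM => //; exact: bmf_cst.
  rewrite mean_cst meanZ// mean_sqr_sum.
  have cE : 1 - d%:R * x != 0 by rewrite gt_eqF.
  by rewrite /c; field.
apply: mean_le.
- apply: bmfD; first exact: bmf_cst.
  by apply: bmfM => //; exact: bmf_cst.
- exact: bmf_genfun_den.
- move=> t; rewrite /g; have v0 := genfun_den_gt0 x0 x1 t.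
  set v := 1 - x * Z t in v0 *.
  have -> : 2 / c - c ^- 2 + c ^- 2 * x * Z t = 2 / c - v / c ^+ 2.
    by rewrite /v; field; rewrite gt_eqF.
  rewrite -subr_ge0 (_ : _ - _ = (v - c) ^+ 2 / (v * c ^+ 2)); last first.
    by field; rewrite !gt_eqF.
  by rewrite divr_ge0 ?sqr_ge0// mulr_ge0 ?sqr_ge0// ltW.
Qed.

(** The mean of |S|^2 under the weight 1/(1 - x |S|^2) increases with x. *)
Lemma tilted_mean_le x y : 0 <= x -> x <= y -> d%:R ^+ 2 * y < 1 ->
  mean (fun t => Z t * u x t) * F y <= mean (fun t => Z t * u y t) * F x.
Proof.
move=> x0 xy y1; have y0 := le_trans x0 xy.
have x1 : d%:R ^+ 2 * x < 1.
  by rewrite (le_lt_trans _ y1)// ler_wpM2l ?sqr_ge0.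
have bZ := @bmf_sqr_sum R d.
have bx := bmf_weighted x0 x1. have by_ := bmf_weighted y0 y1.
have bux := bmf_genfun_den x0 x1. have buy := bmf_genfun_den y0 y1.
set B := mean _; set B' := (X in _ <= X * _).
have A0 : 0 < F x by rewrite (lt_le_trans ltr01)// genfun_ge1.
pose m := B / F x.
have Bm : B = m * F x by rewrite /m mulfVK// gt_eqF.
have m0 : 0 <= m by rewrite divr_ge0 ?weighted_ge0// ltW.
have md : m <= d%:R ^+ 2.
  rewrite ler_pdivrMr// -meanZ//; apply: mean_le => //.
    by apply: bmfM => //; exact: bmf_cst.
  move=> t; rewrite ler_wpM2r ?sqr_sum_le// invr_ge0 ltW//.
  exact: genfun_den_gt0.
have ym : 0 < 1 - y * m.
  by rewrite subr_gt0 (le_lt_trans _ y1)// mulrC ler_wpM2r.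
have xm : 0 < 1 - x * m.
  by rewrite subr_gt0 (le_lt_trans _ x1)// mulrC ler_wpM2r.
rewrite Bm mulrAC ler_pM2r//.
(* (Z - m) / (1 - y Z) >= c (Z - m) / (1 - x Z) pointwise, with equality at Z = m *)
pose c := (1 - x * m) / (1 - y * m).
have h : mean (fun t => c * (Z t * u x t - m * u x t)) <=
         mean (fun t => Z t * u y t - m * u y t).
  apply: mean_le.
  - apply: bmfM; first exact: bmf_cst.
    by apply: bmfB => //; apply: bmfM => //; exact: bmf_cst.
  - by apply: bmfB => //; apply: bmfM => //; exact: bmf_cst.
  - move=> t; have vx := genfun_den_gt0 x0 x1 t;
    have vy := genfun_den_gt0 y0 y1 t.
    rewrite -subr_ge0 (_ : _ - _ = (y - x) * (Z t - m) ^+ 2 /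
       ((1 - x * Z t) * (1 - y * Z t) * (1 - y * m))); last first.
      by rewrite /c; field; rewrite !gt_eqF.
    apply: divr_ge0; first by rewrite mulr_ge0 ?sqr_ge0 ?subr_ge0.
    by rewrite ltW// !mulr_gt0.
have bmx : bmf (fun t => m * u x t) by apply: bmfM => //; exact: bmf_cst.
have bmy : bmf (fun t => m * u y t) by apply: bmfM => //; exact: bmf_cst.
move: h; rewrite meanZ; last exact: bmfB.
rewrite !meanB// !meanZ// -/B -/B' -/(F x) -/(F y) Bm subrr mulr0 subr_ge0.
by [].
Qed.

(** The quotient (1 - 1/F(x)) / x increases with x: it is the mean of |S|^2 under
    the weight 1/(1 - x |S|^2). *)
Lemma genfun_ratio_le x y : 0 < x -> x <= y -> d%:R ^+ 2 * y < 1 ->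
  y * (1 - (F x)^-1) <= x * (1 - (F y)^-1).
Proof.
move=> x0 xy y1; have y0 := lt_le_trans x0 xy.
have x1 : d%:R ^+ 2 * x < 1.
  by rewrite (le_lt_trans _ y1)// ler_wpM2l ?sqr_ge0.
have h := tilted_mean_le (ltW x0) xy y1.
have A0 : 0 < F x by rewrite (lt_le_trans ltr01)// genfun_ge1// ltW.
have A0' : 0 < F y by rewrite (lt_le_trans ltr01)// genfun_ge1// ltW.
have E z : 0 < z -> 0 < F z -> d%:R ^+ 2 * z < 1 ->
    1 - (F z)^-1 = z * (mean (fun t => Z t * u z t) / F z).
  move=> z0 Fz z1; rewrite mulrA.
  have := genfunE (ltW z0) z1 => e.
  rewrite (_ : z * mean _ = F z - 1); last by rewrite e addrC addKr.
  by field; rewrite gt_eqF.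
rewrite !E// mulrCA ler_pM2l// ler_pM2l//.
by rewrite ler_pdivrMr// mulrAC ler_pdivlMr.
Qed.

End generating_function_analysis.

(** * Sums of squared multinomial coefficients *)

Section multinomial_sums.

Lemma multinomial_fact d (k : 'I_d -> nat) :
  (multinomial k * \prod_(j < d) (k j)`!)%N = (\sum_(j < d) k j)`!.
Proof.
rewrite /multinomial divnK//.
elim: d k => [|d IH] k; first by rewrite !big_ord0.
rewrite !big_ord_recl.
set s := (\sum_(i < d) _)%N.
have sk : (k ord0 <= k ord0 + s)%N by rewrite leq_addr.
rewrite -(bin_fact sk) addKn dvdn_mull// dvdn_mul//.
Qed.

Lemma multinomial_recl d (k : 'I_d.+1 -> nat) :
  multinomial k = ('C(\sum_(j < d.+1) k j, k ord0) *
                   multinomial (fun j => k (lift ord0 j)))%N.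
Proof.
have p0 : (0 < \prod_(j < d.+1) (k j)`!)%N by apply: prodn_gt0 => j;
  exact: fact_gt0.
apply/eqP; rewrite -(eqn_pmul2r p0) multinomial_fact; apply/eqP.
have sk : (k ord0 <= \sum_(j < d.+1) k j)%N by rewrite big_ord_recl leq_addr.
rewrite -(bin_fact sk) -mulnA; congr (_ * _)%N.
rewrite [in RHS]big_ord_recl mulnCA multinomial_fact; congr (_ * _)%N.
by rewrite big_ord_recl addKn.
Qed.

(** Functions on 'I_(d + 1) as pairs of a first value and the other values. *)
Definition ffun_cons d (A : Type) (z : A * {ffun 'I_d ->
  A}) : {ffun 'I_d.+1 -> A} :=
  [ffun j => if unlift ord0 j is Some i then z.2 i else z.1].

Definition ffun_uncons d (A : Type) (f : {ffun 'I_d.+1 ->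
  A}) : A * {ffun 'I_d -> A} :=
  (f ord0, [ffun i => f (lift ord0 i)]).

Lemma ffun_consK d A : cancel (@ffun_cons d A) (@ffun_uncons d A).
Proof.
move=> [a f]; rewrite /ffun_uncons /ffun_cons ffunE unlift_none; congr pair.
by apply/ffunP => i; rewrite !ffunE liftK.
Qed.

Lemma ffun_unconsK d A : cancel (@ffun_uncons d A) (@ffun_cons d A).
Proof.
move=> f; apply/ffunP => j; rewrite /ffun_cons /ffun_uncons ffunE.
by case: unliftP => [i|] ->; rewrite ?ffunE.
Qed.

(** The recursion on the number of variables groups the indices by the value of
    the first one. The codomain 'I_N.+1 may be larger than needed, so that all
    remainders n - i can share it. *)
Lemma sum_sqr_multinomial d N n : (n <= N)%N ->
  (\sum_(k : {ffun 'I_d -> 'I_N.+1} | (\sum_(j < d) k j == n)%N)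
     multinomial (fun j => k j) ^ 2)%N = mom d n.
Proof.
elim: d n => [|d IH] n nN.
  have E (k : {ffun 'I_0 -> 'I_N.+1}) : (\sum_(j < 0) k j == n)%N = (n == 0%N).
    by rewrite big_ord0 eq_sym.
  under eq_bigl do rewrite E.
  rewrite (eq_bigr (fun=> 1%N)) => [|k _]; last first.
    by rewrite /multinomial !big_ord0.
  rewrite /=; case: (n == 0%N); last by rewrite big_pred0.
  by rewrite sum1_card card_ffun !card_ord expn0.
rewrite (reindex (@ffun_cons d 'I_N.+1)); last first.
  exists (@ffun_uncons d 'I_N.+1) => z _;
    [exact: ffun_consK|exact: ffun_unconsK].
have S (z : 'I_N.+1 * {ffun 'I_d -> 'I_N.+1}) :
    (\sum_(j < d.+1) ffun_cons z j = z.1 + \sum_(j < d) z.2 j)%N.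
  rewrite big_ord_recl ffunE unlift_none; congr (_ + _)%N.
  by apply: eq_bigr => j _; rewrite ffunE liftK.
have M (z : 'I_N.+1 * {ffun 'I_d -> 'I_N.+1}) :
    multinomial (fun j => ffun_cons z j) =
    ('C(z.1 + \sum_(j < d) z.2 j, z.1) * multinomial (fun j => z.2 j))%N.
  rewrite multinomial_recl S ffunE unlift_none; congr (_ * multinomial _)%N.
  by apply/funext => j; rewrite ffunE liftK.
under eq_bigl do rewrite S.
under eq_bigr do rewrite M.
rewrite -(pair_big_dep xpredT (fun (i : 'I_N.+1) (k : {ffun 'I_d ->
  'I_N.+1}) => (i + \sum_(j < d) k j == n)%N)
  (fun (i : 'I_N.+1) (k : {ffun 'I_d -> 'I_N.+1}) =>
    (('C(i + \sum_(j < d) k j, i) * multinomial (fun j => k j)) ^ 2)%N)) /=.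
rewrite (big_ord_widen N.+1 (fun i =>
  'C(n, i) ^ 2 * mom d (n - i))%N)// [RHS]big_mkcond/=.
apply: eq_bigr => i _; rewrite ltnS; case: leqP => [le_in|lt_ni].
  rewrite -(IH (n - i)%N) ?(leq_trans (leq_subr _ _))// big_distrr/=.
  apply: eq_big => [k|k /eqP ->]; last by rewrite expnMn.
  by rewrite -[RHS](eqn_add2l i) subnKC.
rewrite big_pred0// => k; apply/negbTE.
by rewrite neq_ltn (leq_trans lt_ni) ?leq_addr ?orbT.
Qed.

End multinomial_sums.

(** * The constant gamma_d *)

Section gamma_constant.
Variable R : realType.
Variable d : nat.
Hypothesis d0 : (0 < d)%N.
Implicit Types x y : R.
Local Notation F := (@genfun R d).
Local Notation G N := (gensum d N (d%:R ^- 2 : R)).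

Let dR : 0 < d%:R :> R. Proof. by rewrite ltr0n. Qed.

Lemma gensum_ge0 N x : 0 <= x -> 0 <= gensum d N x.
Proof. by move=> x0; apply: sumr_ge0 => n _; rewrite mulr_ge0// exprn_ge0. Qed.

Lemma gammaE : gamma R d =
  (\sum_(0 <= n <oo) ((mom d n)%:R * (d%:R ^- 2) ^+ n)%:E)%E.
Proof.
rewrite /gamma; congr (limn _); apply/funext => N; apply: eq_bigr => n _.
congr (_%:E); rewrite -(@sum_sqr_multinomial d n n (leqnn n)) natr_sum
  big_distrl/=.
by apply: eq_bigr => k _; rewrite natrX -exprVn -exprVn exprM.
Qed.

Lemma gensum_le_gamma N : ((G N)%:E <= gamma R d)%E.
Proof.
rewrite gammaE; apply: le_trans (nneseries_lim_ge N _) => //.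
  by rewrite /gensum -sumEFin big_mkord.
Qed.

Lemma gamma_le (M : R) : (forall N, G N <= M) -> (gamma R d <= M%:E)%E.
Proof.
move=> h; rewrite gammaE; apply: lime_le.
  apply: is_cvg_nneseries => n _ _.
  by rewrite lee_fin mulr_ge0// exprn_ge0// invr_ge0 sqr_ge0.
apply: nearW => N; rewrite sumEFin lee_fin.
by have := h N; rewrite /gensum big_mkord.
Qed.

Lemma gensum1 : G 1 = 1.
Proof. by rewrite /gensum big_ord1 mom_0 mul1r expr0. Qed.

(** The condition on |b| in the extended reals, in terms of the partial sums
    of the series defining gamma_d. *)
Lemma gamma_condE (a m : R) : 0 < a ->
  (m%:E < (1 - (gamma R d)^-1) * a%:E)%E <-> exists N, 1 < G N * (1 - m / a).
Proof.
move=> a0; set b := m / a.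
have -> : m = b * a by rewrite /b mulfVK// gt_eqF.
have g1 : (1%:E <= gamma R d)%E by rewrite -gensum1; exact: gensum_le_gamma.
have GleP N := gensum_le_gamma N.
have G0 N : 0 <= G N by apply: gensum_ge0; rewrite invr_ge0 sqr_ge0.
have gle := gamma_le.
move: g1 GleP gle; case: (gamma R d) => [g| |] //= g1 GleP gle.
- rewrite lee_fin in g1; have g0 : 0 < g by exact: lt_le_trans g1.
  rewrite inver (gt_eqF g0) -EFinB -EFinM lte_fin ltr_pM2r//.
  split=> [bg|[N hN]].
  + apply: contrapT => /forallNP h.
    have b1 : 0 < 1 - b.
      by rewrite subr_gt0 (lt_le_trans bg)// gerBl invr_ge0 ltW.
    have : (g%:E <= ((1 - b)^-1)%:E)%E.
      apply: gle => N; have /negP := h N.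
      by rewrite -leNgt -ler_pdivlMr// div1r.
    rewrite lee_fin leNgt => /negP; apply.
    rewrite -[ltRHS]invrK ltf_pV2 ?posrE ?invr_gt0//.
    by rewrite ltrBrDl addrC -ltrBrDl.
  + have GN : G N <= g by rewrite -lee_fin.
    have b1 : 0 < 1 - b.
      rewrite ltNge; apply/negP => b1.
      by have := lt_le_trans hN (mulr_ge0_le0 (G0 N) b1); rewrite ltNge ler01.
    have : 1 < g * (1 - b) by rewrite (lt_le_trans hN)// ler_pM2r.
    move=> H.
    have : g^-1 < 1 - b by rewrite -[g^-1]mulr1 ltr_pdivrMl.
    lra.
- rewrite -EFinD oppr0 addr0 -EFinM mul1r lte_fin gtr_pMl//.
  split=> [b1|[N hN]].
  + apply: contrapT => /forallNP h.
    have b1' : 0 < 1 - b by rewrite subr_gt0.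
    have : (+oo <= ((1 - b)^-1)%:E)%E.
      apply: gle => N; have /negP := h N.
      by rewrite -leNgt -ler_pdivlMr// div1r.
    by [].
  + rewrite -subr_gt0 ltNge; apply/negP => b1.
    by have := lt_le_trans hN (mulr_ge0_le0 (G0 N) b1); rewrite ltNge ler01.
Qed.

Lemma genfun_le_bound x M : 0 <= x -> d%:R ^+ 2 * x < 1 ->
  (forall N, gensum d N x <= M) -> F x <= M.
Proof.
move=> x0 x1 h; rewrite -subr_le0.
(* the positive part of F x - M is below every error term *)
pose z := Num.max (F x - M) 0.
suff z0 : z = 0 by rewrite -z0 /z le_max lexx.
have r0 : 0 <= d%:R ^+ 2 * x < 1 by rewrite mulr_ge0 ?sqr_ge0.
have K0 : 0 <= (1 - d%:R ^+ 2 * x)^-1 by rewrite invr_ge0 subr_ge0 ltW.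
apply: (le_geometric_eq0 (K := (1 - d%:R ^+ 2 * x)^-1) r0) => N.
rewrite ger0_norm ?le_max ?lexx ?orbT// /z ge_max; apply/andP;
  split; last first.
  by rewrite mulr_ge0// exprn_ge0//; case/andP: r0.
have := genfun_truncation x0 x1 N; apply: le_trans.
by rewrite (le_trans _ (ler_norm _))// lerB.
Qed.

Lemma gensum_le_genfun N x : 0 <= x -> d%:R ^+ 2 * x < 1 -> gensum d N x <= F x.
Proof.
move=> x0 x1.
have bZ : bmf (fun t => x * @sqr_sum R d t).
  by apply: bmfM; [exact: bmf_cst|exact: bmf_sqr_sum].
rewrite gensumE; apply: mean_le.
- by apply: bmf_sum => i; exact: bmfX.
- exact: bmf_genfun_den.
- move=> t; have h := genfun_den_gt0 x0 x1 t.
  rewrite (geometric_truncation N);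
    last by rewrite -subr_eq0 -oppr_eq0 opprB gt_eqF.
  rewrite lerDl divr_ge0 ?(ltW h)// exprn_ge0//.
  by case/andP: (xsqr_sum_le x0 t).
Qed.

Lemma gensum_le_gensum1 N x : 0 <= x -> d%:R ^+ 2 * x <= 1 ->
  gensum d N x <= G N.
Proof.
move=> x0 x1; apply: ler_sum => n _; rewrite ler_wpM2l// lerXn2r ?nnegrE//.
by rewrite -[leRHS]mul1r ler_pdivlMr ?exprn_gt0// mulrC.
Qed.

(** Partial sums slightly inside the disc of convergence almost reach those on
    its boundary. *)
Lemma gensum_scale N (s : R) : 0 <= s <= 1 ->
  s ^+ N * G N <= gensum d N (s * d%:R ^- 2).
Proof.
move=> /andP[s0 s1]; rewrite /gensum big_distrr/=; apply: ler_sum => n _.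
rewrite mulrCA ler_wpM2l// exprMn ler_wpM2r//.
by rewrite ler_wiXn2l// ltnW.
Qed.

Lemma genfun_gt1 x : 0 < x -> d%:R ^+ 2 * x < 1 -> 1 < F x.
Proof.
move=> x0 x1; have x1' : d%:R * x < 1.
  rewrite (le_lt_trans _ x1)// ler_pM2r// -[leLHS]mulr1 expr2 ler_pM2l//.
  by rewrite ler1n.
apply: lt_le_trans (genfun_lower (ltW x0) x1 x1').
rewrite invf_gt1 ?subr_gt0// gtrBl mulr_gt0//.
Qed.

(** The forward direction: r stands for |p_1/p_0| and b for |b|/a. *)
Lemma ratio_lt_gamma (r b : R) : 0 < r -> d%:R * r < 1 ->
  d%:R * r * b = 1 - (F (r ^+ 2))^-1 -> exists N, 1 < G N * (1 - b).
Proof.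
move=> r0 r1 hb.
have dr0 : 0 < d%:R * r by rewrite mulr_gt0.
(* any y with r / d < y < 1 / d^2 works: then r^2 / (d r y) < 1 *)
pose y := (r / d%:R + d%:R ^- 2) / 2.
have h1 : r / d%:R < d%:R ^- 2.
  by rewrite -exprVn expr2 ltr_pM2r ?invr_gt0// -[ltRHS]mul1r
    ltr_pdivlMr// mulrC.
have hy1 : r / d%:R < y by rewrite /y; lra.
have hy2 : y < d%:R ^- 2 by rewrite /y; lra.
clearbody y.
have y0 : 0 < y by apply: lt_trans hy1; rewrite divr_gt0.
have y1 : d%:R ^+ 2 * y < 1.
  by rewrite mulrC -ltr_pdivlMr ?exprn_gt0// div1r.
have xy : r ^+ 2 <= y.
  rewrite (le_trans _ (ltW hy1))// expr2 ler_pM2l//.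
  by rewrite -[leRHS]mul1r ler_pdivlMr// mulrC ltW.
have x0 : 0 < r ^+ 2 by rewrite exprn_gt0.
have := genfun_ratio_le x0 xy y1; rewrite -hb => le.
have Fy := genfun_gt1 y0 y1.
have Fy0 : 0 < F y by rewrite (lt_trans ltr01).
have Hy : 0 < 1 - (F y)^-1 by rewrite subr_gt0 invf_lt1.
have bH : b < 1 - (F y)^-1.
  rewrite -(@ltr_pM2l _ (d%:R * r * y)) ?mulr_gt0//.
  apply: (@le_lt_trans _ _ (r ^+ 2 * (1 - (F y)^-1))).
    by apply: le_trans le; rewrite [leLHS]mulrAC mulrC.
  rewrite ltr_pM2r// expr2 mulrAC ltr_pM2r//.
  by move: hy1; rewrite ltr_pdivrMr// mulrC.
have b1 : 0 < 1 - b.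
  by rewrite subr_gt0 (lt_trans bH)// gtrBl invr_gt0.
apply: contrapT => /forallNP h.
suff : F y <= (1 - b)^-1.
  apply/negP; rewrite -ltNge -[ltRHS]invrK ltf_pV2 ?posrE ?invr_gt0//.
  by rewrite ltrBrDl addrC -ltrBrDl.
apply: (genfun_le_bound (ltW y0) y1) => N.
rewrite (le_trans (gensum_le_gensum1 N (ltW y0) (ltW y1)))//.
by have /negP := h N; rewrite -leNgt -ler_pdivlMr// div1r.
Qed.

End gamma_constant.

(** A function that is Lipschitz with respect to a continuous one is continuous. *)
Lemma within_continuous_dominated (R : realType) (A : set R) (h g : R ->
  R) (K : R) :
  0 < K -> continuous g ->
  (forall x y, A x -> A y -> `|h x - h y| <= K * `|g x - g y|) ->
  {within A, continuous h}.
Proof.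
move=> K0 cg H; apply/subspace_continuousP => x Ax.
apply/cvgrPdist_le => e e0.
have cgx : \forall y \near within A (nbhs x), `|g x - g y| <= e / K.
  apply: cvg_within; have /cvgrPdist_le := cg x; apply.
  by rewrite divr_gt0.
have Ay : \forall y \near within A (nbhs x), A y by exact: withinT.
near=> y; rewrite (le_trans (H x y Ax _))//; first by near: y.
rewrite mulrC -ler_pdivlMr//; near: y; exact: cgx.
Unshelve. all: by end_near. Qed.

Lemma bernoulli_onem (R : realType) (e : R) M : 0 <= e <= 1 ->
  1 - M%:R * e <= (1 - e) ^+ M.
Proof.
move=> /andP[e0 e1]; elim: M => [|M IH]; first by rewrite mul0r subr0 expr0.
rewrite exprS; apply: (@le_trans _ _ ((1 - e) * (1 - M%:R * e))).
  rewrite -natr1; have : 0 <= M%:R * e * e by rewrite !mulr_ge0.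
  by move=> h; lra.
by rewrite ler_wpM2l// subr_ge0.
Qed.

(** Powers of a number close enough to 1 are close to 1. *)
Lemma expr_near1 (R : realType) (A : R) M : 1 < A ->
  exists s, 1 / 2 <= s < 1 /\ 1 <= s ^+ M * A.
Proof.
move=> A1; have A0 : 0 < A by lra.
have Ai : A^-1 < 1 by rewrite invf_lt1.
have Ai0 : 0 < A^-1 by rewrite invr_gt0.
have M0 : (0 : R) < M%:R + 1 by rewrite ltr_wpDl.
pose e : R := (1 - A^-1) / (2 * (M%:R + 1)).
have e0 : 0 < e by rewrite divr_gt0 ?subr_gt0// mulr_gt0.
have eM : (M%:R + 1) * e = (1 - A^-1) / 2 by rewrite /e; field; rewrite !gt_eqF.
clearbody e.
have e12 : e <= 1 / 2.
  have : 0 <= M%:R * e by rewrite mulr_ge0// ltW.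
  lra.
exists (1 - e); split; first by lra.
rewrite -ler_pdivrMr// div1r; have e01 : 0 <= e <= 1 by lra.
apply: le_trans (bernoulli_onem M e01); lra.
Qed.

(** * Existence of the ratio of the coefficients *)

Section existence_of_ratio.
Variable R : realType.
Variable d : nat.
Hypothesis d0 : (0 < d)%N.
Local Notation F := (@genfun R d).
Local Notation G N := (gensum d N (d%:R ^- 2 : R)).

Let dR : 0 < d%:R :> R. Proof. by rewrite ltr0n. Qed.

Lemma genfun_lipschitz X x y : 0 <= x <= X -> 0 <= y <= X ->
  d%:R ^+ 2 * X < 1 ->
  `|F x - F y| <= (d%:R / (1 - d%:R ^+ 2 * X)) ^+ 2 * `|x - y|.
Proof.
move=> /andP[x0 xX] /andP[y0 yX] X1.
have X0 : 0 <= X by exact: le_trans xX.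
have x1 : d%:R ^+ 2 * x < 1 by rewrite (le_lt_trans _ X1)// ler_wpM2l ?sqr_ge0.
have y1 : d%:R ^+ 2 * y < 1 by rewrite (le_lt_trans _ X1)// ler_wpM2l ?sqr_ge0.
have bx := bmf_genfun_den x0 x1; have by_ := bmf_genfun_den y0 y1.
rewrite /genfun -meanB//; apply: mean_norm_le; first exact: bmfB.
move=> t; have vx := genfun_den_gt0 x0 x1 t; have vy := genfun_den_gt0 y0 y1 t.
have gx := genfun_den_ge x0 t; have gy := genfun_den_ge y0 t.
have hX : 0 < 1 - d%:R ^+ 2 * X by rewrite subr_gt0.
have -> : (1 - x * sqr_sum t)^-1 - (1 - y * sqr_sum t)^-1 =
    (x - y) * (sqr_sum t / ((1 - x * sqr_sum t) * (1 - y * sqr_sum t))).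
  by field; rewrite !gt_eqF.
rewrite normrM mulrC ler_wpM2r// ger0_norm; last first.
  by rewrite divr_ge0 ?sqr_sum_ge0// mulr_ge0// ltW.
rewrite expr_div_n ler_pM ?sqr_sum_ge0 ?sqr_sum_le ?invr_ge0 ?mulr_ge0 ?(ltW
  vx) ?(ltW vy)//.
rewrite lef_pV2 ?posrE ?mulr_gt0 ?exprn_gt0// expr2.
have l z : z <= X -> 1 - d%:R ^+ 2 * X <= 1 - d%:R ^+ 2 * z.
  by move=> zX; rewrite lerB// ler_wpM2l ?sqr_ge0.
rewrite ler_pM ?(ltW hX)//;
  [exact: le_trans (l _ xX) gx|exact: le_trans (l _ yX) gy].
Qed.

(** The equation d r b = 1 - 1/F(r^2), written F(r^2) (1 - d r b) = 1 and solved by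
    the intermediate value theorem: the left-hand side is at most 1 at r = b/(2d)
    and at least 1 near r = 1/d. *)
Lemma exists_ratio (b : R) : 0 < b -> (exists N, 1 < G N * (1 - b)) ->
  exists r : R, [/\ 0 < r, d%:R * r < 1 & d%:R * r * b = 1 - (F (r ^+ 2))^-1].
Proof.
move=> b0 [N hN].
have G0 : 0 <= G N by apply: gensum_ge0; rewrite invr_ge0 sqr_ge0.
have b1 : b < 1.
  rewrite -subr_gt0 ltNge; apply/negP => b1.
  by have := lt_le_trans hN (mulr_ge0_le0 G0 b1); rewrite ltNge ler01.
have [s [/andP[s12 s1] hs]] := expr_near1 (2 * N) hN.
have s0 : 0 < s by lra.
pose r0 : R := b / 2 / d%:R; pose r1 : R := s / d%:R.
have dr0 : d%:R * r0 = b / 2 by rewrite /r0 mulrC mulfVK ?gt_eqF.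
have dr1 : d%:R * r1 = s by rewrite /r1 mulrC mulfVK ?gt_eqF.
have r0_gt0 : 0 < r0 by rewrite !divr_gt0.
have r01 : r0 <= r1 by rewrite ler_pM2r ?invr_gt0//; lra.
clearbody r0.
have inside r : 0 <= r -> r <= r1 -> d%:R ^+ 2 * r ^+ 2 < 1.
  move=> r_ge0 rr; rewrite -exprMn expr_lt1 ?mulr_ge0 ?(ltW dR)//.
  by rewrite (le_lt_trans _ s1)// -dr1 ler_pM2l.
have r1_ge0 : 0 <= r1 by apply: le_trans r01; exact: ltW.
pose f r := F (r ^+ 2) * (1 - d%:R * r * b).
have cf : {within `[r0, r1], continuous f}.
  have cF : {within `[r0, r1], continuous (fun r => F (r ^+ 2))}.
    pose K := (d%:R / (1 - d%:R ^+ 2 * r1 ^+ 2)) ^+ 2 : R.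
    apply: (@within_continuous_dominated _ _ _ (fun r => r ^+ 2) K).
    - by rewrite exprn_gt0// divr_gt0// subr_gt0 inside.
    - exact: exprn_continuous.
    - move=> x y /=; rewrite !in_itv/= => /andP[x0 x1] /andP[y0 y1].
      have x_ge0 : 0 <= x by apply: le_trans x0; exact: ltW.
      have y_ge0 : 0 <= y by apply: le_trans y0; exact: ltW.
      apply: genfun_lipschitz; last exact: inside.
        by rewrite sqr_ge0/= lerXn2r ?nnegrE.
      by rewrite sqr_ge0/= lerXn2r ?nnegrE.
  have cL : {within `[r0, r1], continuous (fun r => 1 - d%:R * r * b)}.
    apply: continuous_subspaceT => x; apply: cvgB; first exact: cvg_cst.
    by apply: cvgMl; apply: cvgMr; exact: cvg_id.
  by move=> x; apply: cvgM; [exact: cF|exact: cL].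
have f0 : f r0 <= 1.
  have h := inside r0 (ltW r0_gt0) r01.
  rewrite /f dr0; have := genfun_upper (sqr_ge0 r0) h => hF.
  have E : d%:R ^+ 2 * r0 ^+ 2 = b ^+ 2 / 4 by rewrite -exprMn dr0; field.
  rewrite E in hF h.
  have q0 : 0 < 1 - b ^+ 2 / 4 by rewrite subr_gt0.
  have hF2 : F (r0 ^+ 2) <= (1 - b ^+ 2 / 4)^-1.
    apply: le_trans hF _.
    rewrite [leRHS](_ : _ = 1 + (b ^+ 2 / 4) / (1 - b ^+ 2 / 4)); last first.
      by field; rewrite gt_eqF//; lra.
    rewrite lerD2l mulrA ler_pM2r ?invr_gt0// -E mulrC ler_wpM2r ?sqr_ge0//.
    by rewrite expr2 ler_peMl// ?ler1n// ltW.
  have p0 : 0 <= 1 - b / 2 * b by nra.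
  apply: le_trans (ler_wpM2r p0 hF2) _.
  by rewrite mulrC ler_pdivrMr// mul1r; nra.
have f1 : 1 <= f r1.
  rewrite /f dr1; have h := inside r1 r1_ge0 (lexx _).
  have hG := gensum_le_genfun N (sqr_ge0 r1) h.
  have s2 : 0 <= s ^+ 2 <= 1 by rewrite sqr_ge0 expr_le1// ltW.
  have := gensum_scale d N s2.
  rewrite (_ : s ^+ 2 * d%:R ^- 2 = r1 ^+ 2); last by rewrite /r1 expr_div_n.
  rewrite -exprM => hS.
  apply: le_trans hs _; rewrite mulrA;
    apply: (@le_trans _ _ (F (r1 ^+ 2) * (1 - b))).
    by rewrite ler_pM2r ?subr_gt0// (le_trans hS).
  rewrite ler_wpM2l ?(le_trans ler01) ?genfun_ge1 ?sqr_ge0//.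
  by rewrite lerB// ler_piMl// ltW.
have [|r /=] := IVT (v := 1) r01 cf.
  by rewrite ge_min f0 le_max f1 orbT.
rewrite in_itv/= => /andP[rr0 rr1] fr.
have r_gt0 : 0 < r by exact: lt_le_trans rr0.
have h := inside r (ltW r_gt0) rr1.
exists r; split=> //; first by rewrite (le_lt_trans _ s1)// -dr1 ler_pM2l.
have Fr : 0 < F (r ^+ 2) by rewrite (lt_le_trans ltr01)// genfun_ge1// sqr_ge0.
move: fr; rewrite /f => /(congr1 (fun z => (F (r ^+ 2))^-1 * z)).
rewrite mulKf ?gt_eqF// mulr1 => <-; lra.
Qed.

End existence_of_ratio.

(** * Integrating out two variables *)

Section two_variables.
Variable R : realType.
Local Notation C := R[i].
Local Notation T := (measurableTypeR R).

Lemma sqr_modulusB (x y : C) : modulus (x - y) ^+ 2 =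
  modulus x ^+ 2 + modulus y ^+ 2 - 2 * complex.Re (x * y^*%C).
Proof. by rewrite !sqr_modulus; case: x y => [x1 x2] [y1 y2] /=; ring. Qed.

Lemma cbmf_poisson (u : C) : modulus u < 1 ->
  cbmf (fun y : T => ((modulus (1 - u * expi y) ^+ 2)^-1)%:C).
Proof.
move=> u1.
have -> : (fun y : T => ((modulus (1 - u * expi y) ^+ 2)^-1)%:C) =
    (fun y => (1 - u * expi y)^-1 * ((1 - u * expi y)^-1)^*%C).
  by apply/funext => t; rewrite mulr_conj modulusV exprVn.
suff h : cbmf (fun y : T => (1 - u * expi y)^-1) by apply: cbmfM => //;
  exact: cbmf_conj.
apply: (cbmf_inv (m := 1 - modulus u)); first by rewrite subr_gt0.
  move=> y; rewrite (le_trans _ (modulusB_ge _ _))// modulus1 lerB//.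
  by rewrite modulusM modulus_expi mulr1.
apply: cbmfB; first exact: cbmf_cst.
by apply: cbmfM; [exact: cbmf_cst|exact: cbmf_expi].
Qed.

(** The mean of the Poisson kernel: this is the case d = 1 of
    [cmean_inv_sqr_affine], where |S| = 1. *)
Lemma cmean1_poisson (u : C) : modulus u < 1 ->
  cmean1 (fun y : T => ((modulus (1 - u * expi y) ^+ 2)^-1)%:C) =
  ((1 - modulus u ^+ 2)^-1)%:C.
Proof.
move=> u1; have hu : 1%:R * modulus u < 1 by rewrite mul1r.
have x0 : 0 <= modulus u ^+ 2 by exact: sqr_ge0.
have S1 (y : T) (t : 0.-tuple T) : expi_sum (tuple_cons (y, t)) = expi y.
  by rewrite expi_sum_cons expi_sum0 addr0.
have S1' (t : 1.-tuple T) : expi_sum t = expi (tnth t ord0) by exact: big_ord1.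
have b := cbmf_inv_sqr_modulus (p0 := 1) (p1 := - u) (d := 1).
rewrite modulus1 modulusN divr1 opprK in b.
have b1 := b hu.
have := cmean_inv_sqr_affine hu; rewrite cmeanS// => h.
transitivity (genfun 1 (modulus u ^+ 2))%:C.
  rewrite -h; apply: eq_cavg => y; rewrite cmean0; last first.
    by have := cbmf_slice y (cbmf_tuple_cons b1); exact.
  by rewrite S1.
congr (_%:C); rewrite -[RHS](mean_cst 1).
apply: eq_avg => t; congr ((1 - _)^-1).
by rewrite /sqr_sum S1' modulus_expi expr1n mulr1.
Qed.

Lemma cmean1_poisson_hom (w u : C) : modulus u < modulus w ->
  cmean1 (fun y : T => ((modulus (w - u * expi y) ^+ 2)^-1)%:C) =
  ((modulus w ^+ 2 - modulus u ^+ 2)^-1)%:C.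
Proof.
move=> uw; have w0 : 0 < modulus w by rewrite (le_lt_trans _ uw)// modulus_ge0.
have wn0 : w != 0 by apply/eqP => h; rewrite h modulus0 ltxx in w0.
have u1 : modulus (u / w) < 1 by rewrite modulusM modulusV ltr_pdivrMr// mul1r.
have b := cbmf_poisson u1.
have -> : (fun y : T => ((modulus (w - u * expi y) ^+ 2)^-1)%:C) =
  (fun y => ((modulus w ^+ 2)^-1)%:C * ((modulus (1 - u / w * expi y)
    ^+ 2)^-1)%:C).
  apply/funext => y; rewrite -real_complexM -invfM -exprMn -modulusM.
  by rewrite mulrBr mulr1 mulrA [w * (u / w)]mulrCA mulfV// mulr1.
rewrite cmean1Z// cmean1_poisson// -real_complexM modulusM modulusV -invfM.
by rewrite expr_div_n mulrBr mulr1 mulrCA mulfV ?mulr1// gt_eqF// exprn_gt0.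
Qed.

(** Integrating out one more variable, with |v| > 2 rho. *)
Lemma cmean1_inv_quadratic (v : C) (rho : R) : 0 <= rho ->
  2 * rho < modulus v ->
  cmean1 (fun x : T =>
    ((modulus (v - rho%:C * expi x) ^+ 2 - rho ^+ 2)^-1)%:C) =
  ((Num.sqrt (modulus v ^+ 2 * (modulus v ^+ 2 - 4 * rho ^+ 2)))^-1)%:C.
Proof.
move=> rho0 hv; have v0 : 0 < modulus v by lra.
have v2 : 0 < modulus v ^+ 2 by rewrite exprn_gt0.
have v4 : 0 < modulus v ^+ 2 - 4 * rho ^+ 2.
  rewrite (_ : _ - _ = (modulus v - 2 * rho) * (modulus v + 2 * rho));
    last by ring.
  by rewrite mulr_gt0; lra.
set D := Num.sqrt _.
have D0 : 0 < D by rewrite sqrtr_gt0 mulr_gt0.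
have DD : D ^+ 2 = modulus v ^+ 2 * (modulus v ^+ 2 - 4 * rho ^+ 2).
  by rewrite sqr_sqrtr// mulr_ge0// ltW.
(* the quadratic is c |1 - u e^(i x)|^2, where c (1 + |u|^2) = |v|^2 and c u = rho conj(v) *)
pose c := (modulus v ^+ 2 + D) / 2.
have c0 : 0 < c by rewrite /c; lra.
have cc : c ^+ 2 + rho ^+ 2 * modulus v ^+ 2 = c * modulus v ^+ 2.
  by rewrite /c; move: DD; set V := modulus v ^+ 2 => DD; lra.
pose u : C := (rho / c)%:C * v^*%C; have uE : u = (rho / c)%:C * v^*%C by [].
clearbody u.
have mu2 : modulus u ^+ 2 = rho ^+ 2 * modulus v ^+ 2 / c ^+ 2.
  rewrite uE modulusM modulus_real modulus_conj exprMn real_normK ?num_real//.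
  by field; rewrite gt_eqF.
have cu : c * (1 - modulus u ^+ 2) = D.
  rewrite mu2.
  have -> : rho ^+ 2 * modulus v ^+ 2 =
    c * modulus v ^+ 2 - c ^+ 2 by rewrite -cc; ring.
  by rewrite /c; field; rewrite gt_eqF//; lra.
have u1 : modulus u < 1.
  rewrite -(@ltr_pXn2r _ 2)// ?nnegrE ?modulus_ge0// expr1n -subr_gt0.
  by rewrite -(pmulr_rgt0 _ c0) cu.
have b := cbmf_poisson u1.
rewrite (_ : (fun _ => _) = (fun y : T =>
  (c^-1)%:C * ((modulus (1 - u * expi y) ^+ 2)^-1)%:C)).
  by rewrite cmean1Z// cmean1_poisson// -real_complexM -invfM cu.
apply/funext => y; rewrite -real_complexM -invfM; congr ((_^-1)%:C).
rewrite !sqr_modulusB modulus1 !modulusM modulus_expi modulus_real mulr1 expr1n.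
rewrite real_normK ?num_real// mul1r.
have -> : complex.Re (v * (rho%:C * expi y)^*%C) =
    c * complex.Re ((u * expi y)^*%C).
  rewrite uE; have : c != 0 by rewrite gt_eqF.
  by case: (v) => v1 v2' /= cn; field.
rewrite (_ : modulus v ^+ 2 = c + c * modulus u ^+ 2); first by ring.
rewrite mu2.
have -> : rho ^+ 2 * modulus v ^+ 2 =
  c * modulus v ^+ 2 - c ^+ 2 by rewrite -cc; ring.
by field; rewrite gt_eqF.
Qed.

End two_variables.

(** * The integral of 1 / sqrt g *)

Section square_root_integral.
Variable R : realType.
Local Notation C := R[i].
Local Notation T := (measurableTypeR R).
Variable n : nat.
Implicit Types (rho : R) (t : n.-tuple T).

(** The function g of the integral equation, with [rho] for |b| / (a + (d - 1) c)
    and [n] for d - 2. *)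
Definition gpoly rho t : R :=
  modulus (1 - rho%:C * expi_sum t) ^+ 2 *
  (modulus (1 - rho%:C * expi_sum t) ^+ 2 - 4 * rho ^+ 2).

Lemma Re_expi_sum t : complex.Re (expi_sum t) = \sum_(j < n) cos (tnth t j).
Proof.
rewrite /expi_sum; elim/big_rec2 : _ => // j x y _ <-.
by rewrite ReD.
Qed.

Lemma Im_expi_sum t : complex.Im (expi_sum t) = \sum_(j < n) sin (tnth t j).
Proof.
rewrite /expi_sum; elim/big_rec2 : _ => // j x y _ <-.
by rewrite ImD.
Qed.

Lemma sqr_modulus_expi_sum t : modulus (expi_sum t) ^+ 2 =
  \sum_(j < n) \sum_(k < n) cos (tnth t j - tnth t k).
Proof.
rewrite sqr_modulus Re_expi_sum Im_expi_sum !expr2 !big_distrl/= -big_split/=.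
apply: eq_bigr => j _; rewrite !big_distrr/= -big_split/=.
by apply: eq_bigr => k _; rewrite cosB.
Qed.

Lemma sqr_modulus_affine rho t : modulus (1 - rho%:C * expi_sum t) ^+ 2 =
  1 - 2 * rho * (\sum_(j < n) cos (tnth t j)) +
  rho ^+ 2 * (\sum_(j < n) \sum_(k < n) cos (tnth t j - tnth t k)).
Proof.
rewrite sqr_modulusB modulus1 modulusM modulus_real exprMn real_normK
  ?num_real//.
rewrite -sqr_modulus_expi_sum -Re_expi_sum.
by case: (expi_sum t) => x y /=; ring.
Qed.

Lemma modulus_affine_real_ge rho t : 0 <= rho ->
  1 - n%:R * rho <= modulus (1 - rho%:C * expi_sum t).
Proof.
move=> rho0; rewrite (le_trans _ (modulusB_ge _ _))// modulus1 lerB//.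
by rewrite modulusM modulus_real ger0_norm// mulrC ler_wpM2r ?modulus_expi_sum.
Qed.

Lemma bmf_sqr_modulus_affine rho :
  bmf (fun t => modulus (1 - rho%:C * expi_sum t) ^+ 2).
Proof.
apply: bmf_sqr_modulus; apply: cbmfB; first exact: cbmf_cst.
by apply: cbmfM; [exact: cbmf_cst|exact: cbmf_expi_sum].
Qed.

Lemma bmf_gpoly rho : bmf (gpoly rho).
Proof.
apply: bmfM; first exact: bmf_sqr_modulus_affine.
by apply: bmfB; [exact: bmf_sqr_modulus_affine|exact: bmf_cst].
Qed.

Section inside.
Variable rho : R.
Hypotheses (rho0 : 0 <= rho) (rho1 : n.+2%:R * rho < 1).

Let k := 1 - n%:R * rho.
Let krho : 2 * rho < k.
Proof.
by move: rho1; rewrite /k -addn2 natrD mulrDl; lra.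
Qed.

Let k0 : 0 < k.
Proof. by rewrite (le_lt_trans _ krho)// mulr_ge0. Qed.

Lemma gpoly_ge t : k ^+ 2 * (k ^+ 2 - 4 * rho ^+ 2) <= gpoly rho t.
Proof.
have h := modulus_affine_real_ge t rho0; rewrite -/k in h.
have h2 : k ^+ 2 <= modulus (1 - rho%:C * expi_sum t) ^+ 2.
  by rewrite ler_pXn2r// nnegrE ?modulus_ge0 ?(ltW k0).
have h4 : 4 * rho ^+ 2 <= k ^+ 2.
  by rewrite (_ : 4 * rho ^+ 2 = (2 * rho) ^+ 2);
    [rewrite lerXn2r ?nnegrE ?mulr_ge0 ?(ltW k0) ?(ltW krho)|ring].
by rewrite /gpoly ler_pM ?sqr_ge0 ?subr_ge0// lerB.
Qed.

Lemma gpoly_lb_gt0 : 0 < k ^+ 2 * (k ^+ 2 - 4 * rho ^+ 2).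
Proof.
rewrite mulr_gt0 ?exprn_gt0//.
rewrite (_ : _ - _ = (k - 2 * rho) * (k + 2 * rho)); last by ring.
by rewrite mulr_gt0 ?subr_gt0// ltr_pwDl// mulr_ge0.
Qed.

Lemma gpoly_gt0 t : 0 < gpoly rho t.
Proof. exact: lt_le_trans gpoly_lb_gt0 (gpoly_ge t). Qed.

Lemma bmf_inv_sqrt_gpoly : bmf (fun t => (Num.sqrt (gpoly rho t))^-1).
Proof.
apply: (bmf_inv (m := Num.sqrt (k ^+ 2 * (k ^+ 2 - 4 * rho ^+ 2)))).
- by rewrite sqrtr_gt0 gpoly_lb_gt0.
- by move=> t; rewrite ler_wsqrtr// gpoly_ge.
- by apply: bmf_sqrt; exact: bmf_gpoly.
Qed.

(** Integrating out two of the n + 2 variables of |1 - rho S|^(-2) with the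
    Poisson kernel leaves the integral of 1 / sqrt g. *)
Lemma mean_inv_sqrt_gpoly :
  mean (fun t => (Num.sqrt (gpoly rho t))^-1) = genfun n.+2 (rho ^+ 2).
Proof.
apply: (@complexI R).
have mq : modulus rho%:C = rho by rewrite modulus_real ger0_norm.
have hq : n.+2%:R * modulus rho%:C < 1 by rewrite mq.
rewrite -cmean_real -[in RHS]mq -(cmean_inv_sqr_affine hq).
pose w (s : C) : C := ((modulus (1 - rho%:C * s) ^+ 2)^-1)%:C.
have hw d (X : measurableType d) (f : X -> C) : cbmf f ->
    (forall x, modulus (f x) <= n.+2%:R) -> cbmf (fun x => w (f x)).
  move=> bf fn; have :=
    @stable_cbmf_w _ _ _ hq d X (fun=> 1) f (cbmf_cst _ _) bf fn.
  by under eq_fun do rewrite conjc1 mulr1.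
have bS m : (m <= n.+2)%N -> cbmf (fun t : m.-tuple T => w (expi_sum t)).
  move=> mn; apply: hw => [|t]; first exact: cbmf_expi_sum.
  by rewrite (le_trans (modulus_expi_sum _))// ler_nat.
pose f (z : (T * T) * n.-tuple T) :=
  w (expi z.1.1 + (expi z.1.2 + expi_sum z.2)).
have bz1 : cbmf (fun z : (T * T) * n.-tuple T => expi z.1.1).
  by apply: cbmf_expi; exact: measurableT_comp.
have bz2 : cbmf (fun z : (T * T) * n.-tuple T => expi z.1.2).
  by apply: cbmf_expi; exact: measurableT_comp.
have bz3 : cbmf (fun z : (T * T) * n.-tuple T => expi_sum z.2).
  exact: (cbmf_comp measurable_snd (@cbmf_expi_sum _ _)).
have bf : cbmf f.
  apply: hw; first by apply: cbmfD => //; exact: cbmfD.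
  move=> [[x y] t] /=; rewrite (le_trans (modulusD_le _ _))// modulus_expi.
  rewrite -[n.+2]add1n natrD lerD2l.
  rewrite (le_trans (modulusD_le _ _))// modulus_expi.
  by rewrite -[n.+1]add1n natrD lerD2l modulus_expi_sum.
have shuffle d (X : measurableType d) (h : X -> (T * T) * n.-tuple T) :
    measurable_fun setT h -> cbmf (f \o h).
  by move=> mh; exact: cbmf_comp.
rewrite [RHS]cmeanS; last exact: bS.
transitivity (cmean1 (fun x => cmean1 (fun y => cmean (fun t =>
  f ((x, y), t))))); last first.
  apply: eq_cavg => x; rewrite cmeanS; last first.
    by have := cbmf_slice x (cbmf_tuple_cons (bS n.+2 (leqnn _))); exact.
  by apply: eq_cavg => y; apply: eq_cavg => t; rewrite /f /w /= !expi_sum_cons.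
transitivity (cmean1 (fun x => cmean (fun t => cmean1 (fun y =>
  f ((x, y), t))))); last first.
  apply: eq_cavg => x; apply/esym.
  apply: (cmean_swap (f := fun z : T * n.-tuple T => f ((x, z.1), z.2))).
  apply: (shuffle _ _ (fun z : T * n.-tuple T => ((x, z.1), z.2))).
  by do 2 apply: measurable_fun_pair => //.
have bg : cbmf (fun z : T * n.-tuple T => cmean1 (fun y => f ((z.1, y), z.2))).
  apply: (cbmf_cmean1 (f := fun z : (T * n.-tuple T) * T =>
    f ((z.1.1, z.2), z.1.2))).
  apply: (shuffle _ _ (fun z : (T * n.-tuple T) * T => ((z.1.1, z.2), z.1.2))).
  apply: measurable_fun_pair; last exact: measurableT_comp.
  by apply: measurable_fun_pair => //; exact: measurableT_comp.
rewrite (cmean_swap bg); apply: eq_cavg => t.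
have vk := modulus_affine_real_ge t rho0; rewrite -/k in vk.
rewrite -cmean1_inv_quadratic//; last exact: lt_le_trans vk.
apply: eq_cavg => x.
set v := 1 - rho%:C * expi_sum t in vk *.
have vx : modulus rho%:C < modulus (v - rho%:C * expi x).
  rewrite mq (lt_le_trans _ (modulusB_ge _ _))// modulusM modulus_expi mulr1 mq.
  by have := lt_le_trans krho vk; rewrite mulr_natl mulr2n ltrBrDr.
have := cmean1_poisson_hom vx; rewrite mq => <-.
apply: eq_cavg => y; rewrite /f /w /=; congr ((_ ^- 2)%:C); congr modulus.
by rewrite /v; ring.
Qed.

End inside.

(** Replacing rho by s rho with 0 <= s <= 1 decreases g by at most the factor s^4,
    because 1 - s rho S = (1 - s) + s (1 - rho S) and Re (1 - rho S) >= 0. *)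
Lemma gpoly_scale (rho s : R) t : 0 <= rho -> n.+2%:R * rho <= 1 ->
  0 <= s <= 1 ->
  s ^+ 4 * gpoly rho t <= gpoly (s * rho) t /\ 0 <= gpoly rho t.
Proof.
move=> rho0 rho1 /andP[s0 s1].
have vk := modulus_affine_real_ge t rho0.
have k2 : 2 * rho <= 1 - n%:R * rho.
  by move: rho1; rewrite -addn2 natrD mulrDl; lra.
rewrite /gpoly; set v := 1 - rho%:C * expi_sum t in vk *.
have Rv : 0 <= complex.Re v.
  have := normr_Re_le (expi_sum t); have := modulus_expi_sum t.
  have -> : complex.Re v = 1 - rho * complex.Re (expi_sum t).
    by rewrite /v; case: (expi_sum t) => x y /=; ring.
  move=> h1 h2; have : complex.Re (expi_sum t) <= n%:R.
    by rewrite (le_trans (ler_norm _))// (le_trans h2).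
  move=> /(ler_wpM2l rho0); lra.
have vE : 1 - (s * rho)%:C * expi_sum t = (1 - s)%:C + s%:C * v.
  by rewrite /v real_complexM real_complexB; ring.
have hs : s ^+ 2 * modulus v ^+ 2 <= modulus (1 - (s * rho)%:C *
  expi_sum t) ^+ 2.
  rewrite vE !sqr_modulus; case: (v) Rv => x y /= x0.
  have : 0 <= s * (1 - s) * x by rewrite !mulr_ge0// subr_ge0.
  by have := sqr_ge0 (1 - s); nra.
have v4 : 4 * rho ^+ 2 <= modulus v ^+ 2.
  rewrite (_ : 4 * rho ^+ 2 = (2 * rho) ^+ 2); last by ring.
  by rewrite lerXn2r ?nnegrE ?mulr_ge0 ?modulus_ge0// (le_trans k2).
split; last by rewrite mulr_ge0 ?sqr_ge0// subr_ge0.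
rewrite (_ : s ^+ 4 * _ = (s ^+ 2 * modulus v ^+ 2) *
  (s ^+ 2 * modulus v ^+ 2 - 4 * (s * rho) ^+ 2)); last by ring.
apply: ler_pM; [by rewrite mulr_ge0 ?sqr_ge0| |exact: hs|by rewrite lerB].
rewrite (_ : _ - _ = s ^+ 2 * (modulus v ^+ 2 - 4 * rho ^+ 2)); last by ring.
by rewrite mulr_ge0 ?sqr_ge0// subr_ge0.
Qed.

End square_root_integral.

(** * Nonnegativity of g bounds the radius *)

Section choice_of_angles.
Variable R : realType.
Local Notation C := R[i].
Local Notation T := (measurableTypeR R).

Lemma cube_cons n (x : T) (t : n.-tuple T) : 0 <= x <= 2 * pi ->
  @cube R n t -> @cube R n.+1 (tuple_cons (x, t)).
Proof.
move=> hx ht; have : (`[0, 2 * pi]%classic `*` @cube R n) (x, t).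
  by split=> //=; rewrite in_itv.
by rewrite -tuple_cons_cube.
Qed.

(** With [k] angles pi and the other ones 0, the coordinates sum to m - 2 k. *)
Lemma exists_signs m k : (k <= m)%N ->
  exists2 t : m.-tuple T, @cube R m t & expi_sum t = (m%:R - 2 * k%:R)%:C.
Proof.
have pi0 := pi_ge0 R.
elim: m k => [|m IH] [|k] // km.
- exists [tuple]; first by case.
  by rewrite expi_sum0 mulr0 subr0.
- have [t ct St] := IH 0%N isT.
  exists (@tuple_cons _ T m ((0 : R), t)); first by apply: cube_cons => //;
    rewrite lexx/= mulr_ge0.
  rewrite expi_sum_cons St expi0 -[1]/((1 : R)%:C) -real_complexD; congr (_%:C).
  by rewrite -natr1; ring.
- have [t ct St] := IH k km.
  exists (@tuple_cons _ T m ((pi : R), t)); first by apply: cube_cons => //;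
    rewrite pi0/=; lra.
  rewrite expi_sum_cons St /expi cospi sinpi.
  rewrite -[(-1) +i* 0]/((-1 : R)%:C) -real_complexD; congr (_%:C).
  by rewrite -natr1 -[k.+1%:R]natr1; ring.
Qed.

(** If rho > 1/(n + 2), then g is negative at some point of the cube: one angle is
    0 or pi/2, [k] angles are pi and the other ones are 0, where [k] is chosen to
    make 0 < |1 - rho S| < 2 rho. *)
Lemma gpoly_ge0_radius n (rho : R) : (0 < n)%N -> 0 <= rho ->
  (forall t, @cube R n t -> 0 <= gpoly rho t) -> n.+2%:R * rho <= 1.
Proof.
case: n => // m _ rho0 h; rewrite leNgt; apply/negP => big.
have pi0 := pi_ge0 R.
have rho_gt0 : 0 < rho.
  by rewrite lt_def rho0 andbT; apply: contraTneq big => ->;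
    rewrite mulr0 ltNge ler01.
have mR : m.+3%:R = m%:R + 3 :> R by rewrite -addn3 natrD.
rewrite mR in big.
have key k (x : R) : (k <= m)%N -> 0 <= x <= 2 * pi ->
    forall e W : R, e = 1 - rho * (m%:R - 2 * k%:R) ->
    W = e ^+ 2 + rho ^+ 2 - 2 * rho * e * cos x ->
    0 <= W * (W - 4 * rho ^+ 2).
  move=> km hx e W eE WE; have [t ct St] := exists_signs km.
  have := h _ (cube_cons hx ct); rewrite /gpoly expi_sum_cons St.
  set v := 1 - _; suff -> : modulus v ^+ 2 = W by [].
  rewrite sqr_modulus (_ : complex.Re v = e - rho * cos x); last first.
    by rewrite /v eE /=; ring.
  rewrite (_ : complex.Im v = - (rho * sin x)); last by rewrite /v /=; ring.
  by rewrite sqrrN exprMn sin2cos2 WE; ring.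
have [hn|hn] := leP 1 ((m%:R + 1) * rho).
  (* 1 / rho lies within distance 1 of one of the values m - 2 k *)
  pose y : R := (m%:R + 1 - rho^-1) / 2.
  have y0 : 0 <= y by rewrite divr_ge0// subr_ge0 -div1r ler_pdivrMr.
  pose k := Num.truncn y.
  have /andP[k1 k2] := truncn_itv y0; rewrite -/k -natr1 in k1 k2.
  have ri : 0 < rho^-1 by rewrite invr_gt0.
  have km : (k <= m)%N.
    have : 2 * k%:R < m%:R + 1 :> R by move: k1; rewrite /y; lra.
    rewrite natr1 -natrM ltr_nat ltnS => h2.
    by rewrite (leq_trans _ h2)// leq_pmull.
  have hpi : (0 : R) <= (pi : R) / 2 <= 2 * (pi : R) by lra.
  have := key k (pi / 2) km hpi _ _ erefl erefl; rewrite cos_pihalf.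
  have eE : 1 - rho * (m%:R - 2 * k%:R) = rho * (1 - 2 * (y - k%:R)).
    by rewrite /y; field; rewrite gt_eqF.
  rewrite eE; set z := 1 - 2 * (y - k%:R).
  have z1 : -1 <= z <= 1 by rewrite /z; lra.
  rewrite mulr0 subr0 (_ : _ * _ = rho ^+ 4 * ((z ^+ 2 + 1) * (z ^+ 2 - 3)));
    last by ring.
  rewrite pmulr_rge0 ?exprn_gt0// pmulr_rge0; last by rewrite ltr_wpDl ?sqr_ge0.
  have : z ^+ 2 <= 1 by nra.
  lra.
have h0 : 0 <= (0 : R) <= 2 * pi by rewrite lexx/= mulr_ge0.
have := key 0%N 0 (leq0n _) h0 _ _ erefl erefl; rewrite cos0.
set e := 1 - _; have e1 : rho < e by rewrite /e; lra.
have e2 : e < 3 * rho by rewrite /e; lra.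
rewrite (_ : _ * _ = (e - rho) ^+ 2 * ((e - 3 * rho) * (e + rho)));
  last by ring.
rewrite pmulr_rge0; last by rewrite exprn_gt0// subr_gt0.
by rewrite nmulr_rge0 ?subr_lt0// leNgt => /negP; apply; lra.
Qed.

End choice_of_angles.

Lemma mean_EFin (R : realType) n (f : n.-tuple (measurableTypeR R) ->
  R) : bmf f ->
  ((mean f)%:E = ((2 * pi) ^- n)%:E *
    \int[lebesgue_tuple R n]_(t in @cube R n) (f t)%:E)%E.
Proof.
move=> bf; rewrite /mean /avg lebesgue_cube EFinM /Rintegral fineK//.
apply: integrable_fin_num; first exact: measurable_cube.
exact: (bmf_integrable (@measurable_cube R n) (lebesgue_cube_fin R n) bf).
Qed.

(** * The integral equation *)

Section integral_equation_theory.
Variable R : realType.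
Local Notation T := (measurableTypeR R).
Variables (d : nat) (hd : (3 <= d)%N) (a : R) (b : R[i]) (c : R).
Let s := a + (d - 1)%:R * c.
Let rho := modulus b / s.
Let lhs := a * (a + (d - 1)%:R * c) /
  (a ^+ 2 + (d - 1)%:R * a * c - d%:R * modulus b ^+ 2).
Hypothesis s0 : 0 < s.

Let rho0 : 0 <= rho. Proof. by rewrite divr_ge0 ?modulus_ge0// ltW. Qed.
Let dE : (d - 2).+2 = d. Proof. by case: d hd => [|[|n]] //= _;
  rewrite subSS subSS subn0. Qed.

Lemma gfunE (t : (d - 2).-tuple T) : gfun a b c t = gpoly rho t.
Proof.
rewrite /gfun /gpoly sqr_modulus_affine /rho -/s.
rewrite !(expr_div_n, mulrA); set S1 := \sum_(j < _) _;
  set S2 := \sum_(j < _) _.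
by congr (_ * _); ring.
Qed.

(** The requirement g >= 0 alone gives d rho <= 1. *)
Lemma integral_equation_radius : integral_equation d a b c -> d%:R * rho <= 1.
Proof.
move=> [g0 _ _]; rewrite -{1}dE; apply: gpoly_ge0_radius => //.
  by rewrite subn_gt0.
by move=> t /g0; rewrite gfunE.
Qed.

(** For d rho < 1 the integrand is bounded and the right-hand side of the integral
    equation is F(rho^2). *)
Lemma integral_equation_inside : d%:R * rho < 1 ->
  integral_equation d a b c <-> lhs = genfun d (rho ^+ 2).
Proof.
move=> rho1; have rho1' : (d - 2).+2%:R * rho < 1 by rewrite dE.
have bg := bmf_inv_sqrt_gpoly rho0 rho1'.
have E : inv_sqrt_gfun a b c = EFin \o (fun t : (d - 2).-tuple T =>
  (Num.sqrt (gpoly rho t))^-1).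
  apply/funext => t; rewrite /inv_sqrt_gfun gfunE inver.
  by rewrite gt_eqF// sqrtr_gt0 gpoly_gt0.
have m := mean_EFin bg.
rewrite mean_inv_sqrt_gpoly// dE in m.
split=> [[_ _]|h].
  by rewrite E -m => -[].
split.
- by move=> t _; rewrite gfunE ltW// gpoly_gt0.
- rewrite E; exact: (bmf_integrable (@measurable_cube R _)
  (lebesgue_cube_fin R _) bg).
- by rewrite E -m -/lhs h.
Qed.

(** For d rho = 1 the integrand dominates, up to the factor tau^2, the one for the
    smaller radius tau rho. *)
Lemma integral_equation_boundary (tau : R) : d%:R * rho = 1 -> 0 < tau < 1 ->
  integral_equation d a b c -> tau ^+ 2 * genfun d ((tau * rho) ^+ 2) <= lhs.
Proof.
move=> rho1 /andP[tau0 tau1] [g0 ig eq].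
have rho1' : (d - 2).+2%:R * rho <= 1 by rewrite dE rho1.
have trho0 : 0 <= tau * rho by rewrite mulr_ge0// ltW.
have trho1 : (d - 2).+2%:R * (tau * rho) < 1 by rewrite dE mulrCA rho1 mulr1.
have bg := bmf_inv_sqrt_gpoly trho0 trho1.
rewrite -lee_fin eq -{1}dE -mean_inv_sqrt_gpoly// EFinM (mean_EFin bg) muleCA.
apply: lee_wpmul2l.
  by rewrite lee_fin invr_ge0 exprn_ge0// ltW// twopi_gt0.
have ib := bmf_integrable (@measurable_cube R _) (lebesgue_cube_fin R _) bg.
rewrite -ge0_integralZl_EFin//; last 3 first.
- exact: measurable_cube.
- exact: measurable_int ib.
- exact: sqr_ge0.
apply: ge0_le_integral.
- exact: measurable_cube.
- by move=> t _; rewrite -EFinM lee_fin mulr_ge0 ?sqr_ge0// invr_ge0 sqrtr_ge0.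
- apply: emeasurable_funM => //; exact: measurable_int ib.
- exact: measurable_int ig.
- move=> t _; rewrite /inv_sqrt_gfun gfunE inver -EFinM.
  have tt : 0 <= tau <= 1 by rewrite !ltW.
  have [h1 h2] := gpoly_scale t rho0 rho1' tt.
  case: ifPn => [_|hn]; first exact: leey.
  have g1 : 0 < Num.sqrt (gpoly rho t) by rewrite lt_def hn sqrtr_ge0.
  have g2 : 0 < Num.sqrt (gpoly (tau * rho) t) by rewrite sqrtr_gt0 gpoly_gt0.
  rewrite lee_fin ler_pdivrMr// mulrC ler_pdivlMr//.
  rewrite (_ : tau ^+ 2 = Num.sqrt (tau ^+ 4)); last first.
    by rewrite (_ : tau ^+ 4 =
      (tau ^+ 2) ^+ 2) ?sqrtr_sqr ?ger0_norm ?sqr_ge0// -exprM.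
  by rewrite -sqrtrM ?exprn_ge0 ?(ltW tau0)// ler_wsqrtr.
Qed.

End integral_equation_theory.

(** * The moment matrix *)

Section moment_matrix_theory.
Variable R : realType.
Local Notation C := R[i].
Variables (d : nat) (d0 : (0 < d)%N) (a : R) (b : C) (c : R).
Let s := a + (d - 1)%:R * c.

Lemma conjE (z : C) : (z^*)%R = z^*%C.
Proof. by []. Qed.

Lemma moment_matrix_mul (x0 : C) (y : 'cV[C]_d) :
  moment_matrix d a b c *m col_mx x0%:M y =
  col_mx (a%:C * x0 + b^*%C * \sum_j y j 0)%:M
         (\col_i (b * x0 + (a - c)%:C * y i 0 + c%:C * \sum_j y j 0)).
Proof.
rewrite /moment_matrix mul_block_col; congr col_mx.
  apply/matrixP => i j; rewrite !ord1 !mxE big_ord1 !mxE !eqxx !mulr1n.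
  by congr (_ + _); rewrite big_distrr/=; apply: eq_bigr => k _; rewrite !mxE.
apply/matrixP => i j; rewrite !ord1 !mxE big_ord1 !mxE eqxx mulr1n -addrA;
  congr (_ + _).
rewrite (bigD1 i)//= [in RHS](bigD1 i)//= !mxE eqxx mulrDr addrA -mulrDl
  -real_complexD subrK.
congr (_ + _); rewrite big_distrr/=; apply: eq_bigr => k ki.
by rewrite !mxE eq_sym (negbTE ki).
Qed.

Lemma quadratic_formE (x0 sg : C) (y : 'cV[C]_d) : \sum_j y j 0 = sg ->
  (map_mx Num.conj (col_mx x0%:M y)^T *m moment_matrix d a b c *m col_mx
    x0%:M y) 0 0 =
  x0^*%C * (a%:C * x0 + b^*%C * sg) + sg^*%C * (b * x0 + c%:C * sg) +
  (a - c)%:C * \sum_j (y j 0) * (y j 0)^*%C.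
Proof.
move=> sgE; rewrite -mulmxA moment_matrix_mul tr_col_mx map_row_mx
  mul_row_col sgE.
rewrite !mxE !big_ord1 !mxE !eqxx !mulr1n -addrA; congr (_ * _ + _).
have -> : sg^*%C = \sum_j (y j 0)^*%C by rewrite -sgE rmorph_sum.
rewrite big_distrl [X in _ = _ + X]big_distrr -big_split/=;
  apply: eq_bigr => j _.
by rewrite !mxE conjE /=; ring.
Qed.

Lemma hermitian_moment_matrix : moment_matrix d a b c \is hermsymmx.
Proof.
apply/is_hermitianmxP;
  rewrite expr0 scale1r /moment_matrix tr_block_mx map_block_mx.
congr block_mx; apply/matrixP => i j; rewrite !mxE.
- by rewrite !ord1 eqxx !mulr1n conjE conjc_real.
- by [].
- by rewrite !conjE conjcK.
- by rewrite conjE conjc_real eq_sym.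
Qed.

Lemma natr_subn1 : (d - 1)%:R = d%:R - 1 :> R.
Proof. by rewrite natrB. Qed.

Let sE : s = a + (d%:R - 1) * c.
Proof. by rewrite /s natr_subn1. Qed.

Lemma real_complex1 : (1 : R)%:C = 1.
Proof. by []. Qed.

(** Evaluation of the quadratic form at the vector (s, -b, ..., -b). *)
Lemma posdef_det : 0 < s -> posdefmx (moment_matrix d a b c) ->
  d%:R * modulus b ^+ 2 < a * s.
Proof.
move=> s0 [_ pd].
pose y : 'cV[C]_d := const_mx (- b).
have sy : \sum_j y j 0 = - (d%:R * b).
  under eq_bigr do rewrite mxE.
  by rewrite sumr_const card_ord mulNrn mulr_natl.
have xn0 : col_mx ((s%:C)%:M : 'M[C]_1) y != 0.
  apply/eqP => /(congr1 (fun A : 'M[C]_(1 + d, 1) => A (lshift d ord0) ord0)).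
  rewrite col_mxEu !mxE eqxx mulr1n => /(@complexI R) h.
  by rewrite h ltxx in s0.
have := pd _ xn0; rewrite (quadratic_formE _ sy).
under eq_bigr do rewrite mxE mulr_conj.
rewrite sumr_const card_ord modulusN -[(modulus b ^+ 2)%:C *+ d]mulr_natl.
have cs : (- (d%:R * b))^*%C = - (d%:R * b^*%C).
  by rewrite rmorphN rmorphM; congr (- (_ * _)); exact: rmorph_nat.
rewrite cs conjc_real.
rewrite (_ : _ + _ = (s * (a * s - d%:R * modulus b ^+ 2))%:C).
  by rewrite ltcR pmulr_rgt0// subr_gt0.
have := mulr_conj b; move: (modulus b ^+ 2) => V hV.
rewrite sE !(real_complex1, real_complexM, real_complexB, real_complexD,
  real_complex_nat) -hV.
by ring.
Qed.

Lemma sum_sqr_modulus_variance (y : 'cV[C]_d) :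
  \sum_j modulus (y j 0 - (\sum_k y k 0) / d%:R) ^+ 2 =
  \sum_j modulus (y j 0) ^+ 2 - modulus (\sum_k y k 0) ^+ 2 / d%:R.
Proof.
set sg := \sum_k y k 0.
have dn : d%:R != 0 :> R by rewrite pnatr_eq0 -lt0n.
under eq_bigr do rewrite sqr_modulusB.
rewrite big_split big_split /= sumr_const card_ord sumrN -big_distrr/=.
have -> : \sum_(j < d) complex.Re (y j 0 * (sg / d%:R)^*%C) =
  modulus sg ^+ 2 / d%:R.
  have e : \sum_(j < d) y j 0 * (sg / d%:R)^*%C = (modulus sg ^+ 2 / d%:R)%:C.
    rewrite -big_distrl/= -/sg rmorphM fmorphV rmorph_nat mulrA mulr_conj.
    by rewrite [RHS]real_complexM real_complexV real_complex_nat.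
  have -> : modulus sg ^+ 2 / d%:R =
    complex.Re ((modulus sg ^+ 2 / d%:R)%:C) by [].
  rewrite -e; elim/big_rec2 : _ => // j u v _ ->.
  by rewrite ReD.
have -> : modulus (sg / d%:R) ^+ 2 = modulus sg ^+ 2 / d%:R ^+ 2.
  by rewrite modulusM modulusV -real_complex_nat modulus_real
    ger0_norm// expr_div_n.
by rewrite -mulr_natl; field; exact: dn.
Qed.

(** Sufficiency: with sigma the sum of the entries y_j, the quadratic form is a sum
    of multiples of the variance of the y_j, of |a x_0 + conj(b) sigma|^2 and of
    |sigma|^2, with positive coefficients. *)
Lemma posdef_moment_matrix : 0 < a -> c < a -> 0 < s ->
  d%:R * modulus b ^+ 2 < a * s -> posdefmx (moment_matrix d a b c).
Proof.
move=> a0 ca s0 det; split; first exact: hermitian_moment_matrix.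
move=> x xn0; rewrite -(vsubmxK x) in xn0 *.
set y := dsubmx _ in xn0 *; set u := usubmx _ in xn0 *.
rewrite (mx11_scalar u) in xn0 *; set x0 := u 0 0 in xn0 *.
set sg := \sum_j y j 0; rewrite (quadratic_formE _ (erefl sg)).
have dR : 0 < d%:R :> R by rewrite ltr0n.
pose V := modulus sg ^+ 2.
pose Y := \sum_j modulus (y j 0) ^+ 2.
pose k := (a * s - d%:R * modulus b ^+ 2) / (a * d%:R).
have k0 : 0 < k by rewrite divr_gt0 ?mulr_gt0// subr_gt0.
rewrite (_ : _ + _ = ((a - c) * (Y - V / d%:R) +
   (modulus (a%:C * x0 + b^*%C * sg) ^+ 2 / a + k * V))%:C); last first.
  under eq_bigr do rewrite mulr_conj.
  have aC : a%:C != 0 :> C by apply/eqP => /(@complexI R) h;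
    rewrite h ltxx in a0.
  have dC : d%:R != 0 :> C by rewrite pnatr_eq0 -lt0n.
  have hY : Y%:C = \sum_(i < d) (modulus (y i 0) ^+ 2)%:C by exact: rmorph_sum.
  have hV : V%:C = sg * sg^*%C by rewrite mulr_conj.
  clearbody Y V.
  have := mulr_conj (a%:C * x0 + b^*%C * sg).
  have := mulr_conj b.
  rewrite /k; move: (modulus b ^+ 2) (modulus (a%:C * x0 + b^*%C * sg) ^+ 2)
    => B W hB hW.
  rewrite sE !(real_complex1, real_complexM, real_complexB, real_complexD,
    real_complexV, real_complex_nat).
  rewrite -hB -hW hV hY.
  have -> : (a%:C * x0 + b^*%C * sg)^*%C = a%:C * x0^*%C + b * sg^*%C.
    rewrite rmorphD !rmorphM; congr (_ * _ + _ * _);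
      [exact: conjc_real|exact: conjcK].
  set Q := \sum_(i < d) _; field.
  by rewrite aC dC.
rewrite ltcR.
have VY : 0 <= Y - V / d%:R.
  by rewrite /Y /V -sum_sqr_modulus_variance; apply: sumr_ge0 => j _;
    exact: sqr_ge0.
have ca0 : 0 < a - c by rewrite subr_gt0.
have P0 : 0 <= modulus (a%:C * x0 + b^*%C * sg) ^+ 2 / a.
  by rewrite divr_ge0 ?sqr_ge0// ltW.
have V0 : 0 <= V by exact: sqr_ge0.
have [Vp|Vn] := ltP 0 V.
  by rewrite ltr_wpDl ?mulr_ge0 ?(ltW ca0)// ltr_wpDl// mulr_gt0.
have VZ : V = 0 by apply/eqP; rewrite eq_le Vn V0.
have sg0 : sg = 0.
  by apply/modulus0_eq0/eqP; rewrite -sqrf_eq0 -/V VZ.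
rewrite VZ sg0 !mulr0 addr0 mul0r subr0.
have Y0 : 0 <= Y by apply: sumr_ge0 => j _; exact: sqr_ge0.
have [Yp|Yn] := ltP 0 Y.
  by rewrite ltr_pwDl ?mulr_gt0// divr_ge0 ?sqr_ge0// ltW.
have YZ : Y = 0 by apply/eqP; rewrite eq_le Yn Y0.
have y0 : y = 0.
  apply/matrixP => i j; rewrite ord1 [RHS]mxE; apply: modulus0_eq0.
  have yge (l : 'I_d) : true -> 0 <= modulus (y l 0) ^+ 2 by move=> _;
    exact: sqr_ge0.
  have := psumr_eq0P yge YZ (i := i) isT.
  by move/eqP; rewrite sqrf_eq0 => /eqP.
have x0n : x0 != 0.
  apply: contraNneq xn0 => ->; rewrite y0.
  by apply/eqP; rewrite -[RHS](@col_mx0 _ 1 d 1); congr col_mx; rewrite raddf0.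
rewrite YZ mulr0 add0r ?addr0 divr_gt0// exprn_gt0// modulusM modulus_real
  gtr0_norm//.
rewrite mulr_gt0// lt_def modulus_ge0 andbT.
by apply: contraNneq x0n => /modulus0_eq0 ->.
Qed.

(** The two distinct rows of the linear system; the second one is repeated d
    times. *)
Lemma coef_equationE (p0 p1 : C) : coef_equation d a b c p0 p1 <->
  (a%:C * (modulus p0 ^+ 2)%:C + d%:R * b^*%C * (p1 * p0^*%C) = 1 /\
   b * (modulus p0 ^+ 2)%:C + s%:C * (p1 * p0^*%C) = 0).
Proof.
rewrite /coef_equation.
have -> : (`|p0| ^+ 2) = (modulus p0 ^+ 2)%:C by rewrite real_complexX.
rewrite moment_matrix_mul.
have -> : \sum_j (const_mx (p1 * (p0^*)%R) :
  'cV[C]_d) j 0 = d%:R * (p1 * p0^*%C).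
  by under eq_bigr do rewrite mxE; rewrite sumr_const card_ord mulr_natl.
have scE : s%:C = a%:C + (d%:R - 1) * c%:C.
  by rewrite /s real_complexD real_complexM natr_subn1 real_complexB
    real_complex_nat.
split.
  move=> /eq_col_mx[h1 h2]; split.
    move/(congr1 (fun A : 'M[C]_1 => A 0 0)): h1;
      rewrite !mxE eqxx !mulr1n => h1.
    by rewrite -[RHS]h1; ring.
  have := congr1 (fun A : 'cV[C]_d => A (Ordinal d0) 0) h2;
    rewrite !mxE => {}h2.
  by rewrite -[RHS]h2 scE real_complexB conjE; ring.
move=> [h1 h2]; congr col_mx.
  by congr (_%:M); rewrite -[RHS]h1; ring.
apply/matrixP => i j; rewrite !mxE -[RHS]h2.
by rewrite scE real_complexB conjE; ring.
Qed.

End moment_matrix_theory.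

(** * Solutions of the moment problem *)

Section solution.
Variable R : realType.
Local Notation C := R[i].
Variables (d : nat) (hd : (3 <= d)%N) (a : R) (a0 : 0 < a) (b : C).
Local Notation F := (@genfun R d).
Local Notation G N := (gensum d N (d%:R ^- 2 : R)).
Let beta := modulus b / a.

Let d0 : (0 < d)%N. Proof. exact: leq_trans hd. Qed.
Let dR : 0 < d%:R :> R. Proof. by rewrite ltr0n. Qed.
Let d1 : 1 < d%:R :> R. Proof. by rewrite ltr1n (leq_trans _ hd). Qed.

Lemma gensum2_gt1 : 1 < G 2.
Proof.
rewrite /gensum !big_ord_recl big_ord0 /bump/= mom_0 mom_1 expr0 mulr1 addr0.
by rewrite ltrDl mulr_gt0// exprn_gt0// invr_gt0 exprn_gt0.
Qed.

(** If p solves the moment problem then |b|/a = (1 - 1/F(r^2)) / (d r) with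
    r = |p_1/p_0| < 1/d, which is less than 1 - 1/gamma_d. *)
Lemma solves_moments_cond (p0 p1 : C) :
  solves_moments a b (@deg1_sympoly R d p0 p1) ->
  exists N, 1 < G N * (1 - beta).
Proof.
move=> [/(stable_deg1 d0) lt f0 f1].
have [aE bE] := fourier_coef_relation d0 lt f0 f1.
set q := - (p1 / p0) in aE bE.
have P0 := p0_gt0 lt; have P2 : 0 < modulus p0 ^+ 2 by rewrite exprn_gt0.
have hq := ratio_lt lt; rewrite -/q in hq.
have [q0|qn0] := eqVneq (modulus q) 0.
  exists 2%N; suff -> : beta = 0 by rewrite subr0 mulr1 gensum2_gt1.
  suff b0 : b = 0 by rewrite /beta b0 modulus0 mul0r.
  have q00 : q = 0 by exact: modulus0_eq0.
  by rewrite -f1 (fourier_coef1 (j := Ordinal d0) lt)// -/q first_coef_0 ?mulr0.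
have qp : 0 < modulus q by rewrite lt_def qn0 modulus_ge0.
apply: (ratio_lt_gamma d0 qp hq).
have x1 : d%:R ^+ 2 * modulus q ^+ 2 < 1.
  by rewrite -exprMn expr_lt1// mulr_ge0 ?modulus_ge0.
have F1 := genfun_ge1 (sqr_ge0 (modulus q)) x1.
have Fp : 0 < F (modulus q ^+ 2) by exact: lt_le_trans F1.
have := congr1 (fun z => modulus z) bE.
rewrite !modulusM modulus_conj -real_complex_nat !modulus_real ger0_norm//.
rewrite aE ger0_norm; last first.
  by rewrite subr_ge0 ler_peMr// invr_ge0 ltW.
move=> E; rewrite /beta [LHS]mulrA E aE; field.
by rewrite !gt_eqF.
Qed.

(** The ratio r of [exists_ratio] is |b| / (a + (d - 1) c), which determines c. *)
Lemma admissible_exists : (exists N, 1 < G N * (1 - beta)) ->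
  exists c : R, admissible d a b c.
Proof.
move=> cond.
have [b0|bn0] := eqVneq (modulus b) 0.
  exists 0; have s0 : 0 < a + (d - 1)%:R * 0 by rewrite mulr0 addr0.
  split; first exact: lexx.
  - have rho1 : d%:R * (modulus b / (a + (d - 1)%:R * 0)) < 1.
      by rewrite b0 mul0r mulr0.
    apply/(integral_equation_inside hd s0 rho1).
    rewrite b0 mul0r expr0n /= !mulr0 !addr0 subr0 -expr2 mulfV ?gt_eqF
      ?exprn_gt0//.
    by rewrite genfunE ?mulr0 ?ltr01// mul0r addr0.
  - apply: posdef_moment_matrix => //.
    by rewrite b0 expr0n /= mulr0 mulr_gt0.
have bp : 0 < modulus b by rewrite lt_def bn0 modulus_ge0.
have betap : 0 < beta by rewrite divr_gt0.
have [r [r0 r1 hr]] := exists_ratio d0 betap cond.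
have x0 := sqr_ge0 r.
have x1 : d%:R ^+ 2 * r ^+ 2 < 1 by rewrite -exprMn expr_lt1// mulr_ge0// ltW.
have F1 := genfun_ge1 x0 x1; have Fp : 0 < F (r ^+ 2) by exact: lt_le_trans F1.
have bE : modulus b = beta * a by rewrite /beta mulfVK// gt_eqF.
pose s := modulus b / r; have sr : modulus b / s = r.
  by rewrite /s; field; rewrite !gt_eqF.
have s0 : 0 < s by rewrite divr_gt0.
pose c := (s - a) / (d - 1)%:R.
have dB : 0 < (d - 1)%:R :> R by rewrite ltr0n subn_gt0 (leq_trans _ hd).
have sE : a + (d - 1)%:R * c = s.
  by rewrite /c mulrCA mulfV ?mulr1 ?gt_eqF// addrC subrK.
have dBE : (d - 1)%:R = d%:R - 1 :> R by rewrite natrB.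
have x1' : d%:R * r ^+ 2 < 1.
  by rewrite (le_lt_trans _ x1)// ler_wpM2r// expr2 ler_peMl// ltW.
(* the lower bound on the generating function gives c >= 0 *)
have rb : r <= beta.
  have := genfun_lower x0 x1 x1' => lo.
  have : d%:R * r * r <= d%:R * r * beta.
    rewrite hr lerBrDr -lerBrDl -mulrA -expr2.
    by rewrite -[leRHS]invrK lef_pV2 ?posrE ?invr_gt0 ?subr_gt0.
  by rewrite ler_pM2l// mulr_gt0.
(* the upper bound gives c < a *)
have bdr : beta < d%:R * r.
  have up := genfun_upper x0 x1.
  set e := 1 - d%:R ^+ 2 * r ^+ 2 in up; have e0 : 0 < e by rewrite subr_gt0.
  have up2 : F (r ^+ 2) < e^-1.
    apply: le_lt_trans up _.
    rewrite [ltRHS](_ : e^-1 = 1 + r ^+ 2 * (d%:R ^+ 2 / e)); last first.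
      have eS : 1 = e + d%:R ^+ 2 * r ^+ 2 by rewrite /e subrK.
      rewrite -[LHS]mul1r [X in X * _ = _]eS mulrDl mulfV ?gt_eqF//;
        congr (1 + _).
      by ring.
    rewrite ltrD2l ltr_pM2l ?exprn_gt0// ltr_pM2r ?invr_gt0//.
    by rewrite expr2 ltr_pMr.
  have : d%:R * r * beta < d%:R * r * (d%:R * r).
    rewrite hr ltrBlDr -ltrBlDl -expr2 exprMn -/e.
    by rewrite -[ltLHS]invrK ltf_pV2 ?posrE ?invr_gt0.
  by rewrite ltr_pM2l// mulr_gt0.
have det : a * s - d%:R * modulus b ^+ 2 = a * s / F (r ^+ 2).
  have -> : a * s / F (r ^+ 2) =
    a * s * (1 - d%:R * r * beta) by rewrite hr subKr.
  by rewrite /s bE; field; rewrite gt_eqF.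
exists c; split.
- rewrite divr_ge0 ?(ltW dB)// subr_ge0 /s ler_pdivlMr// bE mulrC.
  by rewrite ler_pM2r.
- rewrite -sE in s0 sr.
  have rho1 : d%:R * (modulus b / (a + (d - 1)%:R * c)) < 1 by rewrite sr.
  apply/(integral_equation_inside hd s0 rho1); rewrite sr.
  rewrite (_ : a ^+ 2 + _ - _ =
    a * (a + (d - 1)%:R * c) - d%:R * modulus b ^+ 2); last by ring.
  rewrite sE det; rewrite sE in s0.
  by field; rewrite !gt_eqF.
- apply: posdef_moment_matrix => //; rewrite ?sE//.
  + rewrite /c ltr_pdivrMr// dBE ltrBlDr mulrBr mulr1 subrK /s ltr_pdivrMr// bE.
    by rewrite mulrC -mulrA ltr_pM2l.
  + by rewrite -subr_gt0 det divr_gt0// mulr_gt0.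
Qed.

Section admissible_solution.
Variable c : R.
Hypothesis cond : exists N, 1 < G N * (1 - beta).
Hypothesis adm : admissible d a b c.
Let s := a + (d - 1)%:R * c.
Let rho := modulus b / s.

Let s0 : 0 < s.
Proof. by case: adm => c0 _ _; rewrite /s ltr_pwDl// mulr_ge0. Qed.

Let rho0 : 0 <= rho. Proof. by rewrite divr_ge0 ?modulus_ge0// ltW. Qed.

Let det : d%:R * modulus b ^+ 2 < a * s.
Proof. by case: adm => _ _ pd; exact: (posdef_det d0 s0 pd). Qed.

Let det0 : 0 < a * s - d%:R * modulus b ^+ 2. Proof. by rewrite subr_gt0. Qed.

Let lhsE : a * (a + (d - 1)%:R * c) /
    (a ^+ 2 + (d - 1)%:R * a * c - d%:R * modulus b ^+ 2) =
  a * s / (a * s - d%:R * modulus b ^+ 2).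
Proof. by congr (_ / _); rewrite /s; ring. Qed.

(** The radius 1/d is excluded: there the integral is at least gamma_d, while the
    integral equation gives it the value 1 / (1 - |b|/a) < gamma_d. *)
Lemma admissible_radius : d%:R * rho < 1.
Proof.
have [_ ie _] := adm.
rewrite lt_def (integral_equation_radius hd s0 ie) andbT.
apply/eqP => /esym rho1; case: cond => N hN.
have bnd tau : 0 < tau < 1 ->
    tau ^+ 2 * F ((tau * rho) ^+ 2) * (1 - beta) <= 1.
  move=> tau01; have := integral_equation_boundary hd s0 rho1 tau01 ie.
  rewrite lhsE -/rho => h.
  have e : a * s / (a * s - d%:R * modulus b ^+ 2) = (1 - beta)^-1.
    have bs : d%:R * modulus b = s.
      by move: rho1; rewrite /rho mulrA => /(canRL (mulfVK _)) ->;
        rewrite ?mul1r// gt_eqF.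
    have E1 : a * s - d%:R * modulus b ^+ 2 = s * (a - modulus b).
      by rewrite expr2 mulrA bs; ring.
    have ab : 0 < a - modulus b by rewrite -(pmulr_rgt0 _ s0) -E1.
    by rewrite E1 /beta; field; rewrite !gt_eqF.
  rewrite e in h; have b1 : 0 < 1 - beta.
    by rewrite -invr_gt0 -e divr_gt0// mulr_gt0.
  by rewrite -ler_pdivlMr// div1r.
have G0 : 0 <= G N by apply: gensum_ge0; rewrite invr_ge0 sqr_ge0.
have b1 : 0 < 1 - beta.
  rewrite ltNge; apply/negP => b1.
  by have := lt_le_trans hN (mulr_ge0_le0 G0 b1); rewrite ltNge ler01.
(* one power more than needed makes the contradiction strict *)
have [tau [/andP[t1 t2] ht]] := expr_near1 (2 * N).+3 hN.
have tau0 : 0 < tau by lra.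
have rhoE : rho = d%:R^-1 by apply: (mulfI (lt0r_neq0 dR));
  rewrite rho1 mulfV ?gt_eqF.
have tau01 : 0 < tau < 1 by rewrite tau0.
have tau2 : 0 <= tau ^+ 2 <= 1 by rewrite sqr_ge0 expr_le1// ltW.
have xE : (tau * rho) ^+ 2 = tau ^+ 2 * d%:R ^- 2 by rewrite exprMn rhoE exprVn.
have x1 : d%:R ^+ 2 * (tau * rho) ^+ 2 < 1.
  by rewrite -exprMn mulrCA rho1 mulr1 expr_lt1// ltW.
have := bnd tau tau01; apply/negP; rewrite -ltNge.
have le1 : tau ^+ (2 * N) * G N <= F ((tau * rho) ^+ 2).
  apply: le_trans (gensum_le_genfun N (sqr_ge0 _) x1).
  by rewrite exprM xE; exact: gensum_scale.
have p1 : 1 <= tau * (tau ^+ 2 * (tau ^+ (2 * N) * G N) * (1 - beta)).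
  by apply: le_trans ht _; rewrite !exprS; lra.
have p2 : 0 < tau ^+ 2 * (tau ^+ (2 * N) * G N) * (1 - beta).
  by rewrite -(pmulr_rgt0 _ tau0) (lt_le_trans ltr01).
have p3 : 1 < tau ^+ 2 * (tau ^+ (2 * N) * G N) * (1 - beta).
  by apply: le_lt_trans p1 _; rewrite gtr_pMl.
by apply: lt_le_trans p3 _; rewrite ler_pM2r// ler_pM2l// exprn_gt0.
Qed.

Lemma coef_equation_exists : exists p0 p1 : C, coef_equation d a b c p0 p1.
Proof.
pose k := s / (a * s - d%:R * modulus b ^+ 2).
have k0 : 0 < k by rewrite divr_gt0.
pose p0 := (Num.sqrt k)%:C; exists p0, (- (b / s%:C) * p0).
have sn : s%:C != 0 by apply/eqP => /(@complexI R) h; move: (s0);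
  rewrite h ltxx.
have p0k : modulus p0 ^+ 2 = k.
  by rewrite /p0 modulus_real real_normK ?num_real// sqr_sqrtr// ltW.
have pE : - (b / s%:C) * p0 * p0^*%C = - (b / s%:C) * k%:C.
  by rewrite -mulrA mulr_conj p0k.
apply/(coef_equationE d0); rewrite pE p0k; split.
  have -> : d%:R * b^*%C * (- (b / s%:C) * k%:C) =
     - (d%:R * (modulus b ^+ 2)%:C * k%:C / s%:C).
    by rewrite -mulr_conj; ring.
  rewrite -[d%:R]real_complex_nat -!real_complexM -real_complexV -real_complexM.
  rewrite -real_complexN -real_complexD -[RHS]/((1 : R)%:C); congr (_%:C).
  by rewrite /k; field; rewrite !gt_eqF.
by rewrite mulrA mulrN mulrCA mulfV// mulr1 mulNr subrr.
Qed.

(** The linear system gives |p_1/p_0| = rho and 1/|p_0|^2 = a - d |b|^2/s, the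
    integral equation then gives the zeroth Fourier coefficient, and
    [fourier_coef_relation] the first one. *)
Lemma coef_equation_solves (p0 p1 : C) : coef_equation d a b c p0 p1 ->
  solves_moments a b (@deg1_sympoly R d p0 p1).
Proof.
move=> /(coef_equationE d0)[h1 h2].
have rho1 := admissible_radius.
have [_ ie _] := adm.
have lhs := (integral_equation_inside hd s0 rho1).1 ie.
rewrite lhsE -/rho in lhs.
have sn : s%:C != 0 by apply/eqP => /(@complexI R) h; move: (s0);
  rewrite h ltxx.
have p0n : p0 != 0.
  apply/eqP => z; move: h1;
    rewrite z conjc0 !mulr0 addr0 modulus0 expr0n /= mulr0.
  by move/eqP; rewrite eq_sym oner_eq0.
have P0 : 0 < modulus p0.
  by rewrite lt_def modulus_ge0 andbT;
    apply: contraNneq p0n => /modulus0_eq0 ->.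
have P2 : 0 < modulus p0 ^+ 2 by rewrite exprn_gt0.
have e : p1 * p0^*%C = - (b * (modulus p0 ^+ 2)%:C / s%:C).
  apply: (mulfI sn); rewrite mulrN [X in _ = - X]mulrCA mulfV// mulr1.
  by apply/eqP; rewrite -addr_eq0 addrC h2.
have qE : - (p1 / p0) = b / s%:C.
  have cn : p0^*%C != 0 by rewrite conjc_eq0.
  apply: (mulIf (mulf_neq0 p0n cn)).
  rewrite [X in _ = _ * X]mulr_conj mulNr mulrA mulfVK// e opprK.
  by rewrite mulrAC.
have mq : modulus (- (p1 / p0)) = rho.
  by rewrite qE modulusM modulusV modulus_real gtr0_norm.
have lt : d%:R * modulus p1 < modulus p0.
  move: rho1; rewrite -mq modulusN modulusM modulusV mulrA
    ltr_pdivrMr// mul1r//.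
have p0E : (modulus p0 ^+ 2)^-1 = a - d%:R * modulus b ^+ 2 / s.
  have h : a * modulus p0 ^+ 2 - d%:R * (modulus b ^+ 2) * modulus p0
    ^+ 2 / s = 1.
    apply: (@complexI R); rewrite -[RHS]h1 e.
    have := mulr_conj b; move: (modulus b ^+ 2) (modulus p0 ^+ 2) => B P hB.
    rewrite !(real_complexM, real_complexB, real_complexV,
      real_complex_nat) -hB.
    by ring.
  apply: (mulIf (lt0r_neq0 P2)); rewrite mulVf ?gt_eqF// -[LHS]h.
  by ring.
have f0 : fourier_coef (inv_sqr_modulus (@deg1_sympoly R d p0 p1))
  (fun=> 0) = a%:C.
  rewrite (fourier_coef0 lt) mq -lhs p0E; congr (_%:C).
  by field; rewrite !gt_eqF.
split=> //; first exact/(stable_deg1 d0).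
have [_] := fourier_coef_relation d0 lt f0 erefl.
have [b0|bn0] := eqVneq b 0.
  move=> _; rewrite (fourier_coef1 (j :=
    Ordinal d0) lt)// first_coef_0 ?mulr0 ?b0//.
    exact: ratio_lt lt.
  by rewrite qE b0 mul0r.
have cn : d%:R * (- (p1 / p0))^*%C != 0.
  rewrite mulf_neq0 ?conjc_eq0 ?qE ?mulf_neq0 ?invr_eq0//.
  by rewrite pnatr_eq0 -lt0n.
move=> fb; apply: (mulfI cn); rewrite fb p0E qE.
rewrite [X in (X)%:C](_ : _ = d%:R * modulus b ^+ 2 / s); last by ring.
have -> : (b / s%:C)^*%C = b^*%C / s%:C.
  have cs : (s%:C^-1)^*%C = s%:C^-1 by rewrite conjc_inv conjc_real.
  by rewrite rmorphM; congr (_ * _); exact: cs.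
have := mulr_conj b; move: (modulus b ^+ 2) => B hB.
rewrite !(real_complexM, real_complexV, real_complex_nat) -hB.
by ring.
Qed.

End admissible_solution.
End solution.

Theorem theorem2p5 (R : realType) (d : nat) (hd : (3 <= d)%N)
    (a : R) (ha : 0 < a) (b : R[i]) :
  ((exists p0 p1 : R[i], solves_moments a b (@deg1_sympoly R d p0 p1)) <->
     ((modulus b)%:E < (1 - (gamma R d)^-1) * a%:E)%E)
  /\
  (((modulus b)%:E < (1 - (gamma R d)^-1) * a%:E)%E ->
     (exists c : R, admissible d a b c) /\
     (forall c : R, admissible d a b c ->
        (exists p0 p1 : R[i], coef_equation d a b c p0 p1) /\
        (forall p0 p1 : R[i], coef_equation d a b c p0 p1 ->
           solves_moments a b (@deg1_sympoly R d p0 p1)))).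
Proof.
have d0 : (0 < d)%N by exact: leq_trans hd.
have condE := @gamma_condE R d a (modulus b) ha.
have part2 : ((modulus b)%:E < (1 - (gamma R d)^-1) * a%:E)%E ->
     (exists c : R, admissible d a b c) /\
     (forall c : R, admissible d a b c ->
        (exists p0 p1 : R[i], coef_equation d a b c p0 p1) /\
        (forall p0 p1 : R[i], coef_equation d a b c p0 p1 ->
           solves_moments a b (@deg1_sympoly R d p0 p1))).
  move=> /condE cond; split; first exact: admissible_exists.
  move=> c adm; split; first exact: (coef_equation_exists hd ha adm).
  by move=> p0 p1; exact: coef_equation_solves.
split=> //; split; first by move=> [p0 [p1 /(solves_moments_cond hd) /condE]].
move=> /part2[[c adm] h]; have [[p0 [p1 ce]] sol] := h c adm.
by exists p0, p1; exact: sol.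
Qed.
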